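(* The adic space $\mathcal W=\mathrm{Spa}(\Lambda_\infty[1/\pi],\Lambda^+)$ is sheafy, i.e. $(\mathcal O_{\mathcal W},\mathcal O_{\mathcal W}^+)$ is a sheaf. Moreover, for every finite Čech covering by rational opens and every sheaf of coherent $(\mathcal O_{\mathcal W},\mathcal O^+_{\mathcal W})$-modules, the associated Čech complex is acyclic.
   Context: Let $A_{\mathfrak p}$ be the completion of the ring $A$ of functions regular away from $\infty$ on a smooth projective curve over $\mathbb F_p$ at a prime $\mathfrak p$, $\pi$ a uniformizer, $\mathcal O$ a finite unramified extension of $A_{\mathfrak p}$ with valuation $v_\pi$. Let $\Lambda_\infty=\mathcal O[[1+\pi A_{\mathfrak p}]]$. It embeds into the ring $\mathcal C(\mathbb Z_p,\mathcal O)$ of continuous functions via the algebra map sending a group element $1+z$ to the function $s\mapsto(1+z)^s=\sum_{j\ge0}\binom sj z^j$; this extends to $\Lambda_\infty[1/\pi]\hookrightarrow\mathcal C(\mathbb Z_p,\mathcal O[1/\pi])$. Define $\Lambda^+=\{f\in\Lambda_\infty[1/\pi]: v_\pi(f(s))\ge0\text{ for all }s\in\mathbb Z_p\}$ and the weight space $\mathcal W=\mathrm{Spa}(\Lambda_\infty[1/\pi],\Lambda^+)$ (in Huber's sense), an adic space over $\mathrm{Spa}(\mathcal O[1/\pi],\mathcal O)$. *)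

(* Defs.v *)
From HB Require Import structures.
From mathcomp Require Import all_boot all_order all_algebra fieldext.
From mathcomp Require Import all_classical.
From mathcomp Require Import topology_structure.
From mathcomp Require Import ring.

Set Implicit Arguments.
Unset Strict Implicit.
Unset Printing Implicit Defensive.

Import Order.TTheory GRing.Theory Num.Theory.
Local Open Scope classical_set_scope.
Local Open Scope ring_scope.

(* All rings are commutative, and may be zero (comPzRingType): the ring of
   sections over the empty set is zero. *)

Section Subsets.
Variable R : comPzRingType.

Definition is_subring (S : set R) : Prop :=
  [/\ S 1, (forall x y, S x -> S y -> S (x - y))
    & (forall x y, S x -> S y -> S (x * y))].

Definition is_ideal (I : set R) : Prop :=
  [/\ I 0, (forall x y, I x -> I y -> I (x - y))
    & (forall a x, I x -> I (a * x))].

Definition ringgen (S : set R) : set R :=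
  [set x | forall D, is_subring D -> S `<=` D -> D x].

Definition idgen (S : set R) : set R :=
  [set x | forall I, is_ideal I -> S `<=` I -> I x].

Fixpoint ideal_pow (I : set R) (n : nat) : set R :=
  if n is m.+1 then
    idgen [set z | exists x y, [/\ I x, ideal_pow I m y & z = x * y]]
  else setT.

Definition is_prime_ideal (P : set R) : Prop :=
  [/\ is_ideal P, ~ P 1 & forall x y, P (x * y) -> P x \/ P y].

Definition is_unit (x : R) : Prop := exists y, x * y = 1.

(* For a domain R: R is a discrete valuation ring with uniformizer w. *)
Definition uniformizer (w : R) : Prop :=
  [/\ w != 0, ~ is_unit w
    & forall x, x != 0 -> exists u n, is_unit u /\ x = u * w ^+ n].

Definition integrally_closed (S : set R) : Prop :=
  forall (x : R) (n : nat) (c : nat -> R), (forall i, S (c i)) ->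
    x ^+ n = \sum_(i < n) c i * x ^+ i -> S x.

Lemma ringgen_subring (S : set R) : is_subring (ringgen S).
Proof.
split=> [D [D1 _ _] _ //|x y Sx Sy D hD SD|x y Sx Sy D hD SD].
- by have [_ h _] := hD; apply: h; [apply: Sx|apply: Sy].
- by have [_ _ h] := hD; apply: h; [apply: Sx|apply: Sy].
Qed.

Lemma ringgen_sub (S : set R) : S `<=` ringgen S.
Proof. by move=> x Sx D _; apply. Qed.

Lemma idgen_ideal (S : set R) : is_ideal (idgen S).
Proof.
split=> [D [D1 _ _] _ //|x y Sx Sy D hD SD|a x Sx D hD SD].
- by have [_ h _] := hD; apply: h; [apply: Sx|apply: Sy].
- by have [_ _ h] := hD; apply: h; apply: Sx.
Qed.

Lemma idgen_sub (S : set R) : S `<=` idgen S.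
Proof. by move=> x Sx D _; apply. Qed.

Lemma ideal_pow_ideal I n : is_ideal (ideal_pow I n).
Proof. by case: n => [|n]; [split|apply: idgen_ideal]. Qed.

Lemma ideal_pow_decr I n : ideal_pow I n.+1 `<=` ideal_pow I n.
Proof.
elim: n => [//|n IHn] x /= h J hJ SJ; apply: h => // _ [a [b [Ia Jb ->]]].
by apply: SJ; exists a, b; split => //; apply: IHn.
Qed.

Lemma subringD (S : set R) x y : is_subring S -> S x -> S y -> S (x + y).
Proof.
move=> [S1 hB SM] Sx Sy; have S0 : S 0 by rewrite -(subrr 1); apply: hB.
by rewrite -[y]opprK; apply: (hB) => //; rewrite -sub0r; apply: hB.
Qed.

Lemma subring0 (S : set R) : is_subring S -> S 0.
Proof. by move=> [S1 SB SM]; rewrite -(subrr 1); apply: SB. Qed.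

Lemma subringN (S : set R) x : is_subring S -> S x -> S (- x).
Proof. by move=> hS Sx; have [_ h _] := hS; rewrite -sub0r; apply: h => //; apply: subring0. Qed.

Lemma subringX (S : set R) x n : is_subring S -> S x -> S (x ^+ n).
Proof.
by move=> hS Sx; have [S1 _ SM] := hS; elim: n => [|n IHn]; rewrite ?expr0 // exprS; apply: SM.
Qed.

Lemma idealD (S : set R) x y : is_ideal S -> S x -> S y -> S (x + y).
Proof.
move=> [S0 hB SM] Sx Sy.
by rewrite -[y]opprK; apply: (hB) => //; rewrite -sub0r; apply: hB.
Qed.

End Subsets.

Record subRing (R : comPzRingType) (S : set R) (hS : is_subring S) :=
  SubRing { sr_val :> R; sr_prop : S sr_val }.

Section SubRingTheory.
Variables (R : comPzRingType) (S : set R) (hS : is_subring S).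
Local Notation T := (subRing hS).

Lemma sr_inj (x y : T) : sr_val x = sr_val y -> x = y.
Proof. by case: x y => [x hx] [y hy] /= e; subst y; congr SubRing; apply: Prop_irrelevance. Qed.

HB.instance Definition _ := gen_eqMixin T.
HB.instance Definition _ := gen_choiceMixin T.

Let zero : T := SubRing hS (subring0 hS).
Let one : T := SubRing hS (let: And3 h _ _ := hS in h).
Let opp (x : T) : T := SubRing hS (subringN hS (sr_prop x)).
Let add (x y : T) : T := SubRing hS (subringD hS (sr_prop x) (sr_prop y)).
Let mul (x y : T) : T :=
  SubRing hS (let: And3 _ _ h := hS in h _ _ (sr_prop x) (sr_prop y)).

Let addA : associative add. Proof. by move=> x y z; apply: sr_inj; apply: addrA. Qed.
Let addC : commutative add. Proof. by move=> x y; apply: sr_inj; apply: addrC. Qed.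
Let add0 : left_id zero add. Proof. by move=> x; apply: sr_inj; apply: add0r. Qed.
Let addN : left_inverse zero opp add. Proof. by move=> x; apply: sr_inj; apply: addNr. Qed.
HB.instance Definition _ := GRing.isZmodule.Build T addA addC add0 addN.
Let mulA : associative mul. Proof. by move=> x y z; apply: sr_inj; apply: mulrA. Qed.
Let mulC : commutative mul. Proof. by move=> x y; apply: sr_inj; apply: mulrC. Qed.
Let mul1 : left_id one mul. Proof. by move=> x; apply: sr_inj; apply: mul1r. Qed.
Let mulD : left_distributive mul +%R.
Proof. by move=> x y z; apply: sr_inj; apply: mulrDl. Qed.
HB.instance Definition _ := GRing.Zmodule_isComPzRing.Build T mulA mulC mul1 mulD.

Lemma sr_val_additive : zmod_morphism (@sr_val R S hS). Proof. by []. Qed.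
Lemma sr_val_multiplicative : monoid_morphism (@sr_val R S hS). Proof. by []. Qed.
HB.instance Definition _ := GRing.isZmodMorphism.Build T R (@sr_val R S hS) sr_val_additive.
HB.instance Definition _ := GRing.isMonoidMorphism.Build T R (@sr_val R S hS) sr_val_multiplicative.

End SubRingTheory.

Definition prodRing (I : Type) (B : I -> comPzRingType) : Type := forall i, B i.

Section ProdRingTheory.
Variables (I : Type) (B : I -> comPzRingType).
Local Notation T := (prodRing B).

HB.instance Definition _ := gen_eqMixin T.
HB.instance Definition _ := gen_choiceMixin T.

Let zero : T := fun _ => 0.
Let one : T := fun _ => 1.
Let opp (x : T) : T := fun i => - x i.
Let add (x y : T) : T := fun i => x i + y i.
Let mul (x y : T) : T := fun i => x i * y i.

Let addA : associative add. Proof. by move=> x y z; apply: functional_extensionality_dep => i; apply: addrA. Qed.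
Let addC : commutative add. Proof. by move=> x y; apply: functional_extensionality_dep => i; apply: addrC. Qed.
Let add0 : left_id zero add. Proof. by move=> x; apply: functional_extensionality_dep => i; apply: add0r. Qed.
Let addN : left_inverse zero opp add. Proof. by move=> x; apply: functional_extensionality_dep => i; apply: addNr. Qed.
HB.instance Definition _ := GRing.isZmodule.Build T addA addC add0 addN.
Let mulA : associative mul. Proof. by move=> x y z; apply: functional_extensionality_dep => i; apply: mulrA. Qed.
Let mulC : commutative mul. Proof. by move=> x y; apply: functional_extensionality_dep => i; apply: mulrC. Qed.
Let mul1 : left_id one mul. Proof. by move=> x; apply: functional_extensionality_dep => i; apply: mul1r. Qed.
Let mulD : left_distributive mul +%R.
Proof. by move=> x y z; apply: functional_extensionality_dep => i; apply: mulrDl. Qed.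
HB.instance Definition _ := GRing.Zmodule_isComPzRing.Build T mulA mulC mul1 mulD.

End ProdRingTheory.

Record setoidRing := SetoidRing {
  scar :> Type;
  seqv : scar -> scar -> Prop;
  szero : scar; sone : scar; sopp : scar -> scar;
  sadd : scar -> scar -> scar; smul : scar -> scar -> scar;
  seqv_refl : forall x, seqv x x;
  seqv_sym : forall x y, seqv x y -> seqv y x;
  seqv_trans : forall x y z, seqv x y -> seqv y z -> seqv x z;
  sopp_eqv : forall x x', seqv x x' -> seqv (sopp x) (sopp x');
  sadd_eqv : forall x x' y, seqv x x' -> seqv (sadd x y) (sadd x' y);
  smul_eqv : forall x x' y, seqv x x' -> seqv (smul x y) (smul x' y);
  saddA : forall x y z, seqv (sadd x (sadd y z)) (sadd (sadd x y) z);
  saddC : forall x y, seqv (sadd x y) (sadd y x);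
  sadd0 : forall x, seqv (sadd szero x) x;
  saddN : forall x, seqv (sadd (sopp x) x) szero;
  smulA : forall x y z, seqv (smul x (smul y z)) (smul (smul x y) z);
  smulC : forall x y, seqv (smul x y) (smul y x);
  smul1 : forall x, seqv (smul sone x) x;
  smulD : forall x y z, seqv (smul (sadd x y) z) (sadd (smul x z) (smul y z))
}.

Record quo (S : setoidRing) :=
  Quo { quo_set : set S; quo_class : exists x, quo_set = seqv x }.

Section QuoTheory.
Variable S : setoidRing.

Definition cls (x : S) : quo S := Quo (ex_intro _ x erefl).
Definition rep (q : quo S) : S := projT1 (cid (quo_class q)).

Lemma quo_inj (p q : quo S) : quo_set p = quo_set q -> p = q.
Proof. by case: p q => [p hp] [q hq] /= e; subst q; congr Quo; apply: Prop_irrelevance. Qed.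

Lemma repK q : cls (rep q) = q.
Proof. by apply: quo_inj; rewrite /= /rep; case: cid. Qed.

Lemma clsE (x y : S) : cls x = cls y <-> seqv x y.
Proof.
split=> [[e]|h]; first by rewrite e; apply: seqv_refl.
apply: quo_inj; apply/seteqP; split=> z /= hz; last exact: seqv_trans hz.
by apply: seqv_trans hz; apply: seqv_sym.
Qed.

Lemma rep_cls (x : S) : seqv (rep (cls x)) x.
Proof. by apply/clsE; rewrite repK. Qed.

HB.instance Definition _ := gen_eqMixin (quo S).
HB.instance Definition _ := gen_choiceMixin (quo S).

Definition qopp (p : quo S) := cls (sopp (rep p)).
Definition qadd (p q : quo S) := cls (sadd (rep p) (rep q)).
Definition qmul (p q : quo S) := cls (smul (rep p) (rep q)).

Lemma qoppE x : qopp (cls x) = cls (sopp x).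
Proof. by apply/clsE; apply: sopp_eqv; apply: rep_cls. Qed.
Lemma qaddE x y : qadd (cls x) (cls y) = cls (sadd x y).
Proof.
apply/clsE; apply: seqv_trans (sadd_eqv _ (rep_cls x)) _.
apply: seqv_trans (saddC _ _) _; apply: seqv_trans (sadd_eqv _ (rep_cls y)) _.
exact: saddC.
Qed.
Lemma qmulE x y : qmul (cls x) (cls y) = cls (smul x y).
Proof.
apply/clsE; apply: seqv_trans (smul_eqv _ (rep_cls x)) _.
apply: seqv_trans (smulC _ _) _; apply: seqv_trans (smul_eqv _ (rep_cls y)) _.
exact: smulC.
Qed.

Lemma quoP (P : quo S -> Prop) : (forall x, P (cls x)) -> forall q, P q.
Proof. by move=> h q; rewrite -(repK q). Qed.

Let addA : associative qadd.
Proof. by do 3!elim/quoP => ?; rewrite !qaddE; apply/clsE/saddA. Qed.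
Let addC : commutative qadd.
Proof. by do 2!elim/quoP => ?; rewrite !qaddE; apply/clsE/saddC. Qed.
Let add0 : left_id (cls (@szero S)) qadd.
Proof. by elim/quoP => ?; rewrite !qaddE; apply/clsE/sadd0. Qed.
Let addN : left_inverse (cls (@szero S)) qopp qadd.
Proof. by elim/quoP => ?; rewrite !qoppE !qaddE; apply/clsE/saddN. Qed.
HB.instance Definition _ := GRing.isZmodule.Build (quo S) addA addC add0 addN.
Let mulA : associative qmul.
Proof. by do 3!elim/quoP => ?; rewrite !qmulE; apply/clsE/smulA. Qed.
Let mulC : commutative qmul.
Proof. by do 2!elim/quoP => ?; rewrite !qmulE; apply/clsE/smulC. Qed.
Let mul1 : left_id (cls (@sone S)) qmul.
Proof. by elim/quoP => ?; rewrite !qmulE; apply/clsE/smul1. Qed.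
Let mulD : left_distributive qmul +%R.
Proof.
do 3!elim/quoP => ?; rewrite -[LHS]/(qmul (qadd _ _) _) -[RHS]/(qadd (qmul _ _) (qmul _ _)).
by rewrite !(qaddE, qmulE); apply/clsE/smulD.
Qed.
HB.instance Definition _ := GRing.Zmodule_isComPzRing.Build (quo S) mulA mulC mul1 mulD.

Lemma clsD x y : cls (sadd x y) = cls x + cls y. Proof. by rewrite -qaddE. Qed.
Lemma clsM x y : cls (smul x y) = cls x * cls y. Proof. by rewrite -qmulE. Qed.
Lemma clsN x : cls (sopp x) = - cls x. Proof. by rewrite -qoppE. Qed.
Lemma cls0 : cls (@szero S) = 0. Proof. by []. Qed.
Lemma cls1 : cls (@sone S) = 1. Proof. by []. Qed.

End QuoTheory.

Local Obligation Tactic := idtac.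

Section Loc.
Variables (A : comPzRingType) (s : A).

(* The pair (a, k) represents a / s ^+ k. *)
Definition loc_eqv (x y : A * nat) : Prop :=
  exists m, s ^+ m * (x.1 * s ^+ y.2) = s ^+ m * (y.1 * s ^+ x.2).

Let add (x y : A * nat) := (x.1 * s ^+ y.2 + y.1 * s ^+ x.2, (x.2 + y.2)%N).
Let mul (x y : A * nat) := (x.1 * y.1, (x.2 + y.2)%N).

Lemma loc_eqv_trans x y z : loc_eqv x y -> loc_eqv y z -> loc_eqv x z.
Proof.
move=> [m e] [n f]; exists (m + n + y.2)%N.
have -> : s ^+ (m + n + y.2) * (x.1 * s ^+ z.2) =
          s ^+ m * (x.1 * s ^+ y.2) * s ^+ n * s ^+ z.2 by rewrite !exprD; ring.
rewrite e.
have -> : s ^+ m * (y.1 * s ^+ x.2) * s ^+ n * s ^+ z.2 =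
          s ^+ n * (y.1 * s ^+ z.2) * s ^+ m * s ^+ x.2 by ring.
by rewrite f !exprD; ring.
Qed.

Program Definition loc_setoid : setoidRing := {|
  seqv := loc_eqv; szero := (0, 0%N); sone := (1, 0%N);
  sopp := fun x => (- x.1, x.2); sadd := add; smul := mul;
  seqv_trans := loc_eqv_trans |}.
Next Obligation. by move=> x; exists 0%N. Qed.
Next Obligation. by move=> x y [m e]; exists m. Qed.
Next Obligation. by move=> x x' [m e]; exists m; rewrite /= !(mulNr, mulrN) e. Qed.
Next Obligation.
move=> x x' y [m e]; exists m; rewrite /= !(exprD, mulrDl, mulrDr).
congr (_ + _); last by ring.
transitivity (s ^+ m * (x.1 * s ^+ x'.2) * s ^+ y.2 * s ^+ y.2); first by ring.
by rewrite e; ring.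
Qed.
Next Obligation.
move=> x x' y [m e]; exists m; rewrite /= !exprD.
transitivity (s ^+ m * (x.1 * s ^+ x'.2) * y.1 * s ^+ y.2); first by ring.
by rewrite e; ring.
Qed.
Next Obligation. by move=> x y z; exists 0%N; rewrite /= !exprD; ring. Qed.
Next Obligation. by move=> x y; exists 0%N; rewrite /= !exprD; ring. Qed.
Next Obligation. by move=> x; exists 0%N; rewrite /= !exprD; ring. Qed.
Next Obligation. by move=> x; exists 0%N; rewrite /= !exprD; ring. Qed.
Next Obligation. by move=> x y z; exists 0%N; rewrite /= !exprD; ring. Qed.
Next Obligation. by move=> x y; exists 0%N; rewrite /= !exprD; ring. Qed.
Next Obligation. by move=> x; exists 0%N; rewrite /= !exprD; ring. Qed.
Next Obligation. by move=> x y z; exists 0%N; rewrite /= !exprD; ring. Qed.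

Definition loc : comPzRingType := quo loc_setoid.

Definition frac (a : A) (k : nat) : loc := cls ((a, k) : loc_setoid).
Definition loc_in (a : A) : loc := frac a 0.

Lemma loc_in_additive : zmod_morphism loc_in.
Proof.
move=> a b; rewrite /loc_in /frac -clsN -clsD; apply/clsE; exists 0%N.
by rewrite /=; ring.
Qed.
Lemma loc_in_multiplicative : monoid_morphism loc_in.
Proof. by split=> // a b; rewrite /loc_in /frac -clsM. Qed.
HB.instance Definition _ := GRing.isZmodMorphism.Build A loc loc_in loc_in_additive.
HB.instance Definition _ := GRing.isMonoidMorphism.Build A loc loc_in loc_in_multiplicative.

Lemma fracE a k : frac a k = loc_in a * frac 1 k.
Proof. by rewrite /loc_in /frac -clsM; congr cls; congr pair; rewrite /= mulr1. Qed.

Lemma fracP (P : loc -> Prop) : (forall a k, P (frac a k)) -> forall x, P x.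
Proof. by move=> h; apply: quoP => -[a k]; apply: h. Qed.

Lemma frac_mul a k b l : frac a k * frac b l = frac (a * b) (k + l).
Proof. by rewrite /frac -clsM. Qed.

Lemma frac_add a k b l :
  frac a k + frac b l = frac (a * s ^+ l + b * s ^+ k) (k + l).
Proof. by rewrite /frac -clsD. Qed.

Lemma frac_eq a k b l :
  frac a k = frac b l <-> exists m, s ^+ m * (a * s ^+ l) = s ^+ m * (b * s ^+ k).
Proof. by rewrite /frac; apply: iff_trans (clsE _ _) _. Qed.

End Loc.

Section LocLift.
Variables (A B : comPzRingType) (s : A) (f : {rmorphism A -> B}) (b : B).
Hypothesis fsb : f s * b = 1.

Definition loc_lift of f s * b = 1 := fun x : loc s =>
  let r : A * nat := @rep (loc_setoid s) x in f r.1 * b ^+ r.2.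

Lemma loc_liftE a k : loc_lift fsb (frac s a k) = f a * b ^+ k.
Proof.
rewrite /loc_lift; move: (rep_cls ((a, k) : loc_setoid s)) => [m].
set r : A * nat := @rep (loc_setoid s) _; move=> e; move: (congr1 f e); rewrite !rmorphM !rmorphXn /= => e'.
have h n : f s ^+ n * b ^+ n = 1 by rewrite -exprMn fsb expr1n.
transitivity (f s ^+ m * (f r.1 * f s ^+ k) * b ^+ m * b ^+ k * b ^+ r.2).
  transitivity (f r.1 * b ^+ r.2 * (f s ^+ m * b ^+ m) * (f s ^+ k * b ^+ k)); last by ring.
  by rewrite !h !mulr1.
rewrite e'; transitivity (f a * b ^+ k * (f s ^+ m * b ^+ m) * (f s ^+ r.2 * b ^+ r.2)); first by ring.
by rewrite !h !mulr1.
Qed.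

Lemma loc_lift_additive : zmod_morphism (loc_lift fsb).
Proof.
apply: fracP => a k; apply: fracP => c l.
have h n : f s ^+ n * b ^+ n = 1 by rewrite -exprMn fsb expr1n.
have -> : - frac s c l = frac s (- c) l by rewrite /frac -clsN.
rewrite frac_add !loc_liftE rmorphD !rmorphM !rmorphXn rmorphN /= exprD.
transitivity (f a * b ^+ k * (f s ^+ l * b ^+ l) - f c * b ^+ l * (f s ^+ k * b ^+ k)); first by ring.
by rewrite !h !mulr1.
Qed.
Lemma loc_lift_multiplicative : monoid_morphism (loc_lift fsb).
Proof.
split; first by rewrite -[1]/(frac s 1 0) loc_liftE rmorph1 mulr1.
apply: fracP => a k; apply: fracP => c l.
by rewrite frac_mul !loc_liftE rmorphM exprD; ring.
Qed.
HB.instance Definition _ := GRing.isZmodMorphism.Build (loc s) B (loc_lift fsb) loc_lift_additive.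
HB.instance Definition _ := GRing.isMonoidMorphism.Build (loc s) B (loc_lift fsb) loc_lift_multiplicative.

End LocLift.

(* nbd is a fundamental system of neighbourhoods of 0. *)
Record ringTop (R : comPzRingType) := RingTop {
  nbd : nat -> set R;
  nbd0 : forall n, nbd n 0;
  nbdB : forall n x y, nbd n x -> nbd n y -> nbd n (x - y);
  nbd_decr : forall n, nbd n.+1 `<=` nbd n;
  nbd_mull : forall x n, exists m, forall y, nbd m y -> nbd n (x * y);
  nbd_mul : forall n, exists m, forall x y, nbd m x -> nbd m y -> nbd n (x * y)
}.

Program Definition ideals_top (R : comPzRingType) (J : nat -> set R)
    (hJ : forall n, is_ideal (J n)) (dJ : forall n, J n.+1 `<=` J n) :=
  {| nbd := J; nbd_decr := dJ |}.
Next Obligation. by move=> R J hJ _ n; have [] := hJ n. Qed.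
Next Obligation. by move=> R J hJ _ n x y; have [_ h _] := hJ n; apply: h. Qed.
Next Obligation. by move=> R J hJ _ x n; exists n => y; have [_ _ h] := hJ n; apply: h. Qed.
Next Obligation. by move=> R J hJ _ n; exists n => x y _; have [_ _ h] := hJ n; apply: h. Qed.

Definition adic_top (R : comPzRingType) (I : set R) : ringTop R :=
  ideals_top (ideal_pow_ideal I) (@ideal_pow_decr R I).

Section Completion.
Variables (R : comPzRingType) (T : ringTop R).

Definition cauchy (u : nat -> R) : Prop :=
  forall n, exists N, forall i j, (N <= i)%N -> (N <= j)%N -> nbd T n (u i - u j).

Lemma nbdN n x : nbd T n x -> nbd T n (- x).
Proof. by move=> h; rewrite -sub0r; apply: nbdB => //; apply: nbd0. Qed.
Lemma nbdD n x y : nbd T n x -> nbd T n y -> nbd T n (x + y).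
Proof. by move=> hx hy; rewrite -[y]opprK; apply: nbdB => //; apply: nbdN. Qed.
Lemma nbd_le m n : (m <= n)%N -> nbd T n `<=` nbd T m.
Proof.
elim: n => [|n IHn]; first by rewrite leqn0 => /eqP->.
rewrite leq_eqVlt => /orP[/eqP->//|/IHn h]; exact: subset_trans (@nbd_decr _ T n) h.
Qed.

Lemma cauchy_mul_small u v : cauchy u ->
    (forall n, exists N, forall i j, (N <= i)%N -> (N <= j)%N -> nbd T n (v i j)) ->
  forall n, exists N, forall i j, (N <= i)%N -> (N <= j)%N -> nbd T n (u i * v i j).
Proof.
move=> cu cv n; have [m hm] := nbd_mul T n; have [N hN] := cu m.
have [k hk] := nbd_mull T (u N) n; have [M hM] := cv (maxn m k).
exists (maxn N M) => i j; rewrite !geq_max => /andP[Ni Mi] /andP[Nj Mj].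
have hv := hM i j Mi Mj.
rewrite (_ : u i * v i j = u N * v i j + (u i - u N) * v i j); last by ring.
apply: nbdD; first by apply: hk; apply: nbd_le hv; rewrite leq_maxr.
by apply: hm; [apply: hN | apply: nbd_le hv; rewrite leq_maxl].
Qed.

Record cauchySeq := CauchySeq { cs_val :> nat -> R; cs_prop : cauchy cs_val }.

Definition cs_eqv (u v : cauchySeq) : Prop :=
  forall n, exists N, forall i, (N <= i)%N -> nbd T n (u i - v i).

Lemma cauchy_cst x : cauchy (fun=> x).
Proof. by move=> n; exists 0%N => i j _ _; rewrite subrr; apply: nbd0. Qed.
Lemma cauchy_opp u : cauchy u -> cauchy (fun i => - u i).
Proof.
move=> cu n; have [N h] := cu n; exists N => i j hi hj.
by rewrite -opprD; apply: nbdN; apply: h.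
Qed.
Lemma cauchy_add u v : cauchy u -> cauchy v -> cauchy (fun i => u i + v i).
Proof.
move=> cu cv n; have [N h] := cu n; have [M k] := cv n; exists (maxn N M) => i j.
rewrite !geq_max => /andP[Ni Mi] /andP[Nj Mj].
by rewrite opprD addrACA; apply: nbdD; [apply: h|apply: k].
Qed.
Lemma cauchy_mul u v : cauchy u -> cauchy v -> cauchy (fun i => u i * v i).
Proof.
move=> cu cv n.
have [N h] := cauchy_mul_small cu cv n.
have [M k] := cauchy_mul_small cv cu n.
exists (maxn N M) => i j; rewrite !geq_max => /andP[Ni Mi] /andP[Nj Mj].
rewrite (_ : _ - _ = u i * (v i - v j) - v j * (u j - u i)); last by ring.
by apply: nbdB; [apply: h|apply: k].
Qed.

Lemma cs_eqv_of (u v : cauchySeq) : (forall i, u i = v i) -> cs_eqv u v.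
Proof. by move=> h n; exists 0%N => i _; rewrite h subrr; apply: nbd0. Qed.

Program Definition compl_setoid : setoidRing := {|
  scar := cauchySeq; seqv := cs_eqv;
  szero := CauchySeq (cauchy_cst 0); sone := CauchySeq (cauchy_cst 1);
  sopp := fun u => CauchySeq (cauchy_opp (cs_prop u));
  sadd := fun u v => CauchySeq (cauchy_add (cs_prop u) (cs_prop v));
  smul := fun u v => CauchySeq (cauchy_mul (cs_prop u) (cs_prop v)) |}.
Next Obligation. by move=> x; apply: cs_eqv_of. Qed.
Next Obligation.
move=> x y H n; have [N h] := H n; exists N => i hi.
by rewrite -opprB; apply: nbdN; apply: h.
Qed.
Next Obligation.
move=> x y z H H0 n; have [N h] := H n; have [M k] := H0 n; exists (maxn N M) => i.
rewrite geq_max => /andP[Ni Mi].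
by rewrite (_ : _ - _ = (x i - y i) + (y i - z i)); [apply: nbdD; [apply: h|apply: k]|ring].
Qed.
Next Obligation.
move=> x x' H n; have [N h] := H n; exists N => i hi /=.
by rewrite -opprD; apply: nbdN; apply: h.
Qed.
Next Obligation.
move=> x x' y H n; have [N h] := H n; exists N => i hi /=.
by rewrite opprD addrACA subrr addr0; apply: h.
Qed.
Next Obligation.
move=> x x' y H n.
have hx m : exists N, forall i j, (N <= i)%N -> (N <= j)%N ->
    nbd T m ((fun i _ => x i - x' i) i j).
  by have [N h] := H m; exists N => i j hi _; apply: h.
have [N h] := cauchy_mul_small (cs_prop y) hx n.
exists N => i hi /=; rewrite (_ : _ - _ = y i * (x i - x' i)); last by ring.
exact: (h i i).
Qed.
Next Obligation. by move=> x y z; apply: cs_eqv_of => i /=; ring. Qed.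
Next Obligation. by move=> x y; apply: cs_eqv_of => i /=; ring. Qed.
Next Obligation. by move=> x; apply: cs_eqv_of => i /=; ring. Qed.
Next Obligation. by move=> x; apply: cs_eqv_of => i /=; ring. Qed.
Next Obligation. by move=> x y z; apply: cs_eqv_of => i /=; ring. Qed.
Next Obligation. by move=> x y; apply: cs_eqv_of => i /=; ring. Qed.
Next Obligation. by move=> x; apply: cs_eqv_of => i /=; ring. Qed.
Next Obligation. by move=> x y z; apply: cs_eqv_of => i /=; ring. Qed.

Definition compl : comPzRingType := quo compl_setoid.

Definition compl_in (x : R) : compl :=
  cls (CauchySeq (cauchy_cst x) : compl_setoid).

(* The closure in the completion of the image of nbd n. *)
Definition compl_nbd (n : nat) : set compl :=
  [set x | exists u : cauchySeq, x = cls (u : compl_setoid) /\ forall i, nbd T n (u i)].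

Lemma compl_in_additive : zmod_morphism compl_in.
Proof. by move=> a b; rewrite /compl_in -clsN -clsD; apply/clsE/cs_eqv_of. Qed.
Lemma compl_in_multiplicative : monoid_morphism compl_in.
Proof. by split=> // a b; rewrite /compl_in -clsM; apply/clsE/cs_eqv_of. Qed.
HB.instance Definition _ := GRing.isZmodMorphism.Build R compl compl_in compl_in_additive.
HB.instance Definition _ := GRing.isMonoidMorphism.Build R compl compl_in compl_in_multiplicative.

End Completion.

Arguments compl_nbd {R} T n.

Section MonoidRing.
Variables (R : comPzRingType) (M : eqType) (e : M) (op : Monoid.com_law e).

(* A list of pairs (c, g) is the formal sum of the c [g]; two lists are
   equivalent when they have the same coefficients. *)
Definition mcoef (l : seq (R * M)) (g : M) : R := \sum_(x <- l | x.2 == g) x.1.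

Definition mpair (l : seq (R * M)) (f : M -> R) : R := \sum_(x <- l) x.1 * f x.2.

Lemma mpairE l (r : seq M) f : uniq r -> {subset [seq x.2 | x <- l] <= r} ->
  mpair l f = \sum_(g <- r) mcoef l g * f g.
Proof.
move=> ur sr; rewrite /mpair /mcoef.
under [RHS]eq_bigr do rewrite mulr_suml.
rewrite (exchange_big_dep xpredT) //=; apply: eq_big_seq => x xl.
have xr : x.2 \in r by apply: sr; apply: map_f.
rewrite big_mkcond (bigD1_seq x.2) //= eqxx big1 ?addr0 // => g.
by rewrite eq_sym => /negPf->.
Qed.

Lemma mpair_coef l g : mpair l (fun h => (h == g)%:R) = mcoef l g.
Proof.
rewrite /mpair /mcoef [RHS]big_mkcond; apply: eq_bigr => x _.
by case: (x.2 == g); rewrite ?mulr1 ?mulr0.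
Qed.

Lemma mcoef_pair l l' : mcoef l =1 mcoef l' <-> mpair l =1 mpair l'.
Proof.
split=> h; last by move=> g; rewrite -!mpair_coef h.
move=> f; set r := undup ([seq x.2 | x <- l] ++ [seq x.2 | x <- l']).
rewrite !(@mpairE _ r) ?undup_uniq //; first by apply: eq_bigr => g _; rewrite h.
- by move=> g gl; rewrite mem_undup mem_cat gl orbT.
- by move=> g gl; rewrite mem_undup mem_cat gl.
Qed.

Definition mr_mul (l l' : seq (R * M)) : seq (R * M) :=
  [seq (x.1 * y.1, op x.2 y.2) | x <- l, y <- l'].
Definition mr_opp (l : seq (R * M)) := [seq (- x.1, x.2) | x <- l].

Lemma mpair_cat l l' f : mpair (l ++ l') f = mpair l f + mpair l' f.
Proof. by rewrite /mpair big_cat. Qed.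
Lemma mpair_opp l f : mpair (mr_opp l) f = - mpair l f.
Proof. by rewrite /mpair big_map /= -sumrN; apply: eq_bigr => x _; rewrite mulNr. Qed.
Lemma mpair_mul l l' f :
  mpair (mr_mul l l') f = mpair l (fun g => mpair l' (fun h => f (op g h))).
Proof.
rewrite /mpair /mr_mul big_allpairs_dep; apply: eq_bigr => x _.
by rewrite mulr_sumr; apply: eq_bigr => y _; rewrite mulrA.
Qed.
Lemma mpair_mulC l l' f : mpair (mr_mul l l') f = mpair (mr_mul l' l) f.
Proof.
rewrite !mpair_mul /mpair; under eq_bigr do rewrite mulr_sumr.
under [RHS]eq_bigr do rewrite mulr_sumr.
rewrite exchange_big; apply: eq_bigr => y _; apply: eq_bigr => x _.
by rewrite mulrCA (Monoid.mulmC op).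
Qed.
Lemma eq_mpair l f g : f =1 g -> mpair l f = mpair l g.
Proof. by move=> h; apply: eq_bigr => x _; rewrite h. Qed.

Program Definition mr_setoid : setoidRing := {|
  scar := seq (R * M); seqv := fun l l' => mcoef l =1 mcoef l';
  szero := [::]; sone := [:: (1, e)]; sopp := mr_opp;
  sadd := cat; smul := mr_mul |}.
Next Obligation. by []. Qed.
Next Obligation. by move=> x y H g; rewrite H. Qed.
Next Obligation. by move=> x y z H H0 g; rewrite H H0. Qed.
Next Obligation. by move=> x x' /mcoef_pair h; apply/mcoef_pair => f; rewrite !mpair_opp h. Qed.
Next Obligation. by move=> x x' y /mcoef_pair h; apply/mcoef_pair => f; rewrite !mpair_cat h. Qed.
Next Obligation. by move=> x x' y /mcoef_pair h; apply/mcoef_pair => f; rewrite !mpair_mul h. Qed.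
Next Obligation. by move=> x y z; apply/mcoef_pair => f; rewrite !mpair_cat addrA. Qed.
Next Obligation. by move=> x y; apply/mcoef_pair => f; rewrite !mpair_cat addrC. Qed.
Next Obligation. by []. Qed.
Next Obligation. by move=> x; apply/mcoef_pair => f; rewrite mpair_cat mpair_opp addNr /mpair big_nil. Qed.
Next Obligation.
move=> x y z; apply/mcoef_pair => f; rewrite !mpair_mul; apply: eq_mpair => g.
by rewrite !mpair_mul; do 2!apply: eq_mpair => ?; rewrite (Monoid.mulmA op).
Qed.
Next Obligation. by move=> x y; apply/mcoef_pair => f; rewrite mpair_mulC. Qed.
Next Obligation.
move=> x; apply/mcoef_pair => f; rewrite mpair_mul {1}/mpair big_seq1 mul1r.
by apply: eq_mpair => g; rewrite (Monoid.mul1m op).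
Qed.
Next Obligation. by move=> x y z; apply/mcoef_pair => f; rewrite !(mpair_mul, mpair_cat). Qed.

Definition mring : comPzRingType := quo mr_setoid.

Definition mr_mono (c : R) (g : M) : mring := cls ([:: (c, g)] : mr_setoid).

End MonoidRing.
Record opens (X : topologicalType) := Opens { oset :> set X; oset_open : open oset }.

Section Opens.
Variable X : topologicalType.

Definition oinf (U V : opens X) : opens X :=
  Opens (openI (oset_open U) (oset_open V)).

Lemma ocap_open n (V : 'I_n -> opens X) : open (\bigcap_j (V j : set X)).
Proof.
have -> : \bigcap_j (V j : set X) = \big[setI/setT]_(j <- enum 'I_n) (V j : set X).
  rewrite -bigcap_seq; apply/seteqP.
  by split=> x h j _; apply: h => //=; rewrite mem_enum.
by elim/big_ind: _ => [|A B|j _]; [exact: openT|exact: openI|exact: oset_open].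
Qed.

Definition ocap n (V : 'I_n -> opens X) : opens X := Opens (ocap_open V).

End Opens.

(* The gluing condition, for a presheaf of sets F on the opens of X. *)
Definition is_sheaf (X : topologicalType) (F : opens X -> Type)
    (res : forall U V : opens X, V `<=` U -> F U -> F V) : Prop :=
  forall (U : opens X) (I : Type) (V : I -> opens X) (VU : forall i, V i `<=` U),
    U `<=` \bigcup_i (V i : set X) ->
  forall s : (forall i, F (V i)),
    (forall i j, res (V i) (oinf (V i) (V j)) (@subIsetl _ _ _) (s i) =
                 res (V j) (oinf (V i) (V j)) (@subIsetr _ _ _) (s j)) ->
    exists! t : F U, forall i, res U (V i) (VU i) t = s i.

(* pnbhs0 U N : N is a neighbourhood of 0 in the topological ring of sections
   over U. *)
Record ringPresheaf (X : topologicalType) := RingPresheaf {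
  psec :> opens X -> comPzRingType;
  pres : forall U V : opens X, V `<=` U -> {rmorphism psec U -> psec V};
  pres_id : forall (U : opens X) (h : U `<=` U) f, pres h f = f;
  pres_comp : forall (U V W : opens X) (h : V `<=` U) (k : W `<=` V) (l : W `<=` U) f,
    pres l f = pres k (pres h f);
  pnbhs0 : forall U, set (set (psec U))
}.

(* A sheaf of topological rings: a sheaf of rings such that, for every open
   covering, the topology of the ring of sections over U is induced by the
   restrictions to the members of the covering. *)
Definition is_topological_sheaf (X : topologicalType) (O : ringPresheaf X) : Prop :=
  is_sheaf (fun U V h => @pres X O U V h : O U -> O V) /\
  forall (U : opens X) (I : Type) (V : I -> opens X) (VU : forall i, V i `<=` U),
    U `<=` \bigcup_i (V i : set X) ->
  forall N : set (O U), pnbhs0 N <->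
    exists (k : nat) (i : 'I_k -> I) (M : forall j, set (O (V (i j)))),
      (forall j, pnbhs0 (M j)) /\
      [set f | forall j, M j (pres O (VU (i j)) f)] `<=` N.

Record modSheaf (X : topologicalType) (O : ringPresheaf X) := ModSheaf {
  msec :> forall U : opens X, lmodType (O U);
  mres : forall U V : opens X, V `<=` U -> msec U -> msec V;
  mres_add : forall (U V : opens X) (h : V `<=` U) x y,
    mres h (x + y) = mres h x + mres h y;
  mres_scale : forall (U V : opens X) (h : V `<=` U) a x,
    mres h (a *: x) = pres O h a *: mres h x;
  mres_id : forall (U : opens X) (h : U `<=` U) x, mres h x = x;
  mres_comp : forall (U V W : opens X) (h : V `<=` U) (k : W `<=` V) (l : W `<=` U) x,
    mres l x = mres k (mres h x);
  mres_sheaf : is_sheaf mres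
}.

Section Coherent.
Variables (X : topologicalType) (O : ringPresheaf X) (F : modSheaf O).

(* The map of sheaves O^n -> F over U given by e_0, .., e_(n-1) in F(U) is
   surjective. *)
Definition generates (U : opens X) (n : nat) (e : 'I_n -> F U) : Prop :=
  forall (V : opens X) (VU : V `<=` U) (m : F V) (x : X), oset V x ->
    exists (W : opens X) (WV : W `<=` V) (WU : W `<=` U), oset W x /\
      exists a : 'I_n -> O W, mres WV m = \sum_i a i *: mres WU (e i).

Definition finite_type : Prop :=
  forall x : X, exists (U : opens X) (n : nat) (e : 'I_n -> F U), oset U x /\ generates e.

(* a is a section over V of the kernel of the map O^n -> F given by e. *)
Definition is_relation (U : opens X) (n : nat) (e : 'I_n -> F U) (V : opens X)
    (VU : V `<=` U) (a : 'I_n -> O V) : Prop :=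
  \sum_i a i *: mres VU (e i) = 0.

Definition relations_finite_type (U : opens X) (n : nat) (e : 'I_n -> F U) : Prop :=
  forall x : X, oset U x ->
  exists (V : opens X) (VU : V `<=` U) (m : nat) (r : 'I_m -> 'I_n -> O V),
    [/\ oset V x, (forall k, is_relation e VU (r k)) &
      forall (W : opens X) (WV : W `<=` V) (WU : W `<=` U) (a : 'I_n -> O W),
        is_relation e WU a ->
      forall y : X, oset W y ->
        exists (W' : opens X) (W'W : W' `<=` W) (W'V : W' `<=` V), oset W' y /\
          exists b : 'I_m -> O W',
            forall i, pres O W'W (a i) = \sum_k b k * pres O W'V (r k i)].

Definition coherent : Prop :=
  finite_type /\
  forall (U : opens X) (n : nat) (e : 'I_n -> F U), relations_finite_type e.

End Coherent.

Section Cech.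
Variables (X : topologicalType) (O : ringPresheaf X) (F : modSheaf O).
Variables (U : opens X) (n : nat) (V : 'I_n -> opens X).
Hypothesis VU : forall i, V i `<=` U.

Definition cinter (k : nat) (i : 'I_k -> 'I_n) : opens X := ocap (V \o i).

Definition cochain (k : nat) : Type := forall i : 'I_k.+1 -> 'I_n, F (cinter i).

Lemma cinter_lift k (i : 'I_k.+2 -> 'I_n) (j : 'I_k.+2) :
  cinter i `<=` cinter (i \o lift j).
Proof. by move=> x h l _; apply: h. Qed.

Lemma cinter_sub (i : 'I_1 -> 'I_n) : cinter i `<=` U.
Proof. by move=> x h; apply: VU (h ord0 I). Qed.

Definition cdiff k (c : cochain k) : cochain k.+1 :=
  fun i => \sum_(j < k.+2) (-1) ^+ j *: mres (@cinter_lift k i j) (c (i \o lift j)).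

Definition caugment (s : F U) : cochain 0 := fun i => mres (@cinter_sub i) s.

(* Exactness of 0 -> F(U) -> C^0 -> C^1 -> ... *)
Definition cech_acyclic : Prop :=
  [/\ (forall s : F U, (forall i, caugment s i = 0) -> s = 0),
      (forall c : cochain 0, (forall i, cdiff c i = 0) ->
         exists s : F U, forall i, c i = caugment s i)
    & (forall k (c : cochain k.+1), (forall i, cdiff c i = 0) ->
         exists b : cochain k, forall i, c i = cdiff b i)].

End Cech.

Record orderedGroup := OrderedGroup {
  ogrp :> zmodType;
  ogle : ogrp -> ogrp -> Prop;
  ogle_refl : forall x, ogle x x;
  ogle_anti : forall x y, ogle x y -> ogle y x -> x = y;
  ogle_trans : forall x y z, ogle x y -> ogle y z -> ogle x z;
  ogle_total : forall x y, ogle x y \/ ogle y x;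
  ogle_add : forall x y z, ogle x y -> ogle (z + x) (z + y)
}.

(* The ordered monoid obtained by adjoining a least, absorbing element None to
   an ordered group, the group being written additively. *)
Definition ole (G : orderedGroup) (x y : option G) : Prop :=
  match x, y with
  | None, _ => True
  | Some _, None => False
  | Some a, Some b => ogle a b
  end.
Definition olt (G : orderedGroup) (x y : option G) : Prop := ~ ole y x.
Definition omul (G : orderedGroup) (x y : option G) : option G :=
  match x, y with Some a, Some b => Some (a + b) | _, _ => None end.

(* Valuations are multiplicative: None is the value of 0, Some 0 that of 1. *)
Record valuation (R : comPzRingType) := Valuation {
  vgrp : orderedGroup;
  vfun :> R -> option vgrp;
  vfun0 : vfun 0 = None;
  vfun1 : vfun 1 = Some 0;
  vfunM : forall x y, vfun (x * y) = omul (vfun x) (vfun y);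
  vfunD : forall x y, ole (vfun (x + y)) (vfun x) \/ ole (vfun (x + y)) (vfun y)
}.

(* Two valuations are equivalent if and only if they define the same vrel. *)
Definition vrel (R : comPzRingType) (v : valuation R) : R -> R -> Prop :=
  fun x y => ole (v x) (v y).

(* v is continuous for the topology with basis nb of neighbourhoods of 0; the
   differences g - h run over the subgroup generated by the nonzero values. *)
Definition vcontinuous (R : comPzRingType) (nb : nat -> set R) (v : valuation R) : Prop :=
  forall (a b : R) (g h : vgrp v), v a = Some g -> v b = Some h ->
    exists n, forall x, nb n x -> olt (v x) (Some (g - h)).

Section ValuationTheory.
Variables (R : comPzRingType) (v : valuation R).
Local Notation le1 x := (ole (v x) (Some 0)).

Lemma ole_trans (G : orderedGroup) (x y z : option G) : ole x y -> ole y z -> ole x z.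
Proof. by case: x y z => [x|] [y|] [z|] //=; apply: ogle_trans. Qed.

Lemma vfunN1 : v (-1) = Some 0.
Proof.
have := vfunM v (-1) (-1); rewrite mulrNN mulr1 vfun1.
case: (v (-1)) => [g|] //= [/esym e]; congr Some.
have [h|h] := ogle_total g 0; apply: ogle_anti => //.
  by have := ogle_add g h; rewrite e addr0.
by have := ogle_add g h; rewrite e addr0.
Qed.

Lemma vle1_subring : is_subring [set x | le1 x].
Proof.
have hN x : v (- x) = v x.
  by rewrite -mulN1r vfunM vfunN1; case: (v x) => [g|] //=; rewrite add0r.
split=> /= [|x y hx hy|x y hx hy]; first by rewrite vfun1; apply: ogle_refl.
- by have [h|h] := vfunD v x (- y); apply: (ole_trans h); rewrite ?hN.
rewrite vfunM; case: (v x) (v y) hx hy => [g|] [h|] //= hg hh.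
by apply: ogle_trans hg; rewrite -[X in ogle _ X]addr0; apply: ogle_add.
Qed.

End ValuationTheory.

(* The topology of the ring has the sets tpi ^+ n * tdef as basis of
   neighbourhoods of 0: tdef is a ring of definition, with ideal of definition
   generated by the topologically nilpotent unit tpi. *)
Record tatePair := TatePair {
  tring :> comPzRingType;
  tdef : set tring;
  tpi : tring;
  tplus : set tring;
  tdef_subring : is_subring tdef;
  tpi_def : tdef tpi;
  tpi_unit : is_unit tpi;
  tdef_absorb : forall a, exists n, tdef (tpi ^+ n * a);
  tplus_subring : is_subring tplus;
  tplus_open : exists n, forall a, tdef a -> tplus (tpi ^+ n * a);
  tplus_bounded : forall a, tplus a -> exists n, forall k, tdef (tpi ^+ n * a ^+ k);
  tplus_closed : integrally_closed tplus
}.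

Definition tnbd (A : tatePair) (n : nat) : set A :=
  [set x | exists a, tdef a /\ x = tpi A ^+ n * a].

Record spa (A : tatePair) := Spa {
  sprel : A -> A -> Prop;
  spP : exists v : valuation A,
    [/\ vcontinuous (@tnbd A) v,
        (forall a, tplus a -> ole (v a) (Some 0))
      & sprel = vrel v]
}.

HB.instance Definition _ (A : tatePair) := gen_eqMixin (spa A).
HB.instance Definition _ (A : tatePair) := gen_choiceMixin (spa A).

(* The topology of the adic spectrum is generated by the sets
   { x | |f(x)| <= |g(x)| <> 0 }. *)
Definition spa_subbase (A : tatePair) : set (set (spa A)) :=
  [set B | exists f g : A, B = [set x | sprel x f g /\ ~ sprel x g 0]].

HB.instance Definition _ (A : tatePair) :=
  @isSubBaseTopological.Build (spa A) (set (spa A)) (@spa_subbase A) id.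

(* A presentation of a rational subset R(T / s): in a Tate ring, an ideal is
   open if and only if it is the unit ideal. *)
Record ratDatum (A : tatePair) := RatDatum {
  rat_T : seq A;
  rat_s : A;
  rat_open : idgen [set` rat_T] 1
}.

Section Rational.
Variables (A : tatePair) (r : ratDatum A).

Definition rset : set (spa A) :=
  [set x | (forall t, t \in rat_T r -> sprel x t (rat_s r)) /\ ~ sprel x (rat_s r) 0].

Definition rloc : comPzRingType := loc (rat_s r).

(* The ring of definition A_0[t / s : t in T] of A[1/s]. *)
Definition rdef : set rloc :=
  ringgen ((loc_in (rat_s r) @` @tdef A) `|` [set frac (rat_s r) t 1 | t in [set` rat_T r]]).

Let pi : rloc := loc_in (rat_s r) (tpi A).

Lemma rdef_pi : rdef pi.
Proof. by apply: ringgen_sub; left; exists (tpi A) => //; apply: tpi_def. Qed.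

Lemma rdef_absorb (x : rloc) : exists n, rdef (pi ^+ n * x).
Proof.
have hD : is_subring rdef by apply: ringgen_subring.
have [D1 DB DM] := hD.
pose B : set rloc := [set x | exists n, rdef (pi ^+ n * x)].
have DX n : rdef (pi ^+ n) by exact: (subringX n hD rdef_pi).
have hB : is_subring B.
  split=> [|y z [m hy] [n hz]|y z [m hy] [n hz]]; first by exists 0%N; rewrite mul1r.
  - exists (m + n)%N; rewrite mulrBr exprD; apply: DB.
      by rewrite mulrAC; apply: DM.
    by rewrite -mulrA; apply: DM.
  - exists (m + n)%N.
    by rewrite (_ : _ * _ = (pi ^+ m * y) * (pi ^+ n * z)); [apply: DM|rewrite exprD; ring].
have [B1 BB BM] := hB.
have hA a : B (loc_in (rat_s r) a).
  have [n h] := tdef_absorb a; exists n; rewrite /pi -rmorphXn -rmorphM.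
  by apply: ringgen_sub; left; exists (tpi A ^+ n * a).
have hs : B (frac (rat_s r) 1 1).
  have := @rat_open _ r [set a | B (frac (rat_s r) a 1)]; apply.
  - split=> [|a b|a b].
    + by rewrite /= fracE rmorph0 mul0r; apply: subring0.
    + rewrite /= (fracE _ a) (fracE _ b) (fracE _ (a - b)) rmorphB mulrBl.
      exact: BB.
    + rewrite /= (fracE _ b) (fracE _ (a * b)) rmorphM -mulrA => hb.
      exact: (BM _ _ (hA a) hb).
  - move=> t Tt; exists 0%N; rewrite mul1r; apply: ringgen_sub; right.
    by exists t.
have hk k : B (frac (rat_s r) 1 k).
  elim: k => [//|k IHk]; rewrite -addn1 -(mulr1 1) -frac_mul.
  exact: (BM _ _ IHk hs).
suff: B x by [].
elim/fracP: x => a k; rewrite fracE; exact: (BM _ _ (hA a) (hk k)).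
Qed.

Definition rnbd (n : nat) : set rloc := [set x | exists d, rdef d /\ x = pi ^+ n * d].

Program Definition rtop : ringTop rloc := {| nbd := rnbd |}.
Next Obligation.
move=> n; exists 0; rewrite mulr0; split=> //.
by apply: subring0; apply: ringgen_subring.
Qed.
Next Obligation.
move=> n _ _ [d [hd ->]] [d' [hd' ->]]; exists (d - d'); rewrite mulrBr; split=> //.
by have [_ h _] : is_subring rdef by [exact: ringgen_subring]; apply: h.
Qed.
Next Obligation.
move=> n _ [d [hd ->]]; exists (pi * d); rewrite mulrA -exprSr; split=> //.
have [_ _ h] : is_subring rdef by exact: ringgen_subring.
by apply: h => //; apply: rdef_pi.
Qed.
Next Obligation.
move=> x n; have [k hk] := rdef_absorb x; exists (n + k)%N => _ [d [hd ->]].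
exists (pi ^+ k * x * d); split; last by rewrite exprD; ring.
by have [_ _ h] : is_subring rdef by [exact: ringgen_subring]; apply: h.
Qed.
Next Obligation.
move=> n; exists n => _ _ [d [hd ->]] [d' [hd' ->]].
exists (pi ^+ n * (d * d')); split; last by ring.
have hD : is_subring rdef by exact: ringgen_subring.
have [_ _ h] := hD; apply: (h); last exact: h.
exact: (subringX n hD rdef_pi).
Qed.

(* The ring A<T / s>. *)
Definition rcompl : comPzRingType := compl rtop.
Definition rstr : A -> rcompl := compl_in rtop \o loc_in (rat_s r).

End Rational.

(* t is the continuous homomorphism of A-algebras A<T/s> -> A<T'/s'>; it is unique,
   and exists as soon as R(T'/s') is contained in R(T/s) (universal property of
   rational localizations). *)
Definition rtransition (A : tatePair) (r r' : ratDatum A)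
    (t : {rmorphism rcompl r -> rcompl r'}) : Prop :=
  (forall a, t (rstr r a) = rstr r' a) /\
  (forall n, exists m, forall x, compl_nbd (rtop r) m x -> compl_nbd (rtop r') n (t x)).

Section StructurePresheaf.
Variable A : tatePair.

(* The sections over U are the limit of the rings A<T / s>, over all the
   presentations of rational subsets contained in U. *)
Definition ratIn (U : opens (spa A)) : Type := {r : ratDatum A | rset r `<=` U}.

Definition rfam (U : opens (spa A)) : comPzRingType :=
  prodRing (fun r : ratIn U => rcompl (sval r)).

Definition rcompat (U : opens (spa A)) : set (rfam U) :=
  [set f | forall r r' : ratIn U, rset (sval r') `<=` rset (sval r) ->
     forall t : {rmorphism rcompl (sval r) -> rcompl (sval r')},
       rtransition t -> t (f r) = f r'].

Lemma rcompat_subring U : is_subring (@rcompat U).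
Proof.
split=> [r r' h t _|f g hf hg r r' h t ht|f g hf hg r r' h t ht].
- exact: rmorph1.
- by rewrite [LHS]rmorphB (hf _ _ h _ ht) (hg _ _ h _ ht).
- by rewrite [LHS]rmorphM (hf _ _ h _ ht) (hg _ _ h _ ht).
Qed.

Definition osec (U : opens (spa A)) : comPzRingType := subRing (@rcompat_subring U).

Definition oval (U : opens (spa A)) (f : osec U) (r : ratIn U) : rcompl (sval r) :=
  sr_val f r.

Section Restriction.
Variables (U V : opens (spa A)) (VU : V `<=` U).

Definition ratIn_widen (r : ratIn V) : ratIn U :=
  exist _ (sval r) (subset_trans (svalP r) VU).

Lemma ores_compat (f : osec U) :
  @rcompat V (fun r : ratIn V => oval f (ratIn_widen r)).
Proof. by move=> r r' h t ht; apply: (sr_prop f (ratIn_widen r) (ratIn_widen r')). Qed.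

Definition ores (f : osec U) : osec V := SubRing (@rcompat_subring V) (ores_compat f).

Lemma ores_additive : zmod_morphism ores.
Proof. by move=> f g; apply: sr_inj. Qed.
Lemma ores_multiplicative : monoid_morphism ores.
Proof. by split=> [|f g]; apply: sr_inj. Qed.
HB.instance Definition _ := GRing.isZmodMorphism.Build (osec U) (osec V) ores ores_additive.
HB.instance Definition _ :=
  GRing.isMonoidMorphism.Build (osec U) (osec V) ores ores_multiplicative.

End Restriction.

Lemma rfam_irr (U : opens (spa A)) (f : rfam U) (r : ratDatum A)
  (h h' : rset r `<=` U) : f (exist _ r h) = f (exist _ r h') :> rcompl r.
Proof. by rewrite (Prop_irrelevance h h'). Qed.

Lemma ores_id (U : opens (spa A)) (h : U `<=` U) (f : osec U) : ores h f = f.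
Proof.
by apply: sr_inj; apply: functional_extensionality_dep => -[r hr]; exact: (rfam_irr (sr_val f)).
Qed.

Lemma ores_comp (U V W : opens (spa A)) (h : V `<=` U) (k : W `<=` V) (l : W `<=` U)
  (f : osec U) : ores l f = ores k (ores h f).
Proof.
by apply: sr_inj; apply: functional_extensionality_dep => -[r hr]; exact: (rfam_irr (sr_val f)).
Qed.

Definition onbhs0 (U : opens (spa A)) : set (set (osec U)) :=
  [set N | exists (k : nat) (r : 'I_k -> ratIn U) (n : 'I_k -> nat),
     [set f | forall j, compl_nbd (rtop (sval (r j))) (n j) (oval f (r j))] `<=` N].

Definition structure_presheaf : ringPresheaf (spa A) :=
  @RingPresheaf _ osec (fun U V h => ores h) ores_id ores_comp onbhs0.

(* The sections of absolute value at most 1 at every point x of U; the absolute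
   value at x of a section over R(T/s) is that of the continuous extension of x
   to A<T/s>. *)
Definition oplus (U : opens (spa A)) : set (osec U) :=
  [set f | forall (r : ratIn U) (v : valuation (rcompl (sval r))) (x : spa A),
     rset (sval r) x -> vcontinuous (compl_nbd (rtop (sval r))) v ->
     (sprel x = fun a b => ole (v (rstr (sval r) a)) (v (rstr (sval r) b))) ->
     ole (v (oval f r)) (Some 0)].

Lemma oplus_subring U : is_subring (@oplus U).
Proof.
split=> [r v x _ _ _|f g hf hg r v x hx hv hr|f g hf hg r v x hx hv hr].
- by have [h _ _] := vle1_subring v; apply: h.
- by have [_ h _] := vle1_subring v; apply: h; [apply: hf hr|apply: hg hr].
- by have [_ _ h] := vle1_subring v; apply: h; [apply: hf hr|apply: hg hr].
Qed.

Definition oplus_sec (U : opens (spa A)) : comPzRingType := subRing (@oplus_subring U).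

Section RestrictionPlus.
Variables (U V : opens (spa A)) (VU : V `<=` U).

Lemma oplus_res_subproof (f : oplus_sec U) : oplus (ores VU (sr_val f)).
Proof. by move=> r; apply: (sr_prop f (ratIn_widen VU r)). Qed.

Definition oplus_res (f : oplus_sec U) : oplus_sec V :=
  SubRing (@oplus_subring V) (oplus_res_subproof f).

Lemma oplus_res_additive : zmod_morphism oplus_res.
Proof. by move=> f g; apply: sr_inj; apply: (rmorphB (ores VU)). Qed.
Lemma oplus_res_multiplicative : monoid_morphism oplus_res.
Proof.
split=> [|f g]; apply: sr_inj; first exact: (rmorph1 (ores VU)).
exact: (rmorphM (ores VU)).
Qed.
HB.instance Definition _ :=
  GRing.isZmodMorphism.Build (oplus_sec U) (oplus_sec V) oplus_res oplus_res_additive.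
HB.instance Definition _ :=
  GRing.isMonoidMorphism.Build (oplus_sec U) (oplus_sec V) oplus_res oplus_res_multiplicative.

End RestrictionPlus.

Lemma oplus_res_id (U : opens (spa A)) (h : U `<=` U) (f : oplus_sec U) :
  oplus_res h f = f.
Proof. by apply: sr_inj; apply: ores_id. Qed.

Lemma oplus_res_comp (U V W : opens (spa A)) (h : V `<=` U) (k : W `<=` V) (l : W `<=` U)
  (f : oplus_sec U) : oplus_res l f = oplus_res k (oplus_res h f).
Proof. by apply: sr_inj; apply: ores_comp. Qed.

Definition oplus_nbhs0 (U : opens (spa A)) : set (set (oplus_sec U)) :=
  [set N | exists M, onbhs0 M /\ [set f : oplus_sec U | M (sr_val f)] `<=` N].

Definition structure_presheaf_plus : ringPresheaf (spa A) :=
  @RingPresheaf _ oplus_sec (fun U V h => oplus_res h) oplus_res_id oplus_res_comp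
    oplus_nbhs0.

Definition is_rational (U : opens (spa A)) : Prop := exists r : ratDatum A, rset r = U.

(* Acyclicity of O-modules, O being one of the two presheaves above, for the
   finite coverings of rational opens by rational opens. *)
Definition coherent_acyclic (O : ringPresheaf (spa A)) : Prop :=
  forall (F : modSheaf O), coherent F ->
  forall (U : opens (spa A)) (n : nat) (V : 'I_n -> opens (spa A))
    (VU : forall i, V i `<=` U),
    is_rational U -> (forall i, is_rational (V i)) ->
    U `<=` \bigcup_i (V i : set (spa A)) -> cech_acyclic F VU.

End StructurePresheaf.
(* A finite extension L of F_p(t) is the function field of a smooth projective
   curve over F_p, whose closed points are the normalized discrete valuations of
   L; the valuation at 0 is left unspecified. *)
Record place (L : fieldType) := Place {
  plv :> L -> int;
  plvM : forall x y, x != 0 -> y != 0 -> plv (x * y) = plv x + plv y;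
  plvD : forall x y, x != 0 -> y != 0 -> x + y != 0 ->
    (plv x <= plv (x + y)) || (plv y <= plv (x + y));
  plv_surj : exists2 x, x != 0 & plv x = 1
}.

Section RegularRing.
Variables (L : fieldType) (inf : place L).

Definition same_place (v w : place L) : Prop := forall x, x != 0 -> v x = w x.

Definition regular_away : set L :=
  [set f | f != 0 -> forall v : place L, ~ same_place v inf -> 0 <= v f].

Lemma plv1 (v : place L) : v 1 = 0.
Proof.
have h1 : (1 : L) != 0 by apply: oner_neq0.
by have /eqP := plvM v h1 h1; rewrite mulr1 -subr_eq0 opprD addNKr oppr_eq0 => /eqP.
Qed.

Lemma plvN (v : place L) x : x != 0 -> v (- x) = v x.
Proof.
move=> hx; have h1 : (-1 : L) != 0 by rewrite oppr_eq0 oner_neq0.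
rewrite -mulN1r plvM //; have := plvM v h1 h1; rewrite mulrNN mulr1 plv1.
by move/esym/eqP; rewrite -mulr2n mulrn_eq0 /= => /eqP->; rewrite add0r.
Qed.

Lemma regular_away_subring : is_subring regular_away.
Proof.
split=> [_ v _|f g hf hg h v hv|f g hf hg h v hv]; first by rewrite plv1.
- have [f0|f0] := eqVneq f 0.
    by move: h; rewrite f0 sub0r oppr_eq0 => g0; rewrite plvN //; apply: hg.
  have [g0|g0] := eqVneq g 0; first by rewrite g0 subr0; apply: hf.
  have g0' : - g != 0 by rewrite oppr_eq0.
  have /orP[] := plvD v f0 g0' h; apply: le_trans; first exact: hf.
  by rewrite plvN //; apply: hg.
- move: h; rewrite mulf_eq0 negb_or => /andP[f0 g0].
  by rewrite plvM // addr_ge0 // ?hf ?hg.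
Qed.

Definition regularRing : comPzRingType := subRing regular_away_subring.

End RegularRing.

Definition primeCompl (R : comPzRingType) (P : set R) : comPzRingType :=
  compl (adic_top P).

(* The group 1 + w R; only its monoid structure is needed. *)
Record oneUnit (R : comPzRingType) (w : R) :=
  OneUnit { ou_val :> R; ou_prop : exists y, ou_val = 1 + w * y }.

Section OneUnits.
Variables (R : comPzRingType) (w : R).

Lemma ou_inj (g h : oneUnit w) : g = h :> R -> g = h.
Proof. by case: g h => [g hg] [h hh] /= e; subst g; congr OneUnit; apply: Prop_irrelevance. Qed.

HB.instance Definition _ := gen_eqMixin (oneUnit w).
HB.instance Definition _ := gen_choiceMixin (oneUnit w).

Lemma ou_one_subproof : exists y, 1 = 1 + w * y.
Proof. by exists 0; rewrite mulr0 addr0. Qed.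
Lemma ou_mul_subproof (g h : oneUnit w) : exists y, (g : R) * (h : R) = 1 + w * y.
Proof.
have [y ->] := ou_prop g; have [z ->] := ou_prop h.
by exists (y + z + y * (w * z)); ring.
Qed.

Definition ou_one : oneUnit w := OneUnit ou_one_subproof.
Definition ou_mul (g h : oneUnit w) : oneUnit w := OneUnit (ou_mul_subproof g h).

Lemma ou_mulA : associative ou_mul.
Proof. by move=> g h k; apply: ou_inj; apply: mulrA. Qed.
Lemma ou_mulC : commutative ou_mul.
Proof. by move=> g h; apply: ou_inj; apply: mulrC. Qed.
Lemma ou_mul1 : left_id ou_one ou_mul.
Proof. by move=> g; apply: ou_inj; apply: mul1r. Qed.
HB.instance Definition _ :=
  Monoid.isComLaw.Build (oneUnit w) ou_one ou_mul ou_mulA ou_mulC ou_mul1.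

End OneUnits.

Section Iwasawa.
Variables (R O : comPzRingType) (w : R) (iota : {rmorphism R -> O}).

Definition groupRing : comPzRingType := mring O (@ou_mul R w).

Definition gr_const (c : O) : groupRing := mr_mono (@ou_mul R w) c (ou_one w).
Definition gr_grp (g : oneUnit w) : groupRing := mr_mono (@ou_mul R w) 1 g.

(* The kernel of O[G] -> (O / w^n)[G / G_n], where G = 1 + w R and
   G_n = G `&` (1 + w^n R). *)
Definition iwasawa_ideal (n : nat) : set groupRing :=
  idgen (gr_const (iota w ^+ n) |`
    [set z | exists g h : oneUnit w,
       (exists y, (g : R) - (h : R) = w ^+ n * y) /\ z = gr_grp g - gr_grp h]).

Lemma iwasawa_ideal_decr n : iwasawa_ideal n.+1 `<=` iwasawa_ideal n.
Proof.
move=> x /= hx; apply: hx (idgen_ideal _) _ => _ [->|[g [h [[y e] ->]]]].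
  have -> : gr_const (iota w ^+ n.+1) = gr_const (iota w) * gr_const (iota w ^+ n).
    rewrite /gr_const /mr_mono -clsM; congr cls.
    by rewrite /= /mr_mul /= -exprS; congr [:: (_, _)]; rewrite ou_mul1.
  have [_ _ hM] : is_ideal (iwasawa_ideal n) by apply: idgen_ideal.
  by apply: hM; apply: idgen_sub; left.
apply: idgen_sub; right; exists g, h; split=> //.
by exists (w * y); rewrite e exprSr mulrA.
Qed.

Definition iwasawa_top : ringTop groupRing :=
  @ideals_top groupRing iwasawa_ideal (fun n => idgen_ideal _) iwasawa_ideal_decr.

Definition iwasawa : comPzRingType := compl iwasawa_top.

Definition iw_const (c : O) : iwasawa := compl_in iwasawa_top (gr_const c).
Definition iw_grp (g : oneUnit w) : iwasawa := compl_in iwasawa_top (gr_grp g).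

End Iwasawa.

Definition padic_top (p : nat) : ringTop int := adic_top [set x : int | exists y, x = p%:Z * y].
Definition padicInt (p : nat) : comPzRingType := compl (padic_top p).

(* For O of characteristic p, the image in O of the binomial coefficient of s
   and j: the common value of the binomial coefficients of m and j, for all the
   natural numbers m close enough to s. *)
Definition binZp (p : nat) (O : comPzRingType) (s : padicInt p) (j : nat) : O :=
  xget 0 [set c : O | exists N, forall m : nat,
    compl_nbd (padic_top p) N (s - m%:R) -> c = 'C(m, j)%:R].

Definition adic_lim (O : comPzRingType) (w : O) (u : nat -> O) (l : O) : Prop :=
  forall n, exists N, forall i, (N <= i)%N -> exists c, u i - l = w ^+ n * c.

Section WeightMap.
Variables (p : nat) (R O : comPzRingType) (w : R) (iota : {rmorphism R -> O}).

(* ev is the continuous homomorphism of O-algebras from O[[1 + w R]] to the ring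
   of continuous functions from Z_p to O that sends the group element 1 + z to
   the function s |-> (1 + z)^s = \sum_j binom(s, j) z^j. *)
Definition is_weight_map (ev : {rmorphism iwasawa w iota -> (padicInt p -> O)}) : Prop :=
  [/\ (forall c s, ev (iw_const w iota c) s = c),
      (forall l s n, exists m, forall t, compl_nbd (padic_top p) m (t - s) ->
         exists c, ev l t - ev l s = iota w ^+ n * c),
      (forall n, exists m, forall l, compl_nbd (iwasawa_top w iota) m l ->
         forall s, exists c, ev l s = iota w ^+ n * c)
    & (forall (g : oneUnit w) s,
         adic_lim (iota w)
           (fun k => \sum_(j < k) binZp O s j * iota ((g : R) - 1) ^+ j)
           (ev (iw_grp iota g) s))].

End WeightMap.

Section WeightPair.
Variables (O : idomainType) (w : O).
Hypothesis hw : uniformizer w.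
Variables (Lam : comPzRingType) (wL : Lam) (S : Type) (ev : {rmorphism Lam -> (S -> O)}).
Hypothesis ev_w : forall s, ev wL s = w.

Local Notation K := {fraction O}.
Local Notation "x %:F" := (@FracField.tofrac O x).

(* v_w(x) >= n, for the w-adic valuation v_w of O[1/w] = K. *)
Definition vge (x : K) (n : int) : Prop := exists c : O, x = c%:F * w%:F ^ n.

Definition evF (s : S) (l : Lam) : K := (ev l s)%:F.

Lemma evF_additive s : zmod_morphism (evF s).
Proof. by move=> a b; rewrite /evF (rmorphB ev); apply: rmorphB. Qed.
Lemma evF_multiplicative s : monoid_morphism (evF s).
Proof.
split=> [|a b]; rewrite /evF ?(rmorph1 ev) ?(rmorphM ev); first exact: rmorph1.
exact: rmorphM.
Qed.
HB.instance Definition _ s := GRing.isZmodMorphism.Build Lam K (evF s) (evF_additive s).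
HB.instance Definition _ s := GRing.isMonoidMorphism.Build Lam K (evF s) (evF_multiplicative s).

Lemma w_neq0 : w != 0. Proof. by have [] := hw. Qed.
Lemma wF_neq0 : w%:F != 0. Proof. by rewrite tofrac_eq0 w_neq0. Qed.

Lemma evF_w s : evF s wL * (w%:F)^-1 = 1.
Proof. by rewrite /evF ev_w divff // wF_neq0. Qed.

(* The value at s of an element of Lam[1/w]. *)
Definition evK (s : S) : loc wL -> K := loc_lift (evF_w s).

Lemma evK_additive s : zmod_morphism (evK s).
Proof. exact: (rmorphB (loc_lift (evF_w s))). Qed.
Lemma evK_multiplicative s : monoid_morphism (evK s).
Proof.
by split; [exact: (rmorph1 (loc_lift (evF_w s)))|exact: (rmorphM (loc_lift (evF_w s)))].
Qed.
HB.instance Definition _ s := GRing.isZmodMorphism.Build (loc wL) K (evK s) (evK_additive s).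
HB.instance Definition _ s :=
  GRing.isMonoidMorphism.Build (loc wL) K (evK s) (evK_multiplicative s).

Definition weight_plus : set (loc wL) := [set f | forall s, vge (evK s f) 0].

Lemma vge0 (x : K) : vge x 0 <-> exists c : O, x = c%:F.
Proof. by split=> -[c ->]; exists c; rewrite expr0z mulr1. Qed.

Lemma evK_frac s a k : evK s (frac wL a k) = (ev a s)%:F * (w%:F)^-1 ^+ k.
Proof. exact: loc_liftE. Qed.

Lemma weight_plus_subring : is_subring weight_plus.
Proof.
split=> [s|f g hf hg s|f g hf hg s]; apply/vge0.
- by exists 1; rewrite !rmorph1.
- have [a ea] := (vge0 _).1 (hf s); have [b eb] := (vge0 _).1 (hg s); exists (a - b).
  by rewrite rmorphB /= ea eb -rmorphB.
- have [a ea] := (vge0 _).1 (hf s); have [b eb] := (vge0 _).1 (hg s); exists (a * b).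
  by rewrite rmorphM /= ea eb -rmorphM.
Qed.

Lemma weight_pi_plus : weight_plus (loc_in wL wL).
Proof. by move=> s; apply/vge0; exists w; rewrite evK_frac ev_w expr0 mulr1. Qed.

Lemma weight_pi_unit : is_unit (loc_in wL wL).
Proof.
exists (frac wL 1 1); rewrite frac_mul; apply/frac_eq.
by exists 0%N; rewrite !mulr1 expr0 expr1 !mul1r.
Qed.

Lemma weight_absorb f : exists n, weight_plus (loc_in wL wL ^+ n * f).
Proof.
elim/fracP: f => a k; exists k => s; apply/vge0; exists (ev a s).
have -> : loc_in wL wL ^+ k * frac wL a k = loc_in wL a.
  rewrite -rmorphXn /= frac_mul; apply/frac_eq; exists 0%N.
  by rewrite expr0 !mul1r mulr1 mulrC.
by rewrite evK_frac expr0 mulr1.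
Qed.

Lemma frac_integrally_closed (x : K) (a : O) (k n : nat) (c : nat -> O) :
    x = a%:F * (w%:F)^-1 ^+ k -> x ^+ n = \sum_(i < n) (c i)%:F * x ^+ i ->
  exists b : O, x = b%:F.
Proof.
move=> ex e; have [wn0 wnu hu] := hw.
have [a0|a0] := eqVneq a 0; first by exists 0; rewrite ex a0 rmorph0 mul0r.
have [u [m [[u' uu'] ea]]] := hu a a0.
have wF := wF_neq0.
have [km|mk] := leqP k m.
  exists (u * w ^+ (m - k)).
  rewrite ex ea -{1}(subnK km) exprD mulrA rmorphM -mulrA [in X in _ * X]rmorphXn /=.
  by rewrite -exprMn mulfV // expr1n mulr1.
pose y := u' * w ^+ (k - m).
have xy : x * y%:F = 1.
  rewrite ex ea mulrAC -rmorphM /= /y.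
  have -> : u * w ^+ m * (u' * w ^+ (k - m)) = w ^+ k.
    by rewrite mulrACA uu' mul1r -exprD subnKC // ltnW.
  by rewrite rmorphXn -exprMn mulfV // expr1n.
case: wnu.
have yw : y = w * (u' * w ^+ (k - m).-1).
  by rewrite /y -{1}(prednK (n := k - m)) ?subn_gt0 // exprS mulrCA.
exists (\sum_(i < n) c i * (u' * w ^+ (k - m).-1) * y ^+ (n - i).-1).
apply/eqP; rewrite -tofrac_eq; apply/eqP.
rewrite rmorph1 -(expr1n _ n) -{1}xy exprMn e mulr_sumr mulr_suml rmorph_sum /=.
apply: eq_bigr => i _.
have -> : y%:F ^+ n = y%:F ^+ i * y%:F ^+ (n - i) by rewrite -exprD subnKC // ltnW.
have hx j : x ^+ j * y%:F ^+ j = 1 by rewrite -exprMn xy expr1n.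
transitivity ((c i)%:F * y%:F ^+ (n - i) * (x ^+ i * y%:F ^+ i)); last by ring.
rewrite hx mulr1 -{2}(prednK (n := n - i)) ?subn_gt0 // exprS {2}yw !(rmorphM, rmorphXn) /=.
by ring.
Qed.

Lemma weight_closed : integrally_closed weight_plus.
Proof.
move=> x n c hc e s; apply/vge0.
have hcs i : exists b : O, evK s (c i) = b%:F by apply/vge0; apply: hc.
pose d i := projT1 (cid (hcs i)).
have hd i : evK s (c i) = (d i)%:F by rewrite /d; case: cid.
elim/fracP: x e => a k e.
apply: (@frac_integrally_closed _ (ev a s) k n d); first exact: evK_frac.
have := congr1 (evK s) e; rewrite rmorphXn rmorph_sum => ->.
by apply: eq_bigr => i _; rewrite rmorphM rmorphXn; congr (_ * _); apply: hd.
Qed.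

Lemma weight_open : exists n, forall a, weight_plus a -> weight_plus (loc_in wL wL ^+ n * a).
Proof. by exists 0%N => a ha; rewrite expr0 mul1r. Qed.

Lemma weight_bounded a : weight_plus a ->
  exists n, forall k, weight_plus (loc_in wL wL ^+ n * a ^+ k).
Proof.
move=> ha; exists 0%N => k; rewrite expr0 mul1r.
exact: subringX weight_plus_subring ha.
Qed.

(* The Huber pair (Lam[1/w], Lam^+). The subring Lam^+ is a ring of definition:
   the topology is that of uniform convergence of functions on S. *)
Definition weightPair : tatePair := {|
  tring := loc wL; tdef := weight_plus; tpi := loc_in wL wL; tplus := weight_plus;
  tdef_subring := weight_plus_subring; tpi_def := weight_pi_plus;
  tpi_unit := weight_pi_unit; tdef_absorb := weight_absorb;
  tplus_subring := weight_plus_subring;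
  tplus_open := weight_open; tplus_bounded := weight_bounded;
  tplus_closed := weight_closed
|}.

End WeightPair.

(* The residue field of R being finite in the case of interest, residue
   extensions are separable; so O is unramified over R if and only if a
   uniformizer w of R is a uniformizer of O. *)
Definition finite_unramified (R : comPzRingType) (O : idomainType)
    (iota : {rmorphism R -> O}) (w : R) : Prop :=
  [/\ injective iota,
      (exists (m : nat) (e : 'I_m -> O), forall x, exists a : 'I_m -> R,
         x = \sum_i iota (a i) * e i)
    & uniformizer (iota w)].

Section WeightSpace.
Variables (p : nat) (R : comPzRingType) (O : idomainType) (w : R).
Variables (iota : {rmorphism R -> O}) (hO : finite_unramified iota w).
Variables (ev : {rmorphism iwasawa w iota -> (padicInt p -> O)}) (hev : is_weight_map ev).

Lemma unramified_uniformizer : uniformizer (iota w).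
Proof. by case: hO. Qed.

Lemma weight_map_uniformizer s : ev (iw_const w iota (iota w)) s = iota w.
Proof. by case: hev. Qed.

(* The weight space is the adic spectrum spa weightSpace. *)
Definition weightSpace : tatePair :=
  weightPair unramified_uniformizer weight_map_uniformizer.

End WeightSpace.

(* Main.v *)
(* Write [A0] for the subring of the power-bounded functions. Since the residue
   field of [O] is finite, [a ^ (M + 1) = a] modulo [pi * A0] for some [M] and all
   [a] in [A0]. Hence each point of the adic spectrum is a discrete valuation whose
   order takes the value 1 at [pi], and [a ^ M] approximates the indicator function
   of the set where [a] has order 0. So rational subsets are clopen, and the
   spectrum is compact because the limit of a family of such valuations along an
   ultrafilter is again one. The ring of a rational subset is the completion of [A]
   for uniform convergence on this subset: outside of it, an approximate indicator
   function is divisible by a high power of [pi] in the ring of definition of the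
   rational localization. Sections are therefore glued from local approximations in
   [A], by means of indicator functions. Finally, the Cech complex of any sheaf of
   modules for a finite clopen covering is contracted by means of a refinement of
   the covering by pairwise disjoint sets. *)
From HB Require Import structures.
From mathcomp Require Import all_boot all_order all_algebra fieldext.
From mathcomp Require Import all_classical.
From mathcomp Require Import topology_structure.
From mathcomp Require Import finmap generic_quotient.
From mathcomp Require Import ring zify.
Require Import Defs.

Set Implicit Arguments.
Unset Strict Implicit.
Unset Printing Implicit Defensive.

Import Order.TTheory GRing.Theory Num.Theory.
Local Open Scope classical_set_scope.
Local Open Scope ring_scope.

(** The obstacle is that the spectrum consists of continuous valuations of arbitrary rank, not only
    of the evaluations at the elements of Z_p. The congruence [a ^ (M + 1) = a] modulo pi leaves no
    value strictly between those of two consecutive powers of pi, and continuity leaves no nonzero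
    value below all of them. So a point amounts to the filtration of the ring by its orders
    ([dv_filtration]). Each axiom of such a filtration involves finitely many memberships, which is
    what lets it pass to a limit along an ultrafilter. Everything up to the acyclicity is done for a
    pair that satisfies [residually_finite]. For the weight pair, the evaluations provide enough
    points to show that a function bounded by 1 on the spectrum is power-bounded. The exponent M has
    to be the same for all functions: it is B!, where B is the length of a list of representatives
    of the residue classes of O. This list is finite because the residue ring of A is; the latter is
    proved by counting elements of bounded degree in the function field, and finiteness then passes
    to the completion and to O. *)

(** * Discrete valuations and points of the adic spectrum *)

(* [G m] is the set of the elements of order at least [m]. *)
Record dv_filtration (B : comPzRingType) (G : int -> set B) : Prop := DvFiltration {
  dv0 : forall m, G m 0;
  dvB : forall m a b, G m a -> G m b -> G m (a - b);
  dv_le : forall m n a, m <= n -> G n a -> G m a;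
  dv_ex : forall a, exists m, G m a;
  dvM : forall m n a b, G m a -> G n b -> G (m + n) (a * b);
  dv_nM : forall m n a b, ~ G (m + 1) a -> ~ G (n + 1) b -> ~ G (m + n + 1) (a * b);
  dv1 : G 0 1;
  dv_n1 : ~ G 1 1
}.

Section DvTheory.
Variables (B : comPzRingType) (G : int -> set B) (hG : dv_filtration G).

Lemma dvN m a : G m a -> G m (- a).
Proof. by move=> h; rewrite -sub0r; apply: dvB => //; apply: dv0. Qed.

Lemma dvD m a b : G m a -> G m b -> G m (a + b).
Proof. by move=> ha hb; rewrite -[b]opprK; apply: dvB => //; apply: dvN. Qed.

Lemma dvX (m : nat) (k : nat) a : G m%:Z a -> G (k * m)%:Z (a ^+ k).
Proof.
move=> h; elim: k => [|k IH]; first by rewrite expr0 mul0n; apply: dv1.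
rewrite exprS mulSn; have := dvM hG h IH.
by rewrite -PoszD.
Qed.

Lemma dv_X0 k a : G 0 a -> G 0 (a ^+ k).
Proof. by move=> h; have := @dvX 0 k a h; rewrite muln0. Qed.

Lemma dvM0 m a b : G 0 a -> G m b -> G m (a * b).
Proof. by move=> ha hb; rewrite -(add0r m); apply: dvM. Qed.

Lemma dvMr0 m a b : G m a -> G 0 b -> G m (a * b).
Proof. by move=> ha hb; rewrite mulrC; apply: dvM0. Qed.

Lemma dv_order a n : ~ G n a -> exists m, G m a /\ ~ G (m + 1) a.
Proof.
move=> hn; have [m hm] := dv_ex hG a.
have mn : m < n by case: (ltP m n) => // /(dv_le hG); move/(_ _ hm).
move e : (`|n - m|)%N => d; elim: d m hm mn e => [|d IH] m hm mn e; first by lia.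
case: (EM (G (m + 1) a)) => h; last by exists m.
have [mn'|mn'] := ltP (m + 1) n; first by apply: (IH (m + 1)) => //; lia.
by case: hn; apply: dv_le h.
Qed.

(** [None] is infinite order: it is taken on the support of the valuation, which need not be
    zero. *)
Definition dv_ord (a : B) : option int :=
  match pselect (exists n, ~ G n a) with
  | left h => Some (projT1 (cid (let: ex_intro n hn := h in dv_order hn)))
  | right _ => None
  end.

Lemma dv_ordP a :
  (dv_ord a = None /\ forall n, G n a) \/
  exists m, [/\ dv_ord a = Some m, G m a & ~ G (m + 1) a].
Proof.
rewrite /dv_ord; case: pselect => [h|h].
  by right; case: cid => m [h1 h2] /=; exists m.
by left; split=> // n; apply: contrapT => hn; apply: h; exists n.
Qed.

Lemma dv_ordE m a : dv_ord a = Some m <-> G m a /\ ~ G (m + 1) a.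
Proof.
have [[-> h]|[n [-> h1 h2]]] := dv_ordP a; first by split=> // -[_ []].
split=> [[<-]//|[h3 h4]]; congr Some.
have [mn|mn|//] := ltgtP m n.
- by case: h4; apply: dv_le h1 => //; lia.
- by case: h2; apply: dv_le h3 => //; lia.
Qed.

(** A large order is a small value, hence the reversed order on the integers. *)
Definition revint : orderedGroup.
Proof.
refine (@OrderedGroup int (fun x y : int => is_true (y <= x)) _ _ _ _ _).
- by [].
- by move=> x y h k; apply/eqP; rewrite eq_le h k.
- by move=> x y z h k; apply: le_trans k h.
- by move=> x y; case/orP: (le_total y x); [left|right].
- by move=> x y z h; rewrite lerD2l.
Defined.

Definition dv_val (a : B) : option revint := dv_ord a.

Lemma dv_val0 : dv_val 0 = None.
Proof.
by rewrite /dv_val; have [[-> //]|[m [_ _ []]]] := dv_ordP 0; apply: dv0.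
Qed.
Lemma dv_val1 : dv_val 1 = Some 0.
Proof. by apply/dv_ordE; split; [exact: dv1|exact: dv_n1]. Qed.
Lemma dv_valM x y : dv_val (x * y) = omul (dv_val x) (dv_val y).
Proof.
rewrite /dv_val; have [[ex hx]|[m [-> hx hx']]] := dv_ordP x.
  have [k hk] := dv_ex hG y.
  have hxy n : G n (x * y) by rewrite -(subrK k n); apply: dvM.
  by rewrite ex; have [[-> //]|[l [_ _ []]]] := dv_ordP (x * y).
have [[ey hy]|[n [-> hy hy']]] := dv_ordP y.
  have hxy l : G l (x * y) by rewrite -(subrK m l) addrC; apply: dvM.
  by rewrite ey; have [[-> //]|[l [_ _ []]]] := dv_ordP (x * y).
by apply/dv_ordE; split; [apply: dvM|apply: dv_nM].
Qed.

Lemma dv_val_le x y : ole (dv_val x) (dv_val y) <-> forall m, G m y -> G m x.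
Proof.
rewrite /dv_val; have [[-> hx]|[m [-> hx hx']]] := dv_ordP x; first by split.
have [[-> hy]|[n [-> hy hy']]] := dv_ordP y; first by split=> //= /(_ _ (hy (m + 1))).
split=> /= [nm k hk|h].
  apply: dv_le hx => //; rewrite leNgt; apply/negP => mk.
  by apply: hy'; apply: dv_le hk => //; move: nm => /=; lia.
rewrite leNgt; apply/negP => mn; apply: hx'; apply: dv_le (h _ hy) => //.
by lia.
Qed.

Lemma dv_valD x y :
  ole (dv_val (x + y)) (dv_val x) \/ ole (dv_val (x + y)) (dv_val y).
Proof.
case: (EM (forall m, G m x -> G m y)) => h.
  by left; apply/dv_val_le => m hm; apply: dvD => //; apply: h.
right; apply/dv_val_le => m hm; apply: dvD => //.
apply: contrapT => hx; apply: h => k hk; apply: dv_le hm => //.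
by rewrite leNgt; apply/negP => mk; apply: hx; apply: dv_le hk => //; apply: ltW.
Qed.

Definition dv_valuation : valuation B := Valuation dv_val0 dv_val1 dv_valM dv_valD.

Lemma dv_vrel x y : vrel dv_valuation x y <-> forall m, G m y -> G m x.
Proof. exact: dv_val_le. Qed.

Lemma dv_vcontinuous (nb : nat -> set B) :
  (forall m, exists n, nb n `<=` G m) -> vcontinuous nb dv_valuation.
Proof.
move=> h a b g k _ _; have [n hn] := h ((g : int) - k + 1); exists n => x /hn hx.
rewrite /olt /= /dv_val; case: (dv_ordP x) => [[-> _]|[m [-> hm hm']] /= h1] //.
by apply: hm'; apply: dv_le hx => //; move: h1; lia.
Qed.

End DvTheory.

Section TatePowers.
Variable A : tatePair.

Definition tpi_inv : A := projT1 (cid (tpi_unit A)).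

Lemma tpi_invE : tpi A * tpi_inv = 1.
Proof. by rewrite /tpi_inv; case: cid. Qed.

Definition tpiz (m : int) : A :=
  match m with Posz n => tpi A ^+ n | Negz n => tpi_inv ^+ n.+1 end.

Lemma tpi_cancel k : tpi A ^+ k * tpi_inv ^+ k = 1.
Proof. by rewrite -exprMn tpi_invE expr1n. Qed.

Lemma tpizE (a b : nat) : tpiz (a%:Z - b%:Z) = tpi A ^+ a * tpi_inv ^+ b.
Proof.
have [ab|ba] := leqP b a.
  rewrite subzn //= -{2}(subnK ab) exprD -mulrA tpi_cancel mulr1 //.
have [k ek] : exists k, b = (a + k.+1)%N by exists (b - a).-1; lia.
rewrite ek PoszD opprD addNKr -NegzE /= exprD mulrA tpi_cancel mul1r //.
Qed.

Lemma tpizD m n : tpiz (m + n) = tpiz m * tpiz n.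
Proof.
have hm k : exists a b : nat, k = a%:Z - b%:Z.
  by case: k => k; [exists k, 0%N; rewrite subr0|exists 0%N, k.+1; rewrite NegzE sub0r].
have [a [b ->]] := hm m; have [c [d ->]] := hm n.
have -> : a%:Z - b%:Z + (c%:Z - d%:Z) = (a + c)%N%:Z - (b + d)%N%:Z by lia.
by rewrite !tpizE !exprD; ring.
Qed.

Lemma tpiz0 : tpiz 0 = 1. Proof. by []. Qed.
Lemma tpiz1 : tpiz 1 = tpi A. Proof. by []. Qed.
Lemma tpizN m : tpiz m * tpiz (- m) = 1. Proof. by rewrite -tpizD subrr. Qed.
Lemma tpizNK m a : tpiz m * (tpiz (- m) * a) = a. Proof. by rewrite mulrA tpizN mul1r. Qed.

End TatePowers.

Section ValuationOrder.
Variables (R : comPzRingType) (v : valuation R).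
Local Notation le a b := (vrel v a b).

Lemma vrel_refl a : le a a.
Proof. by rewrite /vrel; case: (v a) => //= g; apply: ogle_refl. Qed.

Lemma vrel_trans b a c : le a b -> le b c -> le a c.
Proof. exact: ole_trans. Qed.

Lemma vrel_mul c a b : le a b -> le (c * a) (c * b).
Proof.
by rewrite /vrel !vfunM; case: (v c) (v a) (v b) => [g|] [h|] [k|] //=; apply: ogle_add.
Qed.

Lemma vrel0 a : le 0 a. Proof. by rewrite /vrel vfun0. Qed.

Lemma vrel_cancel c a b : ~ le c 0 -> le (c * a) (c * b) -> le a b.
Proof.
rewrite /vrel !vfunM vfun0; case: (v c) => [g|] /=; last by case.
case: (v a) (v b) => [h|] [k|] //= _ H.
by rewrite -(addKr g h) -(addKr g k); apply: ogle_add.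
Qed.

Lemma vrel_mul0 a b : ~ le a 0 -> ~ le b 0 -> ~ le (a * b) 0.
Proof. by rewrite /vrel !vfunM vfun0; case: (v a) (v b) => [g|] [h|]. Qed.

Lemma vrelN a b : le a b -> le (- a) b.
Proof.
rewrite /vrel -mulN1r vfunM vfunN1; case: (v a) => [g|] //=; by rewrite add0r.
Qed.

Lemma vrelD a b c : le a c -> le b c -> le (a + b) c.
Proof. by move=> ha hb; have [h|h] := vfunD v a b; apply: ole_trans h _. Qed.

Lemma vrelB a b c : le a c -> le b c -> le (a - b) c.
Proof. by move=> ha hb; apply: vrelD => //; apply: vrelN. Qed.

Lemma vrel_10 : ~ le 1 0. Proof. by rewrite /vrel vfun0 vfun1. Qed.

Lemma vrelM a b c d : le a b -> le c d -> le (a * c) (b * d).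
Proof.
move=> h k; apply: (@vrel_trans (a * d)); first exact: vrel_mul.
by rewrite ![_ * d]mulrC; apply: vrel_mul.
Qed.

Lemma vrelX n a b : le a b -> le (a ^+ n) (b ^+ n).
Proof.
by move=> h; elim: n => [|n IH]; [exact: vrel_refl|rewrite !exprS; apply: vrelM].
Qed.

Lemma vrel_expr n a : le a 1 -> le (a ^+ n.+1) a.
Proof.
move=> a1; rewrite exprS -[X in le _ X]mulr1; apply: vrel_mul.
by rewrite -(expr1n _ n); apply: vrelX.
Qed.

(** For [|a| < 1] the term [a] dominates its higher powers, whatever the rank: otherwise [a] is
    nonzero and cancelling it gives a power of [a] of value at least 1. *)
Lemma vrel_sub_expr n a : (0 < n)%N -> le a 1 -> ~ le 1 a -> le a (a ^+ n.+1 - a).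
Proof.
case: n => // n _ a1 h1; set b := _ - a.
have eb : a = a ^+ n.+2 - b by rewrite /b opprB addrCA subrr addr0.
have [h|h] : le a (a ^+ n.+2) \/ le a b.
- rewrite /vrel {1 3}eb; have [h|h] := vfunD v (a ^+ n.+2) (- b); [left|right] => //.
  by apply: ole_trans h _; apply: vrelN (vrel_refl _).
- apply: vrel_trans (vrel0 _); apply: contrapT => a0; apply: h1.
  have h2 : le 1 (a ^+ n.+1) by apply: (vrel_cancel a0); rewrite mulr1 -exprS.
  exact: vrel_trans h2 (vrel_expr _ _).
- exact: h.
Qed.

End ValuationOrder.

(* For a pair of functions on a set, [rf_exp] holds as soon as the residue field
   is finite, and [rf_sep] as soon as the evaluations belong to the spectrum. *)
Record residually_finite (A : tatePair) : Prop := ResiduallyFinite {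
  rf_plus : @tplus A = @tdef A;
  rf_exp : exists2 M, (0 < M)%N & forall a : A, tdef a ->
    exists2 d, tdef d & a ^+ M.+1 - a = tpi A * d;
  rf_sep : forall a : A, (forall x : spa A, sprel x a 1) -> tdef a
}.

Section Points.
Variables (A : tatePair) (hA : residually_finite A).
Local Notation pi := (tpi A).
Local Notation pz := (tpiz A).

(** The functions of order at least m at x. A point records only the relation [|a| <= |b|];
    comparison with the powers of pi turns it into an order. *)
Definition spge (x : spa A) (m : int) : set A := [set a | sprel x a (pz m)].

Section OnePoint.
Variable v : valuation A.
Hypothesis vc : vcontinuous (@tnbd A) v.
Hypothesis vp : forall a, tplus a -> ole (v a) (Some 0).
Local Notation le a b := (vrel v a b).

Lemma val_def a : tdef a -> le a 1.
Proof. by rewrite -(rf_plus hA) /vrel vfun1; apply: vp. Qed.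

Lemma val_small a : ~ le a 0 -> exists n : nat, ~ le a (pz n%:Z).
Proof.
move=> ha; have [g ga] : exists g, v a = Some g.
  by move: ha; rewrite /vrel vfun0; by case: (v a) => [g|] /=; [exists g|case].
have [n hn] := vc ga (vfun1 v); exists n => h.
have : tnbd n (pz n%:Z).
  by exists 1; rewrite mulr1; split=> //; have [] := tdef_subring A.
by move/hn; rewrite subr0 -ga /olt; apply.
Qed.

Lemma val_pz_neq0 m : ~ le (pz m) 0.
Proof.
move=> h; apply: (@vrel_10 _ v); rewrite -(tpizN A (- m)) opprK.
by have := vrel_mul (pz (- m)) h; rewrite mulr0.
Qed.

Lemma val_pz_cancel m a b : le (pz m * a) (pz m * b) -> le a b.
Proof. by apply: vrel_cancel; apply: val_pz_neq0. Qed.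

Lemma val_pi_lt1 : ~ le 1 pi.
Proof.
move=> h; have [n hn] := val_small (@vrel_10 _ v); apply: hn => /=.
by have := vrelX n h; rewrite expr1n.
Qed.

Lemma val_pz_le m n : n <= m -> le (pz m) (pz n).
Proof.
move=> nm; have [k ->] : exists k : nat, m = n + k%:Z by exists `|m - n|%N; lia.
rewrite tpizD -[X in le _ X]mulr1; apply: vrel_mul; rewrite /= -(expr1n _ k).
by apply: vrelX; apply: val_def; apply: tpi_def.
Qed.

(** If [|c| < 1], then c has the same value as [c ^+ M.+1 - c = pi * d]. Passing from c to d lowers
    the order by one, so induction on k leaves no value strictly between two consecutive powers of
    pi. *)
Lemma val_gap0 (k : nat) c : tdef c -> le c (pz k.+1%:Z) \/ le (pz k%:Z) c.
Proof.
have [M M0 hM] := rf_exp hA.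
have key a : tdef a -> ~ le 1 a -> exists d, [/\ tdef d, le a (pi * d) & le (pi * d) a].
  move=> ha a1; have [d hd e] := hM a ha; exists d; split=> //.
    by rewrite -e; apply: vrel_sub_expr => //; apply: val_def.
  rewrite -e; apply: vrelB; last exact: vrel_refl.
  by apply: vrel_expr; apply: val_def.
elim: k c => [|k IH] c hc; (have [h|c1] := EM (le 1 c); first by
  right; apply: vrel_trans h; rewrite -(tpiz0 A); apply: val_pz_le).
all: have [d [hd h1 h2]] := key c hc c1.
  left; apply: vrel_trans h1 _; rewrite -[X in le _ X]mulr1; apply: vrel_mul.
  exact: val_def.
have [h|h] := IH d hd; [left|right].
  by apply: vrel_trans h1 _; rewrite /= exprS; exact: vrel_mul.
by apply: vrel_trans h2; rewrite /= exprS; apply: vrel_mul.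
Qed.

Lemma val_absorb a : exists n : nat, tdef (pz n%:Z * a).
Proof. exact: tdef_absorb. Qed.

Lemma val_gap m a : le a (pz (m + 1)) \/ le (pz m) a.
Proof.
have [n hn] := val_absorb a; have [mn|mn] := leP 0 (n%:Z + m).
  have [k ek] : exists k : nat, n%:Z + m = k%:Z by case: (n%:Z + m) mn => // k _; exists k.
  have [h|h] := val_gap0 k hn; [left|right]; apply: (@val_pz_cancel n%:Z).
    by rewrite -tpizD (_ : n%:Z + (m + 1) = k.+1%:Z) //; lia.
  by rewrite -tpizD ek.
left; apply: (@val_pz_cancel n%:Z); rewrite -tpizD.
apply: vrel_trans (val_def hn) _; rewrite -(tpiz0 A); apply: val_pz_le.
by lia.
Qed.

Lemma val_filtration : dv_filtration (fun m => [set a | le a (pz m)]).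
Proof.
split=> /=.
- by move=> m; apply: vrel0.
- by move=> m a b; apply: vrelB.
- by move=> m n a mn h; apply: vrel_trans h (val_pz_le mn).
- move=> a; have [n hn] := val_absorb a; exists (- n%:Z).
  apply: (@val_pz_cancel n%:Z); rewrite tpizN; exact: val_def.
- by move=> m n a b ha hb; rewrite tpizD; apply: vrelM.
- move=> m n a b ha hb hab.
  have [//|{}ha] := val_gap m a; have [//|{}hb] := val_gap n b.
  apply: val_pi_lt1; apply: (@val_pz_cancel (m + n)); rewrite mulr1 -(tpiz1 A) -tpizD.
  by apply: vrel_trans hab; rewrite tpizD; apply: vrelM.
- exact: vrel_refl.
- by rewrite /= expr1; apply: val_pi_lt1.
Qed.

(** By [val_gap], a value that is not below all the powers of pi is the value of one of them; by
    continuity, 0 is the only value below all of them. So the valuation is discrete of rank one and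
    its filtration determines it. *)
Lemma val_leE a b : le a b <-> forall m, le b (pz m) -> le a (pz m).
Proof.
split=> [h m k|h]; first exact: vrel_trans h k.
have [b0|b0] := EM (le b 0).
  have ha m : le a (pz m) by apply: h; apply: vrel_trans b0 (vrel0 _ _).
  apply: vrel_trans (vrel0 _ _); apply: contrapT => a0.
  by have [n []] := val_small a0.
have [n hn] := val_small b0.
have [m [hm hm']] := dv_order val_filtration hn.
by have [//|hb] := val_gap m b; apply: vrel_trans hb; apply: h.
Qed.

End OnePoint.

Lemma spge_filtration x : dv_filtration (spge x).
Proof.
have [v [vc vp e]] := spP x; rewrite /spge e; exact: val_filtration.
Qed.

Lemma sprelE x a b : sprel x a b <-> forall m, spge x m b -> spge x m a.
Proof. by rewrite /spge; have [v [vc vp ->]] := spP x; apply: val_leE. Qed.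

Lemma spge_pz x m : spge x m (pz m).
Proof. by rewrite /spge; have [v [vc vp ->]] := spP x; apply: vrel_refl. Qed.

Lemma spge_def x a : tdef a -> spge x 0 a.
Proof. by rewrite /spge; have [v [vc vp ->]] := spP x; apply: val_def. Qed.

Lemma spge_sep a : (forall x, spge x 0 a) -> tdef a.
Proof. exact: rf_sep. Qed.

Lemma sprel0 x a : sprel x a 0 <-> forall m, spge x m a.
Proof.
split=> [/sprelE h m|h]; last by apply/sprelE.
by apply: h; apply: dv0 (spge_filtration x) _.
Qed.

End Points.

Section MakePoint.
Variables (A : tatePair) (G : int -> set A).
Hypothesis hG : dv_filtration G.
Hypothesis Gp : forall a, tplus a -> G 0 a.
Hypothesis Gd : forall a, tdef a -> G 0 a.
Hypothesis G1 : G 1 (tpi A).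
Hypothesis GV : G (-1) (tpi_inv A).

Lemma dv_tpiz m : G m (tpiz A m).
Proof.
case: m => n /=; first by have := @dvX _ _ hG 1 n _ G1; rewrite muln1.
elim: n => [|n IH]; first by rewrite expr1.
by rewrite exprS; have := dvM hG GV IH; congr G; lia.
Qed.

Definition dv_point : spa A.
Proof.
apply: (@Spa A (vrel (dv_valuation hG))).
exists (dv_valuation hG); split=> //.
- apply: dv_vcontinuous => m; exists `|m|%N => _ [a [ha ->]].
  apply: (@dv_le _ _ hG _ `|m|%N%:Z); first by lia.
  by apply: dvMr0 => //; [apply: (dv_tpiz `|m|%N%:Z)|apply: Gd].
- move=> a ha; suff : vrel (dv_valuation hG) a 1 by rewrite /vrel vfun1.
  by apply/dv_vrel => m hm; rewrite -[a]mulr1; apply: dvM0 => //; apply: Gp.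
Defined.

Lemma dv_pointE m a : sprel dv_point a (tpiz A m) <-> G m a.
Proof.
split=> [/dv_vrel|h]; first by apply; apply: dv_tpiz.
apply/dv_vrel => n hn; apply: dv_le h => //.
rewrite leNgt; apply/negP => mn; apply: (dv_n1 hG).
apply: (@dv_le _ _ hG _ (n - m)); first by lia.
by rewrite -(tpizN A m); apply: dvM => //; apply: dv_tpiz.
Qed.

End MakePoint.

(** * Constructible subsets of the spectrum *)

Section Clopen.
Variables (A : tatePair) (hA : residually_finite A).
Local Notation X := (spa A).
Local Notation pi := (tpi A).
Local Notation pz := (tpiz A).
Local Notation ge := (@spge A).
Local Notation hx := (spge_filtration hA).

Lemma spgeM_pz x n m a : ge x (n + m) (pz n * a) <-> ge x m a.
Proof.
split=> h; last by apply: (dvM (hx x)) => //; apply: spge_pz.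
rewrite -(addKr n m) -(mul1r a) -(tpizN A (- n)) opprK -mulrA.
by apply: (dvM (hx x)) => //; apply: spge_pz.
Qed.

Lemma spge_lower a : exists n : nat, forall x, ge x (- n%:Z) a.
Proof.
have [n hn] := tdef_absorb a; exists n => x.
by apply/(spgeM_pz x n%:Z); rewrite subrr; apply: spge_def.
Qed.

Lemma spge_le x m n a : m <= n -> ge x n a -> ge x m a.
Proof. by apply: dv_le; apply: hx. Qed.

Lemma spge_exprB1 x m k a : 0 <= m -> ge x m (a - 1) -> ge x m (a ^+ k - 1).
Proof.
move=> m0 h.
have a0 : ge x 0 a.
  rewrite -(subrK 1 a); apply: (dvD (hx x)); last exact: (dv1 (hx x)).
  exact: spge_le h.
elim: k => [|k IH]; first by rewrite subrr; apply: (dv0 (hx x)).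
rewrite (_ : _ - 1 = a ^+ k * (a - 1) + (a ^+ k - 1)); last by rewrite exprSr; ring.
by apply: (dvD (hx x)) => //; apply: (dvM0 (hx x)) => //; apply: (dv_X0 (hx x)).
Qed.

Lemma spge_1B_expr x m k w : 0 <= m -> ge x m w -> ge x m (1 - (1 - w) ^+ k).
Proof.
move=> m0 h; rewrite -opprB; apply: (dvN (hx x)); apply: spge_exprB1 => //.
by rewrite addrC addKr; apply: (dvN (hx x)).
Qed.

Lemma tdefB (a b : A) : tdef a -> tdef b -> tdef (a - b).
Proof. by have [_ h _] := tdef_subring A; apply: h. Qed.
Lemma tdefM (a b : A) : tdef a -> tdef b -> tdef (a * b).
Proof. by have [_ _ h] := tdef_subring A; apply: h. Qed.
Lemma tdef1 : @tdef A 1. Proof. by have [] := tdef_subring A. Qed.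
Lemma tdefX (a : A) n : tdef a -> tdef (a ^+ n).
Proof. by apply: subringX; apply: tdef_subring. Qed.
Local Hint Resolve tdef1 : core.

(** Orders add up in products: [e * (e ^+ M - 1)] is a multiple of pi and [e] has order 0. *)
Lemma unit_fermat M x e : (forall a : A, tdef a -> exists2 d, tdef d & a ^+ M.+1 - a = tpi A * d) ->
  tdef e -> ~ ge x 1 e -> ge x 1 (e ^+ M - 1).
Proof.
move=> hM he xe; have [d hd ed] := hM e he.
apply: contrapT => h; have := dv_nM (hx x) (m := 0) (n := 0) xe h; apply.
rewrite mulrBr mulr1 -exprS ed; apply: (dvMr0 (hx x)); last exact: spge_def.
exact: (spge_pz x 1).
Qed.

(** The indicator function of C is a uniform limit of elements of [tdef]. In this form the Boolean
    operations are immediate, and such sets turn out to be both open and rational. *)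
Definition constructible (C : set X) : Prop := forall N : nat, exists e,
  [/\ tdef e, (forall x, C x -> ge x N%:Z (e - 1)) & (forall x, ~ C x -> ge x N%:Z e)].

Lemma constructible_unit e : tdef e -> constructible [set x | ~ ge x 1 e].
Proof.
have [M M0 hM] := rf_exp hA; move=> he N.
(* Where [e] has order 0, [e ^+ M] is 1 modulo pi, so the outer power has order at least N.
   Elsewhere the inner power has order at least N, and the whole is [1 - 1] up to that order. *)
exists (1 - (1 - (e ^+ M) ^+ N) ^+ N); split.
- by do ?[apply: tdefB|apply: tdefX].
- move=> x /= xe.
  have h1 := unit_fermat hM he xe.
  rewrite addrAC subrr add0r; apply: (dvN (hx x)).
  have := @dvX _ _ (hx x) 1 N (1 - (e ^+ M) ^+ N); rewrite muln1; apply.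
  rewrite -opprB; apply: (dvN (hx x)); exact: spge_exprB1.
- move=> x /= /contrapT xe; apply: spge_1B_expr => //.
  have := @dvX _ _ (hx x) 1 N (e ^+ M); rewrite muln1; apply.
  rewrite -(prednK M0) exprS; apply: (dvMr0 (hx x)) => //.
  by apply: (dv_X0 (hx x)); apply: spge_def.
Qed.

Lemma constructibleE C : constructible C -> exists e,
  tdef e /\ forall x, C x <-> ~ ge x 1 e.
Proof.
move=> /(_ 1%N) [e [he h1 h2]]; exists e; split=> // x; split=> [xC xe|xe].
  apply: (dv_n1 (hx x)); rewrite (_ : 1 = e - (e - 1)); last by ring.
  by apply: (dvB (hx x)) => //; apply: h1.
by apply: contrapT => xC; apply: xe; apply: h2.
Qed.

Lemma constructibleT : constructible setT.
Proof.
move=> N; exists 1; split=> [|x _|x []] //.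
by rewrite subrr; apply: (dv0 (hx x)).
Qed.

Lemma constructibleC C : constructible C -> constructible (~` C).
Proof.
move=> h N; have [e [he h1 h2]] := h N; exists (1 - e); split.
- exact: tdefB.
- by move=> x /h2 xe; rewrite addrAC subrr add0r; apply: (dvN (hx x)).
- by move=> x /contrapT/h1 xe; rewrite -opprB; apply: (dvN (hx x)).
Qed.

Lemma constructibleI C D : constructible C -> constructible D -> constructible (C `&` D).
Proof.
move=> h k N; have [e [he h1 h2]] := h N; have [f [hf k1 k2]] := k N.
exists (e * f); split; first exact: tdefM.
- move=> x [xC xD]; rewrite (_ : _ - 1 = (e - 1) * f + (f - 1)); last by ring.
  apply: (dvD (hx x)); last exact: k1.
  by apply: (dvMr0 (hx x)); [apply: h1|apply: spge_def].
- move=> x xCD; have [xC|xC] := EM (C x).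
    apply: (dvM0 (hx x)); first exact: spge_def.
    by apply: k2 => xD; apply: xCD.
  by apply: (dvMr0 (hx x)); [apply: h2|apply: spge_def].
Qed.

Lemma constructibleU C D : constructible C -> constructible D -> constructible (C `|` D).
Proof.
by move=> h k; rewrite -[C `|` D]setCK setCU; apply/constructibleC/constructibleI;
  apply: constructibleC.
Qed.

Lemma constructible0 : constructible set0.
Proof. by rewrite -setCT; apply/constructibleC/constructibleT. Qed.

(** Write [a ^+ M.+1 - a = pi * d]. If a has order at least 1, then [a ^+ M - 1] has order 0, so a
    and [pi * d] have the same order. Thus order at least k + 1 for a means order at least 1 for a
    and at least k for d. A general f is first multiplied by a power of pi. *)
Lemma constructible_ge f m : constructible [set x | ge x m f].
Proof.
have [M M0 hM] := rf_exp hA.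
have key (k : nat) a : tdef a -> constructible [set x | ge x k%:Z a].
  elim: k a => [|k IH] a ha.
    rewrite (_ : [set _ | _] = setT); first exact: constructibleT.
    by apply/seteqP; split=> // x _ /=; apply: spge_def.
  have [d hd ed] := hM a ha.
  rewrite (_ : [set _ | _] = ~` [set x | ~ ge x 1 a] `&` [set x | ge x k%:Z d]).
    apply: constructibleI; last exact: IH.
    by apply: constructibleC; apply: constructible_unit.
  have aM x : ge x 0 (a ^+ M) by apply: (dv_X0 (hx x)); apply: spge_def.
  apply/seteqP; split=> x /=.
    move=> h; split; first by apply; apply: spge_le h.
    apply/(spgeM_pz x 1); rewrite /= expr1 -ed (_ : 1 + k%:Z = k.+1%:Z); last by lia.
    apply: (dvB (hx x)) => //; rewrite exprS; exact: (dvMr0 (hx x)).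
  move=> [/contrapT h1 /(spgeM_pz x 1)]; rewrite /= expr1 -ed => h2.
  apply: contrapT => h; apply: (dv_nM (hx x) (m := k) (n := 0) (a := a) (b := a ^+ M - 1)).
  - by rewrite (_ : k%:Z + 1 = k.+1%:Z) //; lia.
  - move=> h3; apply: (dv_n1 (hx x)); rewrite (_ : 1 = a ^+ M - (a ^+ M - 1)); last by ring.
    apply: (dvB (hx x)) => //; rewrite -(prednK M0) exprS; apply: (dvMr0 (hx x)) => //.
    by apply: (dv_X0 (hx x)); apply: spge_def.
  - by rewrite mulrBr mulr1 -exprS addr0 addrC.
have [n hn] := tdef_absorb f; have [mn|mn] := leP 0 (n%:Z + m).
  have [k ek] : exists k : nat, n%:Z + m = k%:Z by case: (n%:Z + m) mn => // k _; exists k.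
  rewrite (_ : [set x | _] = [set x | ge x k%:Z (pz n * f)]); first exact: key.
  by rewrite -ek; apply/seteqP; split=> x /= /spgeM_pz.
rewrite (_ : [set x | _] = setT); first exact: constructibleT.
apply/seteqP; split=> // x _ /=; apply/(spgeM_pz x n%:Z).
by apply: (@spge_le _ _ 0); [apply: ltW|apply: spge_def].
Qed.

Lemma glue2 C a b (N : nat) : constructible C -> exists c,
  (forall x, C x -> ge x N%:Z (c - a)) /\ (forall x, ~ C x -> ge x N%:Z (c - b)).
Proof.
move=> hC; have [n hn] := spge_lower (a - b).
(* The difference [a - b] has order at least -n, hence the additional precision n. *)
have [e [he h1 h2]] := hC (N + n)%N.
exists (b + e * (a - b)); split=> x xC.
  rewrite (_ : _ - a = (e - 1) * (a - b)); last by ring.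
  by rewrite -(addrK n%:Z N%:Z) -PoszD; apply: (dvM (hx x)); [apply: h1|].
rewrite addrAC subrr add0r -(addrK n%:Z N%:Z) -PoszD.
by apply: (dvM (hx x)); [apply: h2|].
Qed.

(** Induction on the bound for the order of s, counted from its lower bound -n. On the stratum where
    this order is the largest allowed, s is a power of pi times a function of order 0, and the
    latter is inverted modulo pi^N by a geometric series, its M-th power being 1 modulo pi. Inverses
    on the strata are then glued. *)
Lemma approx_inv C s m (N : nat) : constructible C -> (forall x, C x -> ~ ge x m s) ->
  exists s', (forall x, C x -> ge x N%:Z (s * s' - 1)) /\ (forall x, ~ C x -> ge x N%:Z s').
Proof.
have [M M0 hM] := rf_exp hA.
have [n hn] := spge_lower s.
suff H (k : nat) D : constructible D -> (forall x, D x -> ~ ge x (k%:Z - n%:Z) s) ->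
    exists s', forall x, D x -> ge x N%:Z (s * s' - 1).
  move=> hC Cm; have [s1 hs1] : exists s1, forall x, C x -> ge x N%:Z (s * s1 - 1).
    apply: (H (absz (m + n%:Z)) C) => // x /Cm h1 h2; apply: h1; apply: spge_le h2; lia.
  have [s2 [h1 h2]] := glue2 s1 0 (N + n) hC; exists s2; split=> x xC.
    rewrite (_ : _ - 1 = s * (s2 - s1) + (s * s1 - 1)); last by ring.
    apply: (dvD (hx x)); last exact: hs1.
    rewrite (_ : N%:Z = - n%:Z + (N + n)%N%:Z); last by lia.
    by apply: (dvM (hx x)) => //; apply: h1.
  by have := h2 x xC; rewrite subr0; apply: spge_le; lia.
elim: k D => [|k IH] D hD Dk.
  by exists 0 => x /Dk []; apply: spge_le (hn x); lia.
pose E := [set x | ge x (k%:Z - n%:Z) s].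
have hE : constructible E by apply: constructible_ge.
have [s1 h1] : exists s', forall x, (D `&` ~` E) x -> ge x N%:Z (s * s' - 1).
  by apply: IH; [apply: constructibleI => //; apply: constructibleC|move=> x []].
pose v := pz (n%:Z - k%:Z) * s.
have sv : s = pz (k%:Z - n%:Z) * v by rewrite /v -(opprB k%:Z) tpizNK.
have hDE : constructible (D `&` E) by apply: constructibleI.
have v0 x : E x -> ge x 0 v.
  by move=> xE; rewrite -(subrr (k%:Z - n%:Z)) opprB addrC; apply/spgeM_pz.
have v1 x : D x -> ~ ge x 1 v.
  move=> xD h; apply: (Dk x xD); rewrite sv (_ : k.+1%:Z - _ = (k%:Z - n%:Z) + 1); last by lia.
  exact/spgeM_pz.
(* Outside [D] and [E], v may have poles; cutting it off there puts u in [tdef], where the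
   congruence for M applies. Precision [N.+1] keeps u of order 0 on the stratum even for [N = 0]. *)
have [u [u1 u2]] := glue2 v 0 N.+1 hDE.
have hu : tdef u.
  apply: spge_sep => // x; have [xDE|xDE] := EM ((D `&` E) x).
    rewrite -(subrK v u); apply: (dvD (hx x)); last by apply: v0; case: xDE.
    by apply: spge_le (u1 x xDE).
  by rewrite -[u]subr0; apply: spge_le (u2 x xDE).
pose S := \sum_(i < N) (1 - u ^+ M) ^+ i.
have hS : tdef S.
  by apply: big_ind => [|a b ha hb|i _]; [apply: subring0|apply: subringD|apply: subringX];
    do ?[apply: tdefB|apply: tdefX]; rewrite //; apply: tdef_subring.
(* Since [u ^+ M * S = 1 - (1 - u ^+ M) ^+ N], the factor [u ^+ M.-1 * S] inverts u up to the N-th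
   power of something of positive order. *)
pose s2 := pz (n%:Z - k%:Z) * u ^+ M.-1 * S.
have h2 x : D x -> E x -> ge x N%:Z (s * s2 - 1).
  move=> xD xE; have uv := u1 x (conj xD xE).
  have xu : ~ ge x 1 u.
    move=> h; apply: (v1 x xD); rewrite -(subKr u v); apply: (dvB (hx x)) => //.
    by apply: spge_le uv.
  have h3 := unit_fermat hM hu xu.
  rewrite (_ : _ - 1 = (v - u) * (u ^+ M.-1 * S) - (1 - u ^+ M) ^+ N).
    apply: (dvB (hx x)).
      apply: (dvMr0 (hx x)); last by apply: spge_def => //; apply: tdefM => //; apply: tdefX.
      by rewrite -opprB; apply: (dvN (hx x)); apply: spge_le uv; lia.
    have := @dvX _ _ (hx x) 1 N (1 - u ^+ M); rewrite muln1; apply.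
    by rewrite -opprB; apply: (dvN (hx x)).
  have e1 : u * u ^+ M.-1 = u ^+ M by rewrite -exprS prednK.
  have e2 : (1 - u ^+ M) ^+ N - 1 = - (u ^+ M * S).
    by rewrite subrX1 addrAC subrr add0r mulNr.
  rewrite mulrBl mulrA e1 -addrA -opprD (_ : (1 - u ^+ M) ^+ N = 1 - u ^+ M * S); last first.
    by rewrite -[LHS](subrK 1) e2 addrC.
  by rewrite /s2 /v; ring.
have [s3 [h3 h4]] := glue2 s2 s1 (N + n) hE.
exists s3 => x xD.
have key t : ge x (N + n)%N%:Z (s3 - t) -> ge x N%:Z (s * t - 1) -> ge x N%:Z (s * s3 - 1).
  move=> k1 k2; rewrite (_ : _ - 1 = s * (s3 - t) + (s * t - 1)); last by ring.
  apply: (dvD (hx x)) => //.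
  rewrite (_ : N%:Z = - n%:Z + (N + n)%N%:Z); last by lia.
  exact: (dvM (hx x)).
have [xE|xE] := EM (E x).
  by apply: key (h3 x xE) _; apply: h2.
by apply: key (h4 x xE) _; apply: h1.
Qed.

End Clopen.

(** * Rational subsets and compactness of the spectrum *)

Section Topology.
Variables (A : tatePair) (hA : residually_finite A).
Local Notation X := (spa A).
Local Notation pi := (tpi A).
Local Notation pz := (tpiz A).
Local Notation ge := (@spge A).
Local Notation hx := (spge_filtration hA).
Local Notation constr := (@constructible A).

Lemma constructible_forall n (C : nat -> set X) : (forall i, constr (C i)) ->
  constr [set x | forall i, (i < n)%N -> C i x].
Proof.
move=> hC; elim: n => [|n IH].
  by rewrite (_ : [set x | _] = setT); [apply: (constructibleT hA)|apply/seteqP].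
rewrite (_ : [set x | _] = [set x | forall i, (i < n)%N -> C i x] `&` C n).
  exact: (constructibleI hA).
apply/seteqP; split=> x /=.
  by move=> h; split=> [i /leqW/h//|]; apply: h.
by move=> [h1 h2] i; rewrite ltnS leq_eqVlt => /orP[/eqP->|/h1].
Qed.

Lemma constructible_imp C D : constr C -> constr D -> constr [set x | C x -> D x].
Proof.
move=> hC hD; rewrite (_ : [set x | _] = ~` C `|` D).
  by apply: (constructibleU hA) => //; apply: (constructibleC hA).
apply/seteqP; split=> x /=; last by move=> [].
by move=> h; have [/h|] := EM (C x); [right|left].
Qed.

(** With the order of g bounded above and that of f bounded below, [|f| <= |g|] has to be tested at
    finitely many levels only. *)
Lemma constructible_sprel m f g : constr [set x | ~ ge x m g /\ sprel x f g].
Proof.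
have [j hj] := spge_lower hA f.
pose C (i : nat) := [set x : X | ge x (i%:Z - j%:Z) g -> ge x (i%:Z - j%:Z) f].
pose n := absz (m + j%:Z).
rewrite (_ : [set x | _] = [set x | ~ ge x m g] `&` [set x | forall i, (i < n)%N -> C i x]).
  apply: (constructibleI hA); first by apply: (constructibleC hA); apply: (constructible_ge hA).
  by apply: constructible_forall => i; apply: constructible_imp; apply: (constructible_ge hA).
apply/seteqP; split=> x /= [h1].
  by move=> /(sprelE hA) h; split=> // i _; apply: h.
move=> h; split=> //; apply/(sprelE hA) => k hk.
have km : k < m by rewrite ltNge; apply/negP => mk; apply: h1; apply: (dv_le (hx x)) hk.
have [kj|kj] := leP k (- j%:Z); first exact: (dv_le (hx x)) (hj x).
have ek : k = (absz (k + j%:Z))%:Z - j%:Z by lia.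
by move: hk; rewrite ek; apply: h; rewrite /n; lia.
Qed.

Lemma sprel0_neg x a : ~ sprel x a 0 <-> exists m, ~ ge x m a.
Proof.
split=> [h|[m h] /(sprel0 hA) //].
by apply: contrapT => k; apply: h; apply/(sprel0 hA) => m; apply: contrapT => hm; apply: k; exists m.
Qed.

Lemma subbase_constructible (B : set X) x : @spa_subbase A B -> B x ->
  exists C, [/\ constr C, C x & C `<=` B].
Proof.
move=> [f [g ->]] [h1 /sprel0_neg [m h2]].
exists [set x | ~ ge x m g /\ sprel x f g]; split=> //; first exact: constructible_sprel.
by move=> y [k1 k2]; split=> //; apply/sprel0_neg; exists m.
Qed.

Lemma open_constructible (U : set X) x : open U -> U x ->
  exists C, [/\ constr C, C x & C `<=` U].
Proof.
move=> [D sD <-] [B DB Bx].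
have [E hE eB] := sD B DB.
suff H (s : seq (set X)) : {subset s <= E} ->
    exists C, [/\ constr C, C x & forall B', B' \in s -> C `<=` B'].
  have [C [hC Cx CB]] := H (enum_fset E) (fun _ h => h).
  exists C; split=> // y Cy; exists B => //; rewrite /= -eB => B' hB'.
  exact: CB hB' _ Cy.
elim: s => [|B' s IH] hs; first by exists setT; split=> //; exact: (constructibleT hA).
have [C [hC Cx CB]] : exists C, [/\ constr C, C x & forall B', B' \in s -> C `<=` B'].
  by apply: IH => y ys; apply: hs; rewrite inE ys orbT.
have hB' : B' \in E by apply: hs; rewrite inE eqxx.
have [C' [hC' Cx' CB']] : exists C, [/\ constr C, C x & C `<=` B'].
  apply: subbase_constructible.
    exact: set_mem (hE _ hB').
  by move: Bx; rewrite -eB /=; apply.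
exists (C `&` C'); split=> //; first exact: (constructibleI hA).
move=> B''; rewrite inE => /orP[/eqP->|h] y [h1 h2]; first exact: CB'.
exact: CB h _ h1.
Qed.

Lemma subbase_open f g : open [set x : X | sprel x f g /\ ~ sprel x g 0].
Proof.
set B := [set x : X | _].
exists [set B]; last by rewrite bigcup_set1.
by move=> _ ->; apply: (@finI_from1 _ _ _ id); exists f, g.
Qed.

Lemma spge_unit x e : tdef e -> ~ ge x 1 e <-> sprel x 1 e /\ ~ sprel x e 0.
Proof.
move=> he; split=> [h|[/(sprelE hA) h1 _] h2]; last by apply: (dv_n1 (hx x)); apply: h1.
split; last by apply/sprel0_neg; exists 1.
apply/(sprelE hA) => m hm.
have m0 : m <= 0.
  by rewrite leNgt; apply/negP => m0; apply: h; apply: (dv_le (hx x)) hm.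
by apply: (dv_le (hx x)) m0 _; apply: (dv1 (hx x)).
Qed.

Lemma constructible_open C : constr C -> open C.
Proof.
move=> /(constructibleE hA) [e [he hC]].
rewrite (_ : C = [set x | sprel x 1 e /\ ~ sprel x e 0]); first exact: subbase_open.
by apply/seteqP; split=> x /=; rewrite hC; apply: (spge_unit x he).1 || apply: (spge_unit x he).2.
Qed.

Lemma ideal1 (r : ratDatum A) (I : set A) : is_ideal I ->
  (forall t, t \in rat_T r -> I t) -> I 1.
Proof. by move=> hI h; apply: (@rat_open _ r). Qed.

(** The functions that are small wherever all of T is small, uniformly in the point, form an ideal.
    It contains T, hence 1; but 1 has order 0 everywhere. *)
Lemma rat_bound (r : ratDatum A) : exists m, forall x, exists2 t, t \in rat_T r & ~ ge x m t.
Proof.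
pose I := [set a : A | forall j, exists m, forall x,
  (forall t, t \in rat_T r -> ge x m t) -> ge x j a].
have hI : is_ideal I.
  split=> [j|a b ha hb j|a b hb j].
  - by exists 0 => x _; apply: (dv0 (hx x)).
  - have [m hm] := ha j; have [n hn] := hb j; exists (Order.max m n) => x h.
    apply: (dvB (hx x)); [apply: hm|apply: hn] => t /h;
      by apply: (dv_le (hx x)); rewrite le_max lexx ?orbT.
  - have [n hn] := spge_lower hA a; have [m hm] := hb (j + n%:Z); exists m => x /hm h.
    rewrite (_ : j = - n%:Z + (j + n%:Z)); last by lia.
    exact: (dvM (hx x)).
have I1 : I 1.
  by apply: (ideal1 (r := r) hI) => t ht j; exists j => x h; apply: h.
have [m hm] := I1 1; exists m => x; apply: contrapT => h.
apply: (dv_n1 (hx x)); apply: hm => t ht; apply: contrapT => h'.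
by apply: h; exists t.
Qed.

Lemma rset_bound (r : ratDatum A) : exists m, forall x, rset r x -> ~ ge x m (rat_s r).
Proof.
have [m hm] := rat_bound r; exists m => x [h _] xs.
by have [t ht] := hm x; apply; have /(sprelE hA) := h t ht; apply.
Qed.

Lemma rset_constructible (r : ratDatum A) : constr (rset r).
Proof.
have [m hm] := rset_bound r.
pose C t := [set x : X | ~ ge x m (rat_s r) /\ sprel x t (rat_s r)].
have H (s : seq A) : constr [set x | forall t, t \in s -> C t x].
  elim: s => [|t s IH].
    by rewrite (_ : [set x | _] = setT); [apply: (constructibleT hA)|apply/seteqP].
  rewrite (_ : [set x | _] = C t `&` [set x | forall t, t \in s -> C t x]).
    by apply: (constructibleI hA) => //; apply: constructible_sprel.
  apply/seteqP; split=> x /=.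
    move=> h; split=> [|t' ht']; apply: h; rewrite inE ?eqxx //.
    by rewrite ht' orbT.
  by move=> [h1 h2] t'; rewrite inE => /orP[/eqP->|/h2].
rewrite (_ : rset r = ~` [set x | ge x m (rat_s r)] `&`
                      [set x | forall t, t \in rat_T r -> C t x]).
  by apply: (constructibleI hA) => //; apply: (constructibleC hA); apply: (constructible_ge hA).
apply/seteqP; split=> x.
  move=> xr; split=> /=; first exact: hm.
  by move=> t ht; split; [exact: hm|have [h _] := xr; apply: h].
move=> /= [h1 h2]; split=> [t /h2 []//|].
by apply/sprel0_neg; exists m.
Qed.

Definition unitDatum (e : A) : ratDatum A.
Proof.
by apply: (@RatDatum A [:: 1] e); apply: idgen_sub; rewrite /= inE.
Defined.

Lemma rset_unitDatum e : tdef e -> rset (unitDatum e) = [set x | ~ ge x 1 e].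
Proof.
move=> he; apply/seteqP; split=> x /=.
  by move=> [h1 h2]; apply/(spge_unit x he); split=> //; apply: h1; rewrite /= inE.
move=> /(spge_unit x he) [h1 h2]; split=> // t.
by rewrite /= inE => /eqP->.
Qed.

Lemma constructible_rational C : constr C -> exists r : ratDatum A, rset r = C.
Proof.
move=> /(constructibleE hA) [e [he hC]]; exists (unitDatum e).
by rewrite rset_unitDatum //; apply/seteqP; split=> x /=; rewrite hC.
Qed.

(* The limit of an ultrafilter is the point whose order function is the
   limit of the order functions. *)
Lemma constructible_compact (P : set X -> Prop) : P set0 ->
    (forall C D, P C -> P D -> P (C `|` D)) ->
    (forall x, exists C, [/\ constr C, C x & P C]) -> P setT.
Proof.
move=> P0 PU Pcov; apply: contrapT => PT.
pose F := [set Y : set X | exists2 C, P C & ~` C `<=` Y].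
have FF : ProperFilter F.
  split; last first.
    split; first by exists set0.
      move=> Y Z [C PC CY] [D PD DZ]; exists (C `|` D); first exact: PU.
      by rewrite setCU => x [/CY ? /DZ ?].
    by move=> Y Z YZ [C PC CY]; exists C => //; apply: subset_trans YZ.
  move=> [C PC CY]; apply: PT; rewrite (_ : setT = C) //.
  by apply/seteqP; split=> // x _; apply: contrapT => /CY.
have [U [UU FU]] := ultraFilterLemma FF.
pose G (m : int) := [set a : A | U [set x | ge x m a]].
have UT (Y : set X) : (forall x, Y x) -> U Y.
  by move=> h; rewrite (_ : Y = setT); [exact: filterT|apply/seteqP; split].
have U0 : ~ U set0 by apply: filter_not_empty.
have UC (Y : set X) : ~ U Y -> U (~` Y) by have [] := in_ultra_setVsetC Y UU.
have UI (Y Z W : set X) : U Y -> U Z -> (forall x, Y x -> Z x -> W x) -> U W.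
  move=> h k H; apply: (@filterS _ _ _ (Y `&` Z)); last exact: filterI.
  by move=> x [? ?]; apply: H.
have hG : dv_filtration G.
  split.
  - by move=> m; apply: UT => x; apply: (dv0 (hx x)).
  - by move=> m a b ha hb; apply: UI ha hb _ => x; apply: (dvB (hx x)).
  - by move=> m n a mn ha; apply: filterS ha => x; apply: (dv_le (hx x)).
  - by move=> a; have [n hn] := spge_lower hA a; exists (- n%:Z); apply: UT.
  - by move=> m n a b ha hb; apply: UI ha hb _ => x; apply: (dvM (hx x)).
  - move=> m n a b /UC ha /UC hb hab; apply: U0.
    by apply: UI hab (filterI ha hb) _ => x /= h [h1 h2]; case: (dv_nM (hx x) h1 h2).
  - by apply: UT => x; exact: (dv1 (hx x)).
  - by move=> h; apply: U0; apply: filterS h => x /(dv_n1 (hx x)).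
have Gd a : tdef a -> G 0 a by move=> ha; apply: UT => x; apply: spge_def.
have Gp a : tplus a -> G 0 a by rewrite (rf_plus hA); apply: Gd.
have G1 : G 1 pi by apply: UT => x; apply: (spge_pz x 1).
have GV : G (-1) (tpi_inv A) by apply: UT => x; apply: (spge_pz x (-1)).
pose x := dv_point hG Gp Gd G1 GV.
(* The limit point lies in some C with [P C]. Membership in C is a condition on an order, so it
   passes from the limit to a member of U, whereas U contains the complement of C. *)
have [C [hC Cx PC]] := Pcov x.
have [e [he hCe]] := constructibleE hA hC.
have nC : U (~` C) by apply: FU; exists C.
have nge : U (~` [set y | ge y 1 e]).
  by apply: UC => h; move: Cx => /hCe; apply; apply/dv_pointE.
by apply: U0; apply: UI nC nge _ => y /= h1 h2; apply: h1; apply/hCe.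
Qed.

End Topology.

(** * Completed rational localizations *)

Section CompletionTheory.
Variables (R : comPzRingType) (T : ringTop R).
Local Notation cls u := (@cls (compl_setoid T) u).

Lemma compl_nbdE n (u : cauchySeq T) :
  compl_nbd T n (cls u) <-> exists N, forall i, (N <= i)%N -> nbd T n (u i).
Proof.
split=> [[v [/clsE e hv]]|[N hN]].
  have [N h] := e n; exists N => i /h hi.
  by rewrite -(subrK (v i) (u i)); apply: nbdD.
have cu : cauchy T (fun i => u (N + i)%N).
  move=> m; have [k hk] := cs_prop u m; exists k => i j hi hj.
  by apply: hk; apply: leq_trans (leq_addl _ _).
exists (CauchySeq cu); split=> [|i /=]; last by apply: hN; apply: leq_addr.
apply/clsE => m; have [k hk] := cs_prop u m; exists k => i hi /=.
by apply: hk => //; apply: leq_trans (leq_addl _ _).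
Qed.

Lemma complP (z : compl T) : exists u : cauchySeq T, z = cls u.
Proof. by elim/quoP: z => u; exists u. Qed.

Lemma compl_nbd0 n : compl_nbd T n 0.
Proof. by apply/(compl_nbdE n (CauchySeq (cauchy_cst T 0))); exists 0%N => i _; apply: nbd0. Qed.

Lemma compl_nbdB n x y : compl_nbd T n x -> compl_nbd T n y -> compl_nbd T n (x - y).
Proof.
have [u ->] := complP x; have [v ->] := complP y.
move=> /compl_nbdE [N hN] /compl_nbdE [M hM]; rewrite -clsN -clsD; apply/compl_nbdE.
exists (maxn N M) => i; rewrite geq_max => /andP[/hN h1 /hM h2] /=; exact: nbdB.
Qed.

Lemma compl_nbdN n x : compl_nbd T n x -> compl_nbd T n (- x).
Proof. by move=> h; rewrite -sub0r; apply: compl_nbdB => //; apply: compl_nbd0. Qed.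

Lemma compl_nbdD n x y : compl_nbd T n x -> compl_nbd T n y -> compl_nbd T n (x + y).
Proof. by move=> h k; rewrite -[y]opprK; apply: compl_nbdB => //; apply: compl_nbdN. Qed.

Lemma compl_nbd_le m n x : (m <= n)%N -> compl_nbd T n x -> compl_nbd T m x.
Proof.
move=> mn; have [u ->] := complP x => /compl_nbdE [N hN]; apply/compl_nbdE.
by exists N => i /hN; apply: nbd_le.
Qed.

Lemma compl_nbd_in n x : compl_nbd T n (compl_in T x) <-> nbd T n x.
Proof.
split=> [/compl_nbdE [N h]|h]; first exact: h (leqnn N).
by apply/compl_nbdE; exists 0%N.
Qed.

Lemma compl_approx n (u : cauchySeq T) : exists N, forall i, (N <= i)%N ->
  compl_nbd T n (cls u - compl_in T (u i)).
Proof.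
have [N hN] := cs_prop u n; exists N => i Ni.
rewrite /compl_in -clsN -clsD; apply/compl_nbdE; exists N => j Nj /=.
exact: hN.
Qed.

Lemma compl_sep x : (forall n, compl_nbd T n x) -> x = 0.
Proof.
have [u ->] := complP x => h; apply/clsE => n.
by have /compl_nbdE [N hN] := h n; exists N => i /hN /=; rewrite subr0.
Qed.

Lemma compl_nbd_mull x n : exists m, forall y, compl_nbd T m y -> compl_nbd T n (x * y).
Proof.
have [u ->] := complP x; have [k hk] := nbd_mul T n; have [N hN] := cs_prop u k.
have [l hl] := nbd_mull T (u N) n; exists (maxn k l) => y.
have [v ->] := complP y => /compl_nbdE [M hM]; rewrite -clsM; apply/compl_nbdE.
exists (maxn N M) => i; rewrite geq_max => /andP[Ni /hM h] /=.
rewrite (_ : u i * v i = u N * v i + (u i - u N) * v i); last by ring.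
apply: nbdD; first by apply: hl; apply: nbd_le h; rewrite leq_maxr.
by apply: hk; [apply: hN|apply: nbd_le h; rewrite leq_maxl].
Qed.

End CompletionTheory.

Section RationalLocalization.
Variables (A : tatePair) (hA : residually_finite A) (r : ratDatum A).
Local Notation X := (spa A).
Local Notation pi := (tpi A).
Local Notation pz := (tpiz A).
Local Notation ge := (@spge A).
Local Notation hx := (spge_filtration hA).
Local Notation constr := (@constructible A).
Local Notation s := (rat_s r).
Local Notation lin := (loc_in s).
Local Notation D := (@rdef A r).
Local Notation nbd := (@rnbd A r).

Let hD : is_subring D. Proof. exact: ringgen_subring. Qed.
Let DM a b : D a -> D b -> D (a * b). Proof. by have [_ _ h] := hD; apply: h. Qed.

Lemma rdef_in a : tdef a -> D (lin a).
Proof. by move=> ha; apply: ringgen_sub; left; exists a. Qed.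

Lemma frac_pow a k : frac s a k = lin a * frac s 1 1 ^+ k.
Proof.
rewrite fracE; congr (_ * _); elim: k => [//|k IH].
by rewrite exprS -IH frac_mul mulr1.
Qed.

Lemma lin_s_frac : lin s * frac s 1 1 = 1.
Proof. by rewrite frac_mul; apply/frac_eq; exists 0%N; rewrite !mulr1 expr0 expr1 !mul1r. Qed.

Lemma rdef_sprel y : D y -> exists a k, y = frac s a k /\
  forall x, rset r x -> sprel x a (s ^+ k).
Proof.
move=> hy; pose E := [set y | exists a k, y = frac s a k /\
  forall x, rset r x -> sprel x a (s ^+ k)].
apply: (hy E); last first.
  move=> _ [[a ha <-]|[t ht <-]].
    by exists a, 0%N; split=> // x _; rewrite expr0; apply: (spge_def hA x ha).
  by exists t, 1%N; split=> // x [h _]; apply: h.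
split.
- exists 1, 0%N; split=> // x _; rewrite expr0.
  by apply/(sprelE hA).
- move=> _ _ [a [k [-> ha]]] [b [l [-> hb]]].
  have -> : - frac s b l = frac s (- b) l by rewrite /frac -clsN.
  rewrite frac_add; exists (a * s ^+ l + - b * s ^+ k), (k + l)%N; split=> // x xr.
  have := ha x xr; have := hb x xr; have [v [_ _ ->]] := spP x => h1 h2.
  apply: vrelD; rewrite exprD.
    by apply: vrelM => //; apply: vrel_refl.
  rewrite mulNr; apply: vrelN; rewrite mulrC; apply: vrelM => //; apply: vrel_refl.
- move=> _ _ [a [k [-> ha]]] [b [l [-> hb]]].
  exists (a * b), (k + l)%N; rewrite frac_mul; split=> // x xr.
  have := ha x xr; have := hb x xr; have [v [_ _ ->]] := spP x => h1 h2.
  by rewrite exprD; apply: vrelM.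
Qed.

Lemma rnbd_spge n a : nbd n (lin a) -> forall x, rset r x -> ge x n%:Z a.
Proof.
move=> [d [/rdef_sprel [b [k [-> hb]]]]] e x xr; move: e.
rewrite -rmorphXn /= {2}/loc_in frac_mul add0n => /frac_eq [m].
rewrite expr0 mulr1 => e; have := hb x xr; have [_] := xr; rewrite /spge /=.
have [v [_ _ ->]] := spP x => h1 h2.
have hs j : ~ vrel v (s ^+ j) 0.
  by elim: j => [|j IH]; [exact: vrel_10|rewrite exprS; apply: vrel_mul0].
apply: (vrel_cancel (hs m)); apply: (vrel_cancel (hs k)).
have -> : s ^+ k * (s ^+ m * a) = s ^+ m * pi ^+ n * b by rewrite -mulrA -e; ring.
have -> : s ^+ k * (s ^+ m * pi ^+ n) = s ^+ m * pi ^+ n * s ^+ k by ring.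
exact: vrel_mul.
Qed.

(* At a point outside the rational subset, some [t] in [T] has an order smaller
   than that of [s]; then [t * t'], for an approximate inverse [t'] of [t], is
   congruent to 1 and equal to [(t / s) * (s * t')], a multiple of [pi]. *)
Lemma off_rset_local x : ~ rset r x -> exists C, [/\ constr C, C x & exists q,
  [/\ tdef q, exists2 d, D d & lin q = lin pi * d & forall y, C y -> ge y 1 (q - 1)]].
Proof.
move=> xr.
have [t [i [ht hs hi]]] : exists t i, [/\ t \in rat_T r, ge x i s & ~ ge x i t].
  have [m hm] := rat_bound hA r; have [t0 ht0 t0m] := hm x.
  have [h|h] := EM (forall t, t \in rat_T r -> sprel x t s).
    exists t0, m; split=> //; apply: contrapT => sm; apply: xr; split=> //.
    by apply/(sprel0_neg hA); exists m.
  apply: contrapT => k; apply: h => t ht; apply/(sprelE hA) => m' hm'.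
  by apply: contrapT => h; apply: k; exists t, m'.
pose C := [set x : X | ge x i s] `&` ~` [set x : X | ge x i t].
have hC : constr C.
  by apply: (constructibleI hA); last apply: (constructibleC hA); apply: constructible_ge.
have [j hj] := spge_lower hA s; have [j' hj'] := spge_lower hA t.
(* The order [j + j' + 1] of t' off C absorbs the poles of s and of t, and the division of [s * t']
   by pi. On C, t has order at most [i - 1] and [t * t'] order at least 0, so t' has order at least
   [1 - i] and pi divides [s * t'] as well. *)
have [t' [h1 h2]] : exists s', (forall x, C x -> ge x (j + j').+1%:Z (t * s' - 1)) /\
    (forall x, ~ C x -> ge x (j + j').+1%:Z s').
  by apply: (approx_inv hA (j + j').+1 hC (m := i)) => y [].
have ht'1 y : C y -> ge y 0 (t * t').
  move=> yC; rewrite -(subrK 1 (t * t')); apply: (dvD (hx y)); last exact: (dv1 (hx y)).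
  by apply: (spge_le hA) (h1 y yC).
exists C; split=> //; exists (t * t'); split=> [||y yC]; last first.
- by apply: (spge_le hA) (h1 y yC).
- pose g := pz (-1) * (s * t').
  have hg : tdef g.
    apply: (spge_sep hA) => y; rewrite -(addNr 1); apply/(spgeM_pz hA).
    have [yC|yC] := EM (C y).
      have [ys yt] := yC; rewrite (_ : 1 = i + (1 - i)); last by lia.
      apply: (dvM (hx y)) => //; apply: contrapT => h.
      apply: (dv_nM (hx y) (m := i - 1) (n := - i) (a := t) (b := t')).
      + by rewrite subrK.
      + by rewrite addrC.
      + by rewrite (_ : i - 1 - i + 1 = 0); [apply: ht'1|lia].
    apply: (spge_le hA (n := - j%:Z + (j + j').+1%:Z)); first by lia.
    by apply: (dvM (hx y)) => //; apply: h2.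
  exists (lin g * frac s t 1).
    by apply: DM; [exact: rdef_in|apply: ringgen_sub; right; exists t].
  have eg : pi * g = s * t' by exact: (tpizNK 1).
  rewrite mulrA -rmorphM /= eg frac_mul; apply/frac_eq; exists 0%N.
  by rewrite expr0 expr1 !mul1r mulr1; ring.
- apply: (spge_sep hA) => y; have [yC|yC] := EM (C y); first exact: ht'1.
  apply: (spge_le hA (n := - j'%:Z + (j + j').+1%:Z)); first by lia.
  by apply: (dvM (hx y)) => //; apply: h2.
Qed.

(** Compactness serves as an induction principle. For a union, p and q are combined into
    [1 - (1 - p) * (1 - q)], still a multiple of pi in [D]; near a point of the rational subset
    nothing is required, and 0 will do. *)
Lemma off_rset : exists q,
  [/\ tdef q, exists2 d, D d & lin q = lin pi * d & forall y, ~ rset r y -> ge y 1 (q - 1)].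
Proof.
pose P (C : set X) := exists q, [/\ tdef q, exists2 d, D d & lin q = lin pi * d
  & forall y, C y -> ~ rset r y -> ge y 1 (q - 1)].
have P0 : P set0.
  exists 0; split=> //; first by apply: subring0; apply: tdef_subring.
  by exists 0; [apply: subring0|rewrite rmorph0 mulr0].
suff [q [h1 h2 h3]] : P setT by exists q; split=> // y yr; apply: h3.
apply: (constructible_compact hA) => //.
- move=> B C [p [p1 [d hd p2] p3]] [q [q1 [e he q2] q3]]; exists (p + q - p * q); split.
  + apply: tdefB; last exact: tdefM.
    by apply: subringD => //; apply: tdef_subring.
  + exists (d + e - d * lin q).
      have [_ DB _] := hD; apply: DB; last by apply: DM => //; apply: rdef_in.
      exact: (subringD hD).
    by rewrite rmorphB rmorphD rmorphM /= p2 q2; ring.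
  + have p0 y : ge y 0 (1 - p).
      by apply: spge_def => //; apply: tdefB => //; apply: tdef1.
    have q0 y : ge y 0 (1 - q).
      by apply: spge_def => //; apply: tdefB => //; apply: tdef1.
    move=> y yBC yr; rewrite (_ : _ - 1 = - ((1 - p) * (1 - q))); last by ring.
    apply: (dvN (hx y)); case: yBC => yC.
      apply: (dvMr0 (hx y)) => //; rewrite -opprB; apply: (dvN (hx y)); exact: p3.
    apply: (dvM0 (hx y)) => //; rewrite -opprB; apply: (dvN (hx y)); exact: q3.
- move=> x; have [xr|xr] := EM (rset r x).
    exists (rset r); split=> //; first exact: rset_constructible.
    have [q [h1 h2 _]] := P0; by exists q; split.
  have [C [hC Cx [q [h1 h2 h3]]]] := off_rset_local xr.
  by exists C; split=> //; exists q; split=> // y yC _; apply: h3.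
Qed.

(** Outside the rational subset [1 - q ^+ N] has order at least 1, so its N-th power is small there.
    And 1 minus this N-th power is a multiple of [q ^+ N], which pi^N divides in the ring of
    definition. *)
Lemma rset_indicator (N : nat) : exists e,
  [/\ tdef e, (forall y, ~ rset r y -> ge y N%:Z e) & nbd N (lin (1 - e))].
Proof.
have [q [hq [d hd qd] h]] := off_rset; exists ((1 - q ^+ N) ^+ N).
have hw : tdef (1 - q ^+ N) by apply: tdefB; [exact: tdef1|exact: tdefX].
split; first exact: tdefX.
  move=> y yr; have := @dvX _ _ (hx y) 1 N (1 - q ^+ N); rewrite muln1; apply.
  rewrite -opprB; apply: (dvN (hx y)); apply: (spge_exprB1 hA) => //; exact: h.
pose S := \sum_(i < N) (1 - q ^+ N) ^+ i.
have -> : 1 - (1 - q ^+ N) ^+ N = q ^+ N * S.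
  by rewrite -opprB subrX1 addrAC subrr add0r mulNr opprK.
exists (d ^+ N * lin S); split; last by rewrite rmorphM rmorphXn /= qd exprMn mulrA.
apply: DM; first exact: (subringX _ hD).
apply: rdef_in; apply: big_ind => [|a b ha hb|i _].
- by apply: subring0; apply: tdef_subring.
- by apply: subringD => //; apply: tdef_subring.
- exact: tdefX.
Qed.

(** For the converse, the quotient b of a by pi^n is integral on the rational subset but may have
    poles outside. Then [b * e] is integral everywhere for an approximate indicator e, and
    [b * (1 - e)] lies in [D] because pi^j, which clears the poles of b, divides [1 - e] in [D]. *)
Lemma rnbdE n a : nbd n (lin a) <-> forall x, rset r x -> ge x n%:Z a.
Proof.
split; first exact: rnbd_spge.
move=> h; pose b := pz (- n%:Z) * a.
have eb : a = pi ^+ n * b by rewrite /b -[pi ^+ n]/(pz n%:Z) tpizNK.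
have hb x : rset r x -> ge x 0 b.
  by move=> xr; rewrite -(addNr n%:Z); apply/(spgeM_pz hA); apply: h.
have [j hj] := tdef_absorb b.
have hj' x : ge x (- j%:Z) b.
  by apply/(spgeM_pz hA x j%:Z); rewrite subrr; apply: spge_def.
have [e [he e1 [d [hd ed]]]] := rset_indicator j.
exists (lin b); split; last by rewrite {1}eb rmorphM rmorphXn.
rewrite (_ : b = b * e + b * (1 - e)); last by ring.
rewrite rmorphD; apply: (subringD hD) => /=.
  apply: rdef_in; apply: (spge_sep hA) => x; have [xr|xr] := EM (rset r x).
    by apply: (dvM0 (hx x)); [exact: hb|exact: spge_def].
  by rewrite -(addNr j%:Z); apply: (dvM (hx x)) => //; apply: e1.
rewrite rmorphM /= ed mulrA -rmorphXn -rmorphM /= [b * _]mulrC.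
by apply: DM => //; apply: rdef_in.
Qed.

(** The closure of A is a subring, so only [1 / s] matters. If s' is an approximate inverse of s on
    the rational subset, then [1 / s - s'] is [(1 - s * s') / s], small by [rnbdE]; the additional
    precision c makes up for the denominator s. *)
Lemma rloc_dense y n : exists a, nbd n (y - lin a).
Proof.
pose E := [set y | forall n, exists a, nbd n (y - lin a)].
have nB k a b : nbd k a -> nbd k b -> nbd k (a - b) by apply: (nbdB (r := rtop r)).
have nD k a b : nbd k a -> nbd k b -> nbd k (a + b) by apply: (@nbdD _ (rtop r)).
have hE : is_subring E.
  split.
  - by move=> k; exists 1; rewrite rmorph1 subrr; apply: (nbd0 (rtop r)).
  - move=> y1 y2 h1 h2 k; have [a1 k1] := h1 k; have [a2 k2] := h2 k.
    exists (a1 - a2); rewrite rmorphB /= (_ : _ - _ = (y1 - lin a1) - (y2 - lin a2)).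
      exact: nB.
    by ring.
  - move=> y1 y2 h1 h2 k; have [m hm] := nbd_mull (rtop r) y1 k.
    have [a2 k2] := h2 m; have [l hl] := nbd_mull (rtop r) (lin a2) k.
    have [a1 k1] := h1 l; exists (a1 * a2); rewrite rmorphM /=.
    rewrite (_ : _ - _ = y1 * (y2 - lin a2) + lin a2 * (y1 - lin a1)).
      by apply: nD; [apply: hm|apply: hl].
    by ring.
have E1 a : E (lin a) by move=> k; exists a; rewrite subrr; apply: (nbd0 (rtop r)).
have E2 : E (frac s 1 1).
  move=> k; have [c hc] := rdef_absorb (frac s 1 1).
  have [m hm] := rset_bound hA r.
  have [s' [h1 _]] := approx_inv hA (k + c) (rset_constructible hA r) hm.
  have /rnbdE [d [hd ed]] : forall x, rset r x -> ge x (k + c)%N%:Z (1 - s * s').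
    by move=> x xr; rewrite -opprB; apply: (dvN (hx x)); apply: h1.
  exists s', (d * (lin pi ^+ c * frac s 1 1)); split; first exact: DM.
  rewrite (_ : _ - _ = lin (1 - s * s') * frac s 1 1); last first.
    by rewrite rmorphB rmorph1 rmorphM /= mulrBl mul1r mulrAC lin_s_frac mul1r.
  by rewrite ed exprD; ring.
suff : E y by apply.
elim/fracP: y => a k; rewrite frac_pow; have [_ _ EM'] := hE.
by apply: EM' => //; apply: (subringX _ hE).
Qed.

End RationalLocalization.

(** * The structure sheaf *)

Section AbstractIdentities.
Variable R : comPzRingType.
Implicit Types a b z w : R.

Lemma subr_swap z a b : a - b = (z - b) - (z - a).
Proof. by ring. Qed.
Lemma subr_shift a z w : z - w = (z - a) - (w - a).
Proof. by ring. Qed.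
Lemma subr_sub z w a b : (z - w) - (a - b) = (z - a) - (w - b).
Proof. by ring. Qed.
Lemma mulr_sub z w a b : z * w - a * b = z * (w - b) + b * (z - a).
Proof. by ring. Qed.

End AbstractIdentities.

Lemma compl_nbd_trans (R : comPzRingType) (T : ringTop R) n (z y y' : compl T) :
  compl_nbd T n (z - y) -> compl_nbd T n (y - y') -> compl_nbd T n (z - y').
Proof. by move=> h k; rewrite -(subrK y z) -addrA; apply: compl_nbdD. Qed.

Lemma rstrB (A : tatePair) (r : ratDatum A) a b : rstr r (a - b) = rstr r a - rstr r b.
Proof. by rewrite /rstr /= !rmorphB. Qed.
Lemma rstrM (A : tatePair) (r : ratDatum A) a b : rstr r (a * b) = rstr r a * rstr r b.
Proof. by rewrite /rstr /= !rmorphM. Qed.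
Lemma rstr0 (A : tatePair) (r : ratDatum A) : rstr r 0 = 0.
Proof. by rewrite /rstr /= !rmorph0. Qed.
Lemma rstr1 (A : tatePair) (r : ratDatum A) : rstr r 1 = 1.
Proof. by rewrite /rstr /= !rmorph1. Qed.

Section Approximation.
Variables (A : tatePair) (hA : residually_finite A).
Local Notation X := (spa A).
Local Notation ge := (@spge A).
Local Notation hx := (spge_filtration hA).
Local Notation constr := (@constructible A).

Definition approx (r : ratDatum A) (z : rcompl r) (n : nat) (a : A) : Prop :=
  compl_nbd (rtop r) n (z - rstr r a).

Section OneDatum.
Variable r : ratDatum A.
Implicit Types z w : rcompl r.

Lemma rstr_nbd n a : compl_nbd (rtop r) n (rstr r a) <->
  forall x, rset r x -> ge x n%:Z a.
Proof. by rewrite compl_nbd_in; apply: (rnbdE hA). Qed.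

Lemma approx_ex z n : exists a, approx z n a.
Proof.
have [u ->] := complP z; have [N hN] := compl_approx n u.
have [a ha] := rloc_dense hA (u N) n; exists a.
apply: (compl_nbd_trans (hN N (leqnn N))); rewrite /rstr /= -rmorphB.
exact/compl_nbd_in.
Qed.

Lemma approx_rstr a n : approx (rstr r a) n a.
Proof. by rewrite /approx subrr; apply: compl_nbd0. Qed.

Lemma approx_ge z n a b : approx z n a -> approx z n b ->
  forall x, rset r x -> ge x n%:Z (a - b).
Proof.
move=> ha hb; apply/rstr_nbd; rewrite rstrB.
rewrite (subr_swap z); exact: (compl_nbdB hb ha).
Qed.

Lemma approx_change z n a b : approx z n a ->
  (forall x, rset r x -> ge x n%:Z (a - b)) -> approx z n b.
Proof.
by move=> ha /rstr_nbd hb; apply: compl_nbd_trans ha _; rewrite -rstrB.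
Qed.

Lemma approx_le z m n a : (m <= n)%N -> approx z n a -> approx z m a.
Proof. exact: compl_nbd_le. Qed.

Lemma approx_uniq z w : (forall n, exists2 a, approx z n a & approx w n a) -> z = w.
Proof.
move=> h; apply/eqP; rewrite -subr_eq0; apply/eqP; apply: compl_sep => n.
have [a ha hb] := h n.
by rewrite (subr_shift (rstr r a)); apply: (compl_nbdB ha hb).
Qed.

Lemma approx_lim (a : nat -> A) :
  (forall n i, (n <= i)%N -> forall x, rset r x -> ge x n%:Z (a i - a n)) ->
  exists z, forall n, approx z n (a n).
Proof.
move=> h; have nh n i : (n <= i)%N -> nbd (rtop r) n (loc_in (rat_s r) (a i - a n)).
  by move=> ni; apply/(rnbdE hA); apply: h.
have cu : cauchy (rtop r) (fun i => loc_in (rat_s r) (a i)).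
  move=> n; exists n => i j ni nj; rewrite -rmorphB /=.
  rewrite (_ : a i - a j = (a i - a n) - (a j - a n)); last by ring.
  by rewrite rmorphB; exact: (nbdB (nh n i ni) (nh n j nj)).
exists (cls (CauchySeq cu : compl_setoid (rtop r))) => n; rewrite /approx /rstr /=.
rewrite /compl_in -clsN -clsD; apply/compl_nbdE; exists n => i ni /=.
by rewrite -rmorphB; apply: nh.
Qed.

Lemma approxB z w n a b : approx z n a -> approx w n b -> approx (z - w) n (a - b).
Proof.
move=> h k; rewrite /approx rstrB.
by rewrite subr_sub; apply: (compl_nbdB h k).
Qed.

(** In [z * w - a * b = z * (w - b) + b * (z - a)], the precision for b depends on z, and the one
    for a on the chosen b: hence the nested quantifiers. *)
Lemma approxM z w n : exists k, forall b, approx w k b ->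
  exists l, forall a, approx z l a -> approx (z * w) n (a * b).
Proof.
have [k hk] := compl_nbd_mull z n; exists k => b hb.
have [l hl] := compl_nbd_mull (rstr r b) n; exists l => a ha.
rewrite /approx rstrM.
rewrite mulr_sub.
by apply: (compl_nbdD (hk _ hb) (hl _ ha)).
Qed.

End OneDatum.

(* [z'] is the image of [z] under the restriction from [r] to [r']. *)
Definition corr (r r' : ratDatum A) (z : rcompl r) (z' : rcompl r') : Prop :=
  forall n a, approx z n a -> approx z' n a.

Section TwoData.
Variables (r r' : ratDatum A) (rr' : rset r' `<=` rset r).

Lemma corrI (z : rcompl r) (z' : rcompl r') :
  (forall n, exists2 a, approx z n a & approx z' n a) -> corr z z'.
Proof.
move=> h n a ha; have [b hb hb'] := h n.
by apply: (approx_change hb') => x /rr'; exact: (approx_ge hb ha).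
Qed.

Lemma corr_uniq (z : rcompl r) (z1 z2 : rcompl r') : corr z z1 -> corr z z2 -> z1 = z2.
Proof.
move=> h1 h2; apply: approx_uniq => n; have [a ha] := approx_ex z n.
by exists a; [exact: h1 ha|exact: h2 ha].
Qed.

Lemma corr_ex (z : rcompl r) : exists z' : rcompl r', corr z z'.
Proof.
have /choice [a ha] : forall n, exists a, approx z n a by exact: approx_ex.
have [z' hz'] : exists z' : rcompl r', forall n, approx z' n (a n).
  apply: approx_lim => n i ni x /rr'.
  exact: (approx_ge (approx_le ni (ha i)) (ha n)).
by exists z'; apply: corrI => n; exists (a n).
Qed.

Definition restr (z : rcompl r) : rcompl r' := projT1 (cid (corr_ex z)).

Lemma restrP z : corr z (restr z).
Proof. by rewrite /restr; case: cid. Qed.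

Lemma corrB (z w : rcompl r) (z' w' : rcompl r') : corr z z' -> corr w w' -> corr (z - w) (z' - w').
Proof.
move=> hz hw; apply: corrI => n.
have [a ha] := approx_ex z n; have [b hb] := approx_ex w n.
by exists (a - b); [exact: (approxB ha hb)|exact: (approxB (hz _ _ ha) (hw _ _ hb))].
Qed.

Lemma corrM (z w : rcompl r) (z' w' : rcompl r') : corr z z' -> corr w w' -> corr (z * w) (z' * w').
Proof.
move=> hz hw; apply: corrI => n.
have [k hk] := approxM z w n; have [k' hk'] := approxM z' w' n.
have [b hb] := approx_ex w (maxn k k').
have [l hl] := hk b (approx_le (leq_maxl _ _) hb).
have [l' hl'] := hk' b (approx_le (leq_maxr _ _) (hw _ _ hb)).
have [a ha] := approx_ex z (maxn l l').
exists (a * b); first exact: hl (approx_le (leq_maxl _ _) ha).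
exact: hl' (approx_le (leq_maxr _ _) (hz _ _ ha)).
Qed.

Lemma corr_rstr a : corr (rstr r a) (rstr r' a).
Proof. by apply: corrI => n; exists a; apply: approx_rstr. Qed.

Lemma restr_additive : zmod_morphism restr.
Proof. by move=> z w; apply: (@corr_uniq (z - w)); [|apply: corrB]; apply: restrP. Qed.
Lemma restr_multiplicative : monoid_morphism restr.
Proof.
split; last by move=> z w; apply: (@corr_uniq (z * w)); [|apply: corrM]; apply: restrP.
apply: (@corr_uniq 1); first exact: restrP.
by have := @corr_rstr 1; rewrite !rstr1.
Qed.
HB.instance Definition _ := GRing.isZmodMorphism.Build (rcompl r) (rcompl r') restr restr_additive.
HB.instance Definition _ :=
  GRing.isMonoidMorphism.Build (rcompl r) (rcompl r') restr restr_multiplicative.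

Lemma restr_transition : rtransition restr.
Proof.
split=> [a|n]; first by apply: (corr_uniq (@restrP (rstr r a)) (@corr_rstr a)).
exists n => z hz; have : approx z n 0 by rewrite /approx rstr0 subr0.
by move/restrP; rewrite /approx rstr0 subr0.
Qed.

Lemma transition_corr (t : {rmorphism rcompl r -> rcompl r'}) z :
  rtransition t -> corr z (t z).
Proof.
move=> [t1 t2]; apply: corrI => n; have [m hm] := t2 n.
have [a ha] := approx_ex z (maxn m n); exists a.
  exact: approx_le (leq_maxr _ _) ha.
by rewrite /approx -t1 -rmorphB; apply: hm; apply: approx_le (leq_maxl _ _) ha.
Qed.

End TwoData.

(** A being dense, a continuous homomorphism of A-algebras can only be [restr]. So compatibility is
    tested on approximations by elements of A, without any homomorphism. *)
Lemma rcompatE U (f : rfam U) : rcompat f <-> forall r r' : ratIn U,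
  rset (sval r') `<=` rset (sval r) -> corr (f r) (f r').
Proof.
split=> h r r' rr'.
  by rewrite -(h r r' rr' _ (restr_transition rr')); apply: restrP.
move=> t ht; apply: corr_uniq (h r r' rr'); exact: (transition_corr rr').
Qed.

Section Germs.
Variable U : opens X.

(** Congruence of f and a modulo pi^n at the point x. A section is a family over all presentations;
    this local form frees it from them, the choice of r being irrelevant by [gapprox_ge]. *)
Definition gapprox (f : osec U) (x : X) (n : nat) (a : A) : Prop :=
  exists (r : ratIn U) b, [/\ rset (sval r) x, approx (oval f r) n b & ge x n%:Z (a - b)].

Lemma oval_corr (f : osec U) (r r' : ratIn U) :
  rset (sval r') `<=` rset (sval r) -> corr (oval f r) (oval f r').
Proof. by have /rcompatE := sr_prop f; apply. Qed.

Lemma ratIn_nbhd C x : constr C -> C x -> oset U x -> exists r : ratIn U,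
  rset (sval r) x /\ rset (sval r) `<=` C.
Proof.
move=> hC Cx Ux; have [D [hD Dx DU]] := open_constructible hA (oset_open U) Ux.
have [r er] := constructible_rational hA (constructibleI hA hC hD).
have rU : rset r `<=` U by rewrite er; apply: subset_trans DU => y [].
by exists (exist _ r rU); rewrite /= er; split=> // y [].
Qed.

Lemma gapprox_in f x n a : gapprox f x n a -> oset U x.
Proof. by move=> [r [b [xr _ _]]]; apply: (svalP r). Qed.

Lemma gapprox_ge f x n a (r : ratIn U) b : gapprox f x n a -> rset (sval r) x ->
  approx (oval f r) n b -> ge x n%:Z (a - b).
Proof.
move=> h xr hb; have Ux := gapprox_in h; move: h => [r1 [b1 [xr1 hb1 h1]]].
have hC : constr (rset (sval r) `&` rset (sval r1)).
  by apply: (constructibleI hA); apply: rset_constructible.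
have [r2 [xr2 s2]] := ratIn_nbhd hC (conj xr xr1) Ux.
rewrite -(subrK b1 a) -addrA; apply: (dvD (hx x)) => //.
apply: (@approx_ge (sval r2) (oval f r2)) => //.
  by apply: oval_corr hb1; apply: subset_trans s2 _ => y [].
by apply: oval_corr hb; apply: subset_trans s2 _ => y [].
Qed.

Lemma approx_gapprox f n a (r : ratIn U) :
  approx (oval f r) n a <-> forall x, rset (sval r) x -> gapprox f x n a.
Proof.
split=> [h x xr|h].
  by exists r, a; split=> //; rewrite subrr; apply: (dv0 (hx x)).
have [b hb] := approx_ex (oval f r) n; apply: (approx_change hb) => x xr.
by rewrite -opprB; apply: (dvN (hx x)); apply: gapprox_ge (h x xr) xr hb.
Qed.

Lemma gapprox_ex f x n : oset U x -> exists a, gapprox f x n a.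
Proof.
move=> Ux; have [r [xr _]] := ratIn_nbhd (constructibleT hA) I Ux.
have [a ha] := approx_ex (oval f r) n; exists a.
by have /approx_gapprox := ha; apply.
Qed.

Lemma gapprox_uniq f x n a b : gapprox f x n a -> gapprox f x n b -> ge x n%:Z (a - b).
Proof.
move=> ha [r [c [xr hc h]]]; rewrite -(subrK c a) -addrA.
apply: (dvD (hx x)); first exact: gapprox_ge ha xr hc.
by rewrite -opprB; apply: (dvN (hx x)).
Qed.

Lemma gapprox_change f x n a b : gapprox f x n a -> ge x n%:Z (a - b) -> gapprox f x n b.
Proof.
move=> [r [c [xr hc h]]] hab; exists r, c; split=> //.
by rewrite -(subrK a b) -addrA; apply: (dvD (hx x)) => //; rewrite -opprB; apply: (dvN (hx x)).
Qed.

Lemma gapprox_le f x m n a : (m <= n)%N -> gapprox f x n a -> gapprox f x m a.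
Proof.
move=> mn [r [c [xr hc h]]]; exists r, c; split=> //; first exact: approx_le hc.
by apply: (spge_le hA) h; lia.
Qed.

Lemma gapprox_open f x n a : gapprox f x n a ->
  exists C, [/\ constr C, C x & forall y, C y -> gapprox f y n a].
Proof.
move=> [r [b [xr hb h]]]; exists (rset (sval r) `&` [set y | ge y n%:Z (a - b)]); split=> //.
  apply: (constructibleI hA); first exact: rset_constructible.
  exact: constructible_ge.
by move=> y [yr yh]; exists r, b.
Qed.

Lemma osec_eq (f g : osec U) :
  (forall x n a, gapprox f x n a -> gapprox g x n a) -> f = g.
Proof.
move=> h; apply: sr_inj; apply: functional_extensionality_dep => r.
apply: (@approx_uniq (sval r) (oval f r) (oval g r)) => n.
have [a ha] := approx_ex (oval f r) n; exists a; first exact: ha.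
by apply/(approx_gapprox g) => x xr; apply: h; have /approx_gapprox := ha; apply.
Qed.

(** On each rational subset, compactness and [glue2] merge the local approximations of precision n
    into one element of A; the limit over n is the value of the section there. Uniqueness modulo
    pi^n makes these values compatible. *)
Lemma osec_make (N : X -> nat -> A -> Prop) :
    (forall x n, oset U x -> exists a C, [/\ constr C, C x & forall y, C y -> N y n a]) ->
    (forall x n a b, N x n a -> N x n b -> ge x n%:Z (a - b)) ->
    (forall x n a b, N x n a -> ge x n%:Z (a - b) -> N x n b) ->
    (forall x m n a, (m <= n)%N -> N x n a -> N x m a) ->
  exists f : osec U, forall x n a, oset U x -> N x n a -> gapprox f x n a.
Proof.
move=> Nex Nuniq Nchange Nle.
have Nr (r : ratIn U) n : exists a, forall x, rset (sval r) x -> N x n a.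
  (* Constructibility of C is carried along because [glue2] requires it at each union. *)
  pose P C := constr C /\ exists a, forall x, C x -> rset (sval r) x -> N x n a.
  suff [_ [a ha]] : P setT by exists a => x; apply: ha.
  apply: (constructible_compact hA).
  - by split; [exact: constructible0|exists 0].
  - move=> C D [hC [a ha]] [hD [b hb]]; split; first exact: constructibleU.
    have [c [h1 h2]] := glue2 hA a b n hC; exists c => x xCD xr.
    have [xC|xC] := EM (C x).
      by apply: Nchange (ha x xC xr) _; rewrite -opprB; apply: (dvN (hx x)); apply: h1.
    have xD : D x by case: xCD.
    by apply: Nchange (hb x xD xr) _; rewrite -opprB; apply: (dvN (hx x)); apply: h2.
  - move=> x; have hr := rset_constructible hA (sval r).
    have [xr|xr] := EM (rset (sval r) x).
      have [a [C [hC Cx h]]] := Nex x n (svalP r x xr).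
      by exists C; split=> //; split=> //; exists a => y /h.
    exists (~` rset (sval r)); split=> //; first exact: constructibleC.
    by split; [exact: constructibleC|exists 0 => y].
have /choice [a ha] : forall rn : ratIn U * nat, exists a,
    forall x, rset (sval rn.1) x -> N x rn.2 a by move=> [r n]; apply: Nr.
have hz (r : ratIn U) : exists z : rcompl (sval r), forall n, approx z n (a (r, n)).
  apply: approx_lim => n i ni x xr; apply: Nuniq (ha (r, n) x xr).
  exact: Nle ni (ha (r, i) x xr).
pose f : rfam U := fun r => projT1 (cid (hz r)).
have hf r n : approx (f r) n (a (r, n)) by rewrite /f; case: cid.
have cf : rcompat f.
  apply/rcompatE => r r' rr'; apply: (corrI rr') => n; exists (a (r, n)); first exact: hf.
  apply: (approx_change (hf r' n)) => x xr'.
  by apply: Nuniq (ha (r', n) x xr') (ha (r, n) x _); apply: rr'.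
exists (SubRing (@rcompat_subring A U) cf) => x n b Ux hb.
have [r [xr _]] := ratIn_nbhd (constructibleT hA) I Ux.
by exists r, (a (r, n)); split; [|exact: hf|exact: Nuniq hb (ha (r, n) x xr)].
Qed.

End Germs.

Lemma gapprox_res (U V : opens X) (VU : V `<=` U) (f : osec U) x n a :
  gapprox (ores VU f) x n a <-> oset V x /\ gapprox f x n a.
Proof.
split=> [h|[Vx h]].
  split; first exact: gapprox_in h.
  by move: h => [r [b [xr hb h]]]; exists (ratIn_widen VU r), b.
have [r [xr _]] := ratIn_nbhd (constructibleT hA) I Vx.
have [b hb] := approx_ex (oval (ores VU f) r) n; exists r, b; split=> //.
exact: (gapprox_ge h (r := ratIn_widen VU r)).
Qed.

Lemma structure_is_sheaf :
  is_sheaf (fun U V h => @pres X (structure_presheaf A) U V h :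
    structure_presheaf A U -> structure_presheaf A V).
Proof.
move=> U I V VU cov s hs.
pose N x n a := exists i, gapprox (s i : osec (V i)) x n a.
have hN : exists f : osec U, forall x n a, oset U x -> N x n a -> gapprox f x n a.
  apply: osec_make.
  - move=> x n /cov [i _ Vx]; have [a ha] := gapprox_ex (s i : osec (V i)) n Vx.
    have [C [hC Cx h]] := gapprox_open ha.
    by exists a, C; split=> // y /h hy; exists i.
  - move=> x n a b [i hi] [j hj].
    have Vix := gapprox_in hi; have Vjx := gapprox_in hj.
    have hij : oset (oinf (V i) (V j)) x by split.
    pose g : osec (oinf (V i) (V j)) :=
      @ores A (V i) (oinf (V i) (V j)) (@subIsetl _ (V i) (V j)) (s i).
    have ga : gapprox g x n a by apply/gapprox_res; split.
    have gb : gapprox g x n b.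
      by rewrite /g; have -> := hs i j; apply/gapprox_res; split.
    exact: gapprox_uniq ga gb.
  - by move=> x n a b [i hi] hab; exists i; apply: gapprox_change hab.
  - by move=> x m n a mn [i hi]; exists i; apply: gapprox_le mn _.
have [f hf] := hN; exists f; split.
  move=> i; apply/esym/osec_eq => x n a h; have Vx := gapprox_in h.
  apply/gapprox_res; split=> //; apply: hf; first exact: (VU i).
  by exists i.
move=> g hg; apply: osec_eq => x n a h; have /cov [i _ Vx] := gapprox_in h.
suff /gapprox_res [] : gapprox (ores (VU i) g) x n a by [].
have -> : ores (VU i) g = s i by apply: hg.
have e : s i = ores (VU i) f.
  apply: osec_eq => y m b h'; have Vy := gapprox_in h'.
  by apply/gapprox_res; split=> //; apply: hf; [exact: (VU i)|exists i].
by rewrite e; apply/gapprox_res; split.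
Qed.

End Approximation.

(** * Integral sections and the topology of sections *)

Lemma vle1_near (R : comPzRingType) (v : valuation R) (z y : R) :
  olt (v (z - y)) (Some (0 - 0)) -> ole (v y) (Some 0) -> ole (v z) (Some 0).
Proof.
rewrite subr0 /olt => h vy; rewrite -(subrK y z).
have [k|k] := vfunD v (z - y) y; last exact: ole_trans k vy.
apply: ole_trans k _; case: (v (z - y)) h => [g|] //= h.
by have [|] := ogle_total g 0.
Qed.

Section ExtendedValuation.
Variables (A : tatePair) (hA : residually_finite A) (r : ratDatum A) (x : spa A).
Hypothesis xr : rset r x.
Local Notation ge := (@spge A).
Local Notation hx := (spge_filtration hA).

Implicit Types z w : rcompl r.

(** The order at x, extended by continuity. The condition [m <= n] says that the precision is enough
    to decide whether the order is at least m. *)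
Definition ext_filtration (m : int) : set (rcompl r) :=
  [set z | exists (n : nat) (a : A), [/\ m <= n%:Z, approx z n a & ge x m a]].

Lemma ext_filtrationE m z (n : nat) a : m <= n%:Z -> approx z n a ->
  ext_filtration m z <-> ge x m a.
Proof.
move=> mn ha; split=> [[k [b [mk hb h]]]|h]; last by exists n, a.
rewrite -(subrK b a); apply: (dvD (hx x)) => //.
apply: (spge_le hA (n := (minn n k)%:Z)); first by lia.
by apply: (approx_ge hA (approx_le (geq_minl _ _) ha) (approx_le (geq_minr _ _) hb)).
Qed.

Lemma ext_approxM z w (n : nat) : exists a b,
  [/\ approx z n a, approx w n b & approx (z * w) n (a * b)].
Proof.
have [k hk] := approxM z w n; have [b hb] := approx_ex hA w (maxn k n).
have [l hl] := hk b (approx_le (leq_maxl _ _) hb).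
have [a ha] := approx_ex hA z (maxn l n).
exists a, b; split.
- exact: approx_le (leq_maxr _ _) ha.
- exact: approx_le (leq_maxr _ _) hb.
- exact: hl (approx_le (leq_maxl _ _) ha).
Qed.

Lemma ext_filtrationP : dv_filtration ext_filtration.
Proof.
split.
- move=> m; exists `|m|%N, 0; split; [lia| |exact: (dv0 (hx x))].
  by rewrite /approx rstr0 subrr; apply: compl_nbd0.
- move=> m z w hz hw; have mm : m <= `|m|%N by lia.
  have [a ha] := approx_ex hA z `|m|%N; have [b hb] := approx_ex hA w `|m|%N.
  apply/(ext_filtrationE mm (approxB ha hb)); apply: (dvB (hx x)).
    exact/(ext_filtrationE mm ha).
  exact/(ext_filtrationE mm hb).
- move=> m n z mn [k [a [nk ha h]]]; exists k, a; split=> //; first exact: le_trans nk.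
  exact: (spge_le hA) h.
- move=> z; have [a ha] := approx_ex hA z 0; have [m hm] := dv_ex (hx x) a.
  exists (Order.min m 0), 0%N, a; split=> //; first by rewrite ge_min lexx orbT.
  by apply: (spge_le hA) hm; rewrite ge_min lexx.
- move=> m n z w hz hw.
  have [a [b [ha hb hab]]] := ext_approxM z w (maxn (absz (m + n)) (maxn `|m|%N `|n|%N)).
  apply/(ext_filtrationE _ hab); first by lia.
  apply: (dvM (hx x)).
    by apply/(ext_filtrationE _ ha) => //; lia.
  by apply/(ext_filtrationE _ hb) => //; lia.
- move=> m n z w hz hw.
  have [a [b [ha hb hab]]] :=
    ext_approxM z w (maxn (absz (m + n + 1)) (maxn (absz (m + 1)) (absz (n + 1)))).
  move/(ext_filtrationE _ hab) => h; have {}h : ge x (m + n + 1) (a * b) by apply: h; lia.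
  apply: (dv_nM (hx x) _ _ h).
    by move=> k; apply: hz; apply/(ext_filtrationE _ ha) => //; lia.
  by move=> k; apply: hw; apply/(ext_filtrationE _ hb) => //; lia.
- exists 0%N, 1; split=> //; last exact: (dv1 (hx x)).
  by have := approx_rstr r 1 0; rewrite rstr1.
- have h1 : approx (1 : rcompl r) 1 1 by have := approx_rstr r 1 1; rewrite rstr1.
  by move/(ext_filtrationE _ h1) => h; apply: (dv_n1 (hx x)); apply: h.
Qed.

Definition ext_valuation : valuation (rcompl r) := dv_valuation ext_filtrationP.

Lemma ext_valuation_continuous : vcontinuous (compl_nbd (rtop r)) ext_valuation.
Proof.
apply: dv_vcontinuous => m; exists `|m|%N => z hz; exists `|m|%N, 0; split; first by lia.
  by rewrite /approx rstr0 subr0.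
exact: (dv0 (hx x)).
Qed.

Lemma ext_valuation_sprel :
  sprel x = fun a b => ole (ext_valuation (rstr r a)) (ext_valuation (rstr r b)).
Proof.
apply: functional_extensionality_dep => a; apply: functional_extensionality_dep => b.
have e m c : ext_filtration m (rstr r c) <-> ge x m c.
  by apply: (ext_filtrationE (n := `|m|%N)); [lia|exact: approx_rstr].
apply/propext; split=> [/(sprelE hA) h|/dv_vrel h].
  by apply/dv_vrel => m /e /h /e.
by apply/(sprelE hA) => m /e /h /e.
Qed.

End ExtendedValuation.

Section Topologies.
Variables (A : tatePair) (hA : residually_finite A).
Local Notation X := (spa A).
Local Notation ge := (@spge A).
Local Notation hx := (spge_filtration hA).
Local Notation constr := (@constructible A).

(** One direction evaluates f at the extension of x constructed above. In the other, v is any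
    continuous extension of x, and continuity lets f be replaced by an element of A, on which v is
    given by x. *)
Lemma oplusE (U : opens X) (f : osec U) :
  oplus f <-> forall x, oset U x -> gapprox f x 0 0.
Proof.
split=> [h x Ux|h r v x xr vc e].
  have [r [xr _]] := ratIn_nbhd hA (constructibleT hA) I Ux.
  have := h r _ x xr (@ext_valuation_continuous A hA (sval r) x xr) (ext_valuation_sprel hA xr).
  have -> : Some 0 = ext_valuation hA xr 1 by rewrite vfun1.
  move=> /dv_vrel /(_ 0) [|n [a [n0 ha h0]]]; first exact: (dv1 (ext_filtrationP hA xr)).
  exists r, a; split=> //; first exact: approx_le ha.
  by rewrite sub0r; apply: (dvN (hx x)).
have [n hn] := vc 1 1 0 0 (vfun1 v) (vfun1 v).
have [a ha] := approx_ex hA (oval f r) n.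
have := gapprox_ge hA (h x (svalP r x xr)) xr (approx_le (leq0n n) ha).
rewrite sub0r => /(dvN (hx x)); rewrite opprK => a0.
have va : ole (v (rstr (sval r) a)) (Some 0).
  have e1 : v (rstr (sval r) 1) = Some 0 by rewrite rstr1; exact: vfun1.
  have : sprel x a 1 by exact: a0.
  by rewrite e e1.
exact: vle1_near (hn _ ha) va.
Qed.

Lemma finite_cap (T : Type) (W : set (set T)) (k : nat) (Y : 'I_k -> set T) :
  W setT -> (forall M N, W M -> W N -> W (M `&` N)) ->
  (forall M N, W M -> M `<=` N -> W N) -> (forall j, W (Y j)) ->
  W [set f | forall j, Y j f].
Proof.
move=> WT WI WS WY.
have H (s : seq 'I_k) : W [set f | forall j, j \in s -> Y j f].
  elim: s => [|j s IH]; first by apply: WS WT _ => f _ j.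
  apply: (WS _ _ (WI _ _ (WY j) IH)) => f [h1 h2] i.
  by rewrite inE => /orP[/eqP->|/h2].
by apply: (WS _ _ (H (enum 'I_k))) => f h j; apply: h; rewrite mem_enum.
Qed.

Section Nbhs.
Variable U : opens X.

Lemma onbhs0_sub (M N : set (osec U)) : onbhs0 M -> M `<=` N -> onbhs0 N.
Proof. by move=> [k [r [n h]]] MN; exists k, r, n; apply: subset_trans MN. Qed.

Lemma onbhs0T : onbhs0 (setT : set (osec U)).
Proof. by exists 0%N, (fun j : 'I_0 => match notF (ltn_ord j) with end), (fun=> 0%N). Qed.

Lemma onbhs0I (M N : set (osec U)) : onbhs0 M -> onbhs0 N -> onbhs0 (M `&` N).
Proof.
move=> [k [r [n h]]] [k' [r' [n' h']]].
exists (k + k')%N, (fun j : 'I_(k + k') => match fintype.split j with inl a => r a | inr b => r' b end),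
  (fun j : 'I_(k + k') => match fintype.split j with inl a => n a | inr b => n' b end).
move=> f H; split; [apply: h|apply: h'] => j.
  by have := H (unsplit (inl j)); rewrite unsplitK.
by have := H (unsplit (inr j)); rewrite unsplitK.
Qed.

Lemma onbhs0_basic (r : ratIn U) n :
  onbhs0 [set f : osec U | compl_nbd (rtop (sval r)) n (oval f r)].
Proof. by exists 1%N, (fun=> r), (fun=> n) => f /(_ ord0). Qed.

End Nbhs.

Lemma onbhs0_res (U V : opens X) (VU : V `<=` U) (M : set (osec V)) :
  onbhs0 M -> onbhs0 [set f | M (ores VU f)].
Proof.
move=> [k [r [n h]]]; exists k, (fun j => ratIn_widen VU (r j)), n => f H.
by apply: h => j; apply: H.
Qed.

Section Covering.
Variables (U : opens X) (I : Type) (V : I -> opens X) (VU : forall i, V i `<=` U).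

Definition induced (N : set (osec U)) : Prop :=
  exists (k : nat) (i : 'I_k -> I) (M : forall j, set (osec (V (i j)))),
    (forall j, onbhs0 (M j)) /\ [set f | forall j, M j (ores (@VU (i j)) f)] `<=` N.

Lemma inducedT : induced setT.
Proof.
exists 0%N, (fun j : 'I_0 => match notF (ltn_ord j) with end),
  (fun j : 'I_0 => match notF (ltn_ord j) with end).
by split=> // j; case: (notF (ltn_ord j)).
Qed.

Lemma induced_sub M N : induced M -> M `<=` N -> induced N.
Proof.
by move=> [k [i [W [h1 h2]]]] MN; exists k, i, W; split=> //; apply: subset_trans MN.
Qed.

Lemma inducedI M N : induced M -> induced N -> induced (M `&` N).
Proof.
move=> [k [i [W [h1 h2]]]] [k' [i' [W' [h1' h2']]]].
pose p (j : 'I_(k + k')) : {i : I & set (osec (V i))} :=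
  match fintype.split j with inl a => existT _ (i a) (W a) | inr b => existT _ (i' b) (W' b) end.
exists (k + k')%N, (fun j => projT1 (p j)), (fun j => projT2 (p j)); split.
  by move=> j; rewrite /p; case: (fintype.split j).
move=> f H; split; [apply: h2|apply: h2'] => j.
  by have := H (unsplit (inl j)); rewrite /p unsplitK.
by have := H (unsplit (inr j)); rewrite /p unsplitK.
Qed.

Lemma induced1 i (M : set (osec (V i))) : onbhs0 M -> induced [set f | M (ores (@VU i) f)].
Proof. by move=> hM; exists 1%N, (fun=> i), (fun=> M); split=> // f /(_ ord0). Qed.

Hypothesis cov : U `<=` \bigcup_i (V i : set X).

(** Smallness over a rational subset is a condition at each of its points; by compactness it follows
    from smallness over finitely many rational subsets, each contained in a member of the
    covering. *)
Lemma induced_basic (r : ratIn U) n :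
  induced [set f : osec U | compl_nbd (rtop (sval r)) n (oval f r)].
Proof.
pose P C := induced [set f : osec U | forall x, C x -> rset (sval r) x -> gapprox f x n 0].
suff : P setT.
  move=> /induced_sub; apply=> f h /=.
  suff : approx (oval f r) n 0 by rewrite /approx rstr0 subr0.
  by apply/(approx_gapprox hA) => x; apply: h.
apply: (constructible_compact hA).
- by apply: induced_sub inducedT _ => f _ x.
- move=> C D hC hD; apply: induced_sub (inducedI hC hD) _ => f [h1 h2] x [xC|xD] xr.
    exact: h1.
  exact: h2.
- move=> x; have hr := rset_constructible hA (sval r).
  have [xr|xr] := EM (rset (sval r) x); last first.
    exists (~` rset (sval r)); split=> //; first exact: constructibleC.
    by apply: induced_sub inducedT _ => f _ y.
  have [i _ Vx] := cov (svalP r x xr).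
  have [r' [xr' _]] := ratIn_nbhd hA (constructibleT hA) Logic.I Vx.
  exists (rset (sval r')); split=> //; first exact: rset_constructible.
  apply: induced_sub (induced1 (onbhs0_basic r' n)) _ => f /= h y yr' _.
  have /(approx_gapprox hA) /(_ y yr') : approx (oval (ores (@VU i) f) r') n 0.
    by rewrite /approx rstr0 subr0.
  by move/(gapprox_res hA) => [].
Qed.

Lemma onbhs0_induced N : onbhs0 N <-> induced N.
Proof.
split=> [[k [r [n h]]]|[k [i [M [h1 h2]]]]].
  apply: induced_sub _ h.
  apply: (finite_cap (W := induced)); [exact: inducedT|exact: inducedI|exact: induced_sub|].
  by move=> j; apply: induced_basic.
apply: onbhs0_sub h2.
apply: (finite_cap (W := @onbhs0 A U)); [exact: onbhs0T|exact: onbhs0I|exact: onbhs0_sub|].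
by move=> j; apply: onbhs0_res.
Qed.

End Covering.

Theorem structure_presheaf_sheaf : is_topological_sheaf (structure_presheaf A).
Proof.
split; first exact: (structure_is_sheaf hA).
by move=> U I V VU cov N; apply: (onbhs0_induced VU cov).
Qed.

Theorem structure_presheaf_plus_sheaf : is_topological_sheaf (structure_presheaf_plus A).
Proof.
split.
  move=> U I V VU cov s hs.
  have [|f [hf uf]] := structure_is_sheaf hA VU cov (s := fun i => sr_val (s i)).
    by move=> i j; have := congr1 (@sr_val _ _ _) (hs i j).
  have fp : oplus (f : osec U).
    apply/oplusE => x Ux; have [i _ Vx] := cov x Ux.
    have /oplusE /(_ x Vx) := sr_prop (s i).
    have <- : ores (VU i) f = sr_val (s i) by exact: hf i.
    by move/(gapprox_res hA) => [].
  exists (SubRing (@oplus_subring A U) fp); split.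
    by move=> i; apply: sr_inj; exact: hf i.
  move=> g hg; apply: sr_inj; apply: uf => i.
  exact: (congr1 (@sr_val _ _ _) (hg i)).
move=> U I V VU cov N; split=> [[M [hM MN]]|[k [i [M [h1 h2]]]]].
  have /(onbhs0_induced VU cov) [k [i [W [k1 k2]]]] := hM.
  exists k, i, (fun j => [set g : oplus_sec (V (i j)) | W j (sr_val g)]); split.
    by move=> j; exists (W j); split=> //; exact: k1.
  by move=> f h; apply: MN; apply: k2 => j; apply: h.
have hM j : exists W : set (osec (V (i j))), onbhs0 W /\
    [set f : oplus_sec (V (i j)) | W (sr_val f)] `<=` M j by exact: h1.
pose W j := projT1 (cid (hM j)).
have hW j : onbhs0 (W j) /\ [set f : oplus_sec (V (i j)) | W j (sr_val f)] `<=` M j.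
  by rewrite /W; case: cid.
exists [set f : osec U | forall j, W j (ores (VU (i j)) f)]; split.
  by apply/(onbhs0_induced VU cov); exists k, i, W; split=> // j; case: (hW j).
move=> f h; apply: h2 => j; have [_] := hW j; apply; exact: h.
Qed.

End Topologies.

(** * Cech complexes of clopen coverings *)

Section ModSheafTheory.
Variables (X : topologicalType) (O : ringPresheaf X) (F : modSheaf O).

Lemma mres_irr (U V : opens X) (h k : V `<=` U) (s : F U) : mres h s = mres k s.
Proof. by rewrite (Prop_irrelevance h k). Qed.

Lemma mres0 (U V : opens X) (h : V `<=` U) : mres h (0 : F U) = 0.
Proof. by apply: (@addrI _ (mres h (0 : F U))); rewrite -mres_add !addr0. Qed.

Lemma mres_sum (U V : opens X) (h : V `<=` U) (n : nat) (s : 'I_n -> F U) :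
  mres h (\sum_i s i) = \sum_i mres h (s i).
Proof. by apply: (big_morph _ (mres_add h)); apply: mres0. Qed.

Lemma mres_sign (U V : opens X) (h : V `<=` U) j (s : F U) :
  mres h ((-1) ^+ j *: s) = (-1) ^+ j *: mres h s.
Proof. by rewrite mres_scale rmorphXn rmorphN1. Qed.

Lemma mres_sep (U : opens X) (I : Type) (V : I -> opens X) (VU : forall i, V i `<=` U)
    (s t : F U) : U `<=` \bigcup_i (V i : set X) ->
  (forall i, mres (VU i) s = mres (VU i) t) -> s = t.
Proof.
move=> cov e.
have [|u [_ hu]] := mres_sheaf VU cov (s := fun i => mres (VU i) t).
  move=> i j; have h : oinf (V i) (V j) `<=` U by move=> x [/VU].
  by rewrite -(mres_comp (VU i) _ h) -(mres_comp (VU j) _ h).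
by rewrite -(hu s) // -(hu t).
Qed.

(** The empty family covers an empty open, so the two sections agree vacuously on its members. *)
Lemma mres_empty (U : opens X) (s t : F U) : (forall x, ~ oset U x) -> s = t.
Proof.
move=> U0; pose V (i : False) : opens X := match i with end.
have VU (i : False) : V i `<=` U by case: i.
by apply: (mres_sep (VU := VU)) => [x /U0 []|[]].
Qed.

End ModSheafTheory.

Section CechClopen.
Variables (X : topologicalType) (O : ringPresheaf X) (F : modSheaf O).
Variables (U : opens X) (n : nat) (V : 'I_n -> opens X).
Hypothesis VU : forall i, V i `<=` U.
Hypothesis cov : U `<=` \bigcup_i (V i : set X).
Hypothesis Vclosed : forall i, open (~` (V i : set X)).

Definition disj (j : 'I_n) : opens X :=
  oinf (V j) (ocap (fun l => if (l < j)%N then Opens (Vclosed l) else Opens openT)).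

Lemma disjE j x : oset (disj j) x <-> oset (V j) x /\ forall l : 'I_n, (l < j)%N -> ~ oset (V l) x.
Proof.
split=> [[h1 h2]|[h1 h2]]; split=> //.
  by move=> l lj; have := h2 l Logic.I; rewrite /= lj.
by move=> l _ /=; case: ifP => //; apply: h2.
Qed.

Lemma disj_sub j x : oset (disj j) x -> oset (V j) x.
Proof. by case/disjE. Qed.

Lemma disj_uniq j l x : oset (disj j) x -> oset (disj l) x -> j = l.
Proof.
move=> /disjE [h1 h2] /disjE [h3 h4]; apply: val_inj => /=.
by have [/h4|/h2|] := ltngtP (val j) (val l).
Qed.

Lemma disj_cover x : oset U x -> exists j, oset (disj j) x.
Proof.
move=> /cov [i _ Vi].
have hP : exists m, `[< exists j : 'I_n, val j = m /\ oset (V j) x >].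
  by exists i; apply/asboolP; exists i.
have [m /asboolP [j [jm Vj]] hm] := ex_minnP hP.
exists j; apply/disjE; split=> // l lj Vl.
have : (m <= l)%N by apply: hm; apply/asboolP; exists l.
by rewrite -jm leqNgt lj.
Qed.

Definition cpiece k (i : 'I_k -> 'I_n) (j : 'I_n) : opens X := oinf (cinter V i) (disj j).

Lemma cpiece_sub k (i : 'I_k -> 'I_n) j : cpiece i j `<=` cinter V i.
Proof. by move=> x []. Qed.

Lemma cpiece_cover k (i : 'I_k.+1 -> 'I_n) : cinter V i `<=` \bigcup_j (cpiece i j : set X).
Proof.
move=> x xi; have [j hj] := disj_cover (VU (xi ord0 Logic.I)).
by exists j.
Qed.

(** Prepending a fixed index contracts the Cech complex wherever the corresponding member is the
    whole space, as V j is over [disj j]. *)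
Definition ext k (j : 'I_n) (i : 'I_k -> 'I_n) : 'I_k.+1 -> 'I_n :=
  fun l => if unlift ord0 l is Some l' then i l' else j.

Lemma ext_lift0 k j (i : 'I_k -> 'I_n) : ext j i \o lift ord0 = i.
Proof. by apply: functional_extensionality_dep => l; rewrite /ext /= liftK. Qed.

Lemma ext_lift k j (i : 'I_k.+1 -> 'I_n) (l : 'I_k.+1) :
  ext j i \o lift (lift ord0 l) = ext j (i \o lift l).
Proof.
apply: functional_extensionality_dep => m; rewrite /ext /=.
have [m' ->|->] := unliftP ord0 m.
  have -> : lift (lift ord0 l) (lift ord0 m') = lift ord0 (lift l m').
    by apply: val_inj; rewrite /= /bump /= !add1n ltnS addnS.
  by rewrite liftK.
have -> : lift (lift ord0 l) (ord0 : 'I_k.+1) = ord0 by apply: val_inj.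
by rewrite unlift_none.
Qed.

Lemma cpiece_ext k (i : 'I_k -> 'I_n) j : cpiece i j `<=` cinter V (ext j i).
Proof.
move=> x [xi xj] l _; rewrite /= /ext; case: unliftP => [m _|_]; first exact: (xi m).
exact: disj_sub.
Qed.

Lemma cochain_eq k (c : cochain F V k) i i' (W : opens X)
    (h : W `<=` cinter V i) (h' : W `<=` cinter V i') :
  i = i' -> mres h (c i) = mres h' (c i').
Proof. by move=> e; subst i'; apply: mres_irr. Qed.

Lemma mres_cdiff k (c : cochain F V k) i (W : opens X) (h : W `<=` cinter V i)
    (h' : forall l, W `<=` cinter V (i \o lift l)) :
  mres h (cdiff c i) = \sum_(l < k.+2) (-1) ^+ l *: mres (h' l) (c (i \o lift l)).
Proof.
rewrite /cdiff mres_sum; apply: eq_bigr => l _; rewrite mres_sign.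
by rewrite -(mres_comp (@cinter_lift X n V k i l) h (h' l)).
Qed.

(* A cocycle restricted to [disj j] is recovered from its values on the
   indices that start with [j]. *)
Lemma cocycle_ext k (c : cochain F V k) : (forall i, cdiff c i = 0) ->
  forall j (i : 'I_k.+1 -> 'I_n) (W : opens X) (h : W `<=` cinter V i)
    (h' : forall l, W `<=` cinter V (ext j i \o lift (lift ord0 l))), W `<=` disj j ->
  mres h (c i) =
    \sum_(l < k.+1) (-1) ^+ l *: mres (h' l) (c (ext j i \o lift (lift ord0 l))).
Proof.
move=> hc j i W h h' Wj.
have hW : W `<=` cinter V (ext j i).
  by move=> x xW; apply: cpiece_ext; split; [apply: h|apply: Wj].
have h0 : W `<=` cinter V (ext j i \o lift ord0) by rewrite ext_lift0.
have hl l : W `<=` cinter V (ext j i \o lift l).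
  by move=> x /hW xi m _; apply: xi.
have := congr1 (mres hW) (hc (ext j i)); rewrite mres0 (mres_cdiff c _ hl).
rewrite big_ord_recl expr0 scale1r (cochain_eq c _ h (ext_lift0 j i)) => /eqP.
rewrite addr_eq0 => /eqP ->; rewrite -sumrN; apply: eq_bigr => l _.
by rewrite /= /bump add1n exprS mulN1r scaleNr opprK (mres_irr _ (h' l)).
Qed.

(** This is the contracting homotopy, defined piece by piece. It glues with no condition on overlaps
    since the pieces are disjoint. *)
Lemma cobound_ex k (c : cochain F V k.+1) : exists b : cochain F V k,
  forall i j, mres (@cpiece_sub _ i j) (b i) = mres (@cpiece_ext _ i j) (c (ext j i)).
Proof.
suff H i : exists s : F (cinter V i),
    forall j, mres (@cpiece_sub _ i j) s = mres (@cpiece_ext _ i j) (c (ext j i)).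
  exists (fun i => projT1 (cid (H i))) => i j; by case: cid.
have [|s [hs _]] := mres_sheaf (@cpiece_sub _ i) (@cpiece_cover _ i)
    (s := fun j => mres (@cpiece_ext _ i j) (c (ext j i))).
  move=> j l; have [jl|jl] := eqVneq j l.
    by subst l; apply: mres_irr.
  apply: mres_empty => x [[_ xj] [_ xl]]; move/eqP: jl; apply.
  exact: disj_uniq xj xl.
by exists s.
Qed.

Theorem cech_acyclic_clopen : cech_acyclic F VU.
Proof.
split.
- move=> s hs; apply: (mres_sep (VU := fun i : 'I_1 -> 'I_n => @cinter_sub X U n V VU i)).
    move=> x /cov [i _ Vi]; exists (fun=> i) => // l _; exact: Vi.
  by move=> i; rewrite mres0; apply: hs.
(* Degree 0 is apart: the intersection of the empty family is the whole space and not U, so the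
   values of c at the one-term tuples are glued over U itself. *)
- move=> c hc.
  have WU j : disj j `<=` U by move=> x /disj_sub /VU.
  have Wc j : disj j `<=` cinter V (ext j (fun l : 'I_0 => j)).
    by move=> x xj l _; rewrite /= /ext; case: unliftP => [m|] _; apply: disj_sub.
  have covW : U `<=` \bigcup_j (disj j : set X).
    by move=> x /disj_cover [j hj]; exists j.
  have [|s [hs _]] := mres_sheaf WU covW (s := fun j => mres (Wc j) (c _)).
    move=> j l; have [jl|jl] := eqVneq j l; first by subst l; apply: mres_irr.
    apply: mres_empty => x [xj xl]; move/eqP: jl; apply; exact: disj_uniq xj xl.
  exists s => i; apply: (mres_sep (VU := @cpiece_sub _ i)); first exact: cpiece_cover.
  move=> j; rewrite /caugment.
  have hW : cpiece i j `<=` disj j by move=> x [].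
  have hU : cpiece i j `<=` U by move=> x [_ /disj_sub /VU].
  have h' l : cpiece i j `<=` cinter V (ext j i \o lift (lift ord0 l)).
    by move=> x /cpiece_ext xi m _; apply: xi.
  rewrite (cocycle_ext hc (@cpiece_sub _ i j) h' hW) big_ord1 expr0 scale1r.
  rewrite -(mres_comp (@cinter_sub X U n V VU i) (@cpiece_sub _ i j) hU).
  have hW' : cpiece i j `<=` cinter V (ext j (fun l : 'I_0 => j)).
    by move=> x /hW /Wc.
  rewrite (mres_comp (WU j) hW hU) hs -(mres_comp (Wc j) hW hW').
  apply: cochain_eq; rewrite ext_lift; congr ext.
  by apply: functional_extensionality_dep => -[].
- move=> k c hc; have [b hb] := cobound_ex c; exists b => i.
  apply: (mres_sep (VU := @cpiece_sub _ i)); first exact: cpiece_cover.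
  move=> j.
  have hW : cpiece i j `<=` disj j by move=> x [].
  have h' l : cpiece i j `<=` cinter V (ext j i \o lift (lift ord0 l)).
    by move=> x /cpiece_ext xi m _; apply: xi.
  have h'' l : cpiece i j `<=` cinter V (i \o lift l).
    by move=> x [xi _] m _; apply: xi.
  rewrite (cocycle_ext hc (@cpiece_sub _ i j) h' hW) (mres_cdiff b _ h'').
  apply: eq_bigr => l _; congr (_ *: _).
  have hp : cpiece i j `<=` cpiece (i \o lift l) j.
    by move=> x xi; split; [apply: h''|apply: hW].
  have hq : cpiece i j `<=` cinter V (ext j (i \o lift l)).
    by move=> x /hp /cpiece_ext.
  rewrite (mres_comp (@cpiece_sub _ (i \o lift l) j) hp (h'' l)) hb.
  by rewrite -(mres_comp (@cpiece_ext _ (i \o lift l) j) hp hq); apply: cochain_eq (ext_lift j i l).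
Qed.

End CechClopen.

Section RationalCoverings.
Variables (A : tatePair) (hA : residually_finite A).

Lemma rational_clopen (V : opens (spa A)) : is_rational V -> open (~` (V : set (spa A))).
Proof.
move=> [r <-]; apply: (constructible_open hA); apply: (constructibleC hA).
exact: rset_constructible.
Qed.

Theorem coherent_acyclic_rational (O : ringPresheaf (spa A)) : coherent_acyclic O.
Proof.
move=> F _ U n V VU _ hV cov.
by apply: cech_acyclic_clopen cov _ => i; apply: rational_clopen.
Qed.

End RationalCoverings.

(** * Orders in the fraction field, and residual finiteness of the weight pair *)

Section FractionOrder.
Variables (O : idomainType) (w : O) (hw : uniformizer w).
Local Notation K := {fraction O}.
Local Notation "x %:F" := (@FracField.tofrac O x).
Local Notation vge := (vge w).
Local Notation wF := (wF_neq0 hw).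

Lemma vge_zero m : vge 0 m.
Proof. by exists 0; rewrite rmorph0 mul0r. Qed.

Lemma vgeB m x y : vge x m -> vge y m -> vge (x - y) m.
Proof. by move=> [c ->] [d ->]; exists (c - d); rewrite rmorphB mulrBl. Qed.

Lemma vge_le m n x : m <= n -> vge x n -> vge x m.
Proof.
move=> mn [c ->]; exists (c * w ^+ `|n - m|%N); rewrite rmorphM rmorphXn -mulrA.
by rewrite exprnP -expfzDr ?wF //; congr (_ * _ ^ _); lia.
Qed.

Lemma vgeM m n x y : vge x m -> vge y n -> vge (x * y) (m + n).
Proof.
move=> [c ->] [d ->]; exists (c * d); rewrite rmorphM expfzDr ?wF //.
by rewrite mulrACA.
Qed.

Lemma vge_unit u n m : is_unit u -> vge (u%:F * w%:F ^ n) m -> m <= n.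
Proof.
move=> [u' uu'] [c e]; rewrite leNgt; apply/negP => nm.
have [_ hu _] := hw; apply: hu.
have [k em] : exists k : nat, m = k.+1%:Z + n by exists (absz (m - n)).-1; lia.
exists (u' * (c * w ^+ k)); apply/eqP; rewrite -tofrac_eq rmorph1.
have e2 : u%:F = (c * w ^+ k.+1)%:F.
  apply: (@mulIf _ (w%:F ^ n)); first by rewrite expfz_neq0 ?wF.
  by rewrite e em expfzDr ?wF // mulrA -exprnP rmorphM rmorphXn.
rewrite (_ : w * _ = u' * (c * w ^+ k.+1)); last by rewrite exprS; ring.
by rewrite rmorphM /= -e2 -rmorphM mulrC uu' rmorph1.
Qed.

Lemma frac_form (a : O) k : a%:F * (w%:F)^-1 ^+ k = 0 \/
  exists u n, is_unit u /\ a%:F * (w%:F)^-1 ^+ k = u%:F * w%:F ^ n.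
Proof.
have [->|a0] := eqVneq a 0; first by left; rewrite rmorph0 mul0r.
have [_ _ /(_ a a0) [u [n [hu ->]]]] := hw; right; exists u, (n%:Z - k%:Z); split=> //.
by rewrite rmorphM rmorphXn expfzDr ?wF // mulrA exprVn exprnN exprnP.
Qed.

Lemma vge_nM m n x y (a b : O) k l : x = a%:F * (w%:F)^-1 ^+ k -> y = b%:F * (w%:F)^-1 ^+ l ->
  ~ vge x (m + 1) -> ~ vge y (n + 1) -> ~ vge (x * y) (m + n + 1).
Proof.
move=> -> ->.
have [->|[u [i [hu ->]]]] := frac_form a k; first by case; apply: vge_zero.
have [->|[u' [j [hu' ->]]]] := frac_form b l; first by move=> _ []; apply: vge_zero.
have vu (c : O) h g : g <= h -> vge (c%:F * w%:F ^ h) g.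
  by move=> gh; apply: (vge_le gh); exists c.
move=> h1 h2.
have im : i <= m by rewrite leNgt; apply/negP => mi; apply: h1; apply: vu; lia.
have jn : j <= n by rewrite leNgt; apply/negP => nj; apply: h2; apply: vu; lia.
rewrite mulrACA -rmorphM -expfzDr ?wF // => /vge_unit h3.
suff : m + n + 1 <= i + j by lia.
apply: h3; have [v uv] := hu; have [v' uv'] := hu'.
by exists (v * v'); rewrite mulrACA uv uv' mulr1.
Qed.

End FractionOrder.

Section WeightPairResiduallyFinite.
Variables (O : idomainType) (w : O) (hw : uniformizer w).
Variables (Lam : comPzRingType) (wL : Lam) (S : Type) (ev : {rmorphism Lam -> (S -> O)}).
Hypothesis ev_w : forall s, ev wL s = w.
Variable (M : nat).
Hypotheses (M0 : (0 < M)%N) (hM : forall c : O, exists d, c ^+ M.+1 - c = w * d).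
Local Notation "x %:F" := (@FracField.tofrac O x).
Local Notation W := (weightPair hw ev_w).
Local Notation evK := (evK hw ev_w).

Lemma evK_frac_ex s f : exists a k, evK s f = a%:F * (w%:F)^-1 ^+ k.
Proof. by elim/fracP: f => a k; exists (ev a s), k; rewrite evK_frac. Qed.

Definition ev_filtration (s : S) (m : int) : set W := [set f | vge w (evK s f) m].

Lemma ev_filtrationP s : dv_filtration (ev_filtration s).
Proof.
split; rewrite /ev_filtration /=.
- by move=> m; rewrite rmorph0; apply: vge_zero.
- by move=> m f g hf hg; rewrite rmorphB; apply: vgeB.
- by move=> m n f; apply: (vge_le hw).
- move=> f; have [a [k ->]] := evK_frac_ex s f; exists (- k%:Z); exists a.
  by rewrite exprVn exprnN.
- by move=> m n f g hf hg; rewrite rmorphM; apply: (vgeM hw).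
- move=> m n f g; rewrite rmorphM; have [a [k ea]] := evK_frac_ex s f.
  have [b [l eb]] := evK_frac_ex s g; exact: (vge_nM hw ea eb).
- by rewrite rmorph1; exists 1; rewrite rmorph1 mul1r expr0z.
- rewrite rmorph1 => h; suff : (1 : int) <= 0 by [].
  apply: (vge_unit hw (u := 1)); first by exists 1; rewrite mul1r.
  by rewrite rmorph1 mul1r expr0z.
Qed.

Lemma evK_pi s : evK s (tpi W) = w%:F.
Proof. by rewrite /= evK_frac ev_w expr0 mulr1. Qed.

Lemma evK_pi_inv s : evK s (tpi_inv W) = (w%:F)^-1.
Proof.
apply: (@mulfI _ w%:F); first exact: wF_neq0.
have e : evK s (tpi W) * evK s (tpi_inv W) = 1.
  rewrite -rmorphM; transitivity (evK s 1); last exact: rmorph1.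
  by congr (evK s _); exact: (tpi_invE W).
by rewrite -{1}(evK_pi s) e divff // wF_neq0.
Qed.

(** [tdef] is defined by integrality at each element of S, so the congruence for M is checked in O,
    one value at a time. For the separation, each evaluation defines a point of the spectrum. *)
Lemma weightPair_residually_finite : residually_finite W.
Proof.
split=> //.
- exists M => // f hf; exists (tpi_inv W * (f ^+ M.+1 - f)); last first.
    by rewrite mulrA (tpi_invE W) mul1r.
  move=> s; have [c ec] := (vge0 _ _).1 (hf s); have [d ed] := hM c.
  have e : evK s (tpi_inv W * (f ^+ M.+1 - f)) =
      evK s (tpi_inv W) * (evK s f ^+ M.+1 - evK s f).
    by rewrite -rmorphXn -rmorphB -rmorphM.
  apply/vge0; exists d; rewrite e evK_pi_inv ec.
  rewrite -rmorphXn -rmorphB ed rmorphM mulrA mulVf ?mul1r //.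
  exact: wF_neq0.
- move=> f h s.
  have Gd g : tdef g -> ev_filtration s 0 g by move=> hg; apply: hg.
  have G1 : ev_filtration s 1 (tpi W).
    by exists 1; rewrite evK_pi rmorph1 mul1r expr1z.
  have GV : ev_filtration s (-1) (tpi_inv W).
    by exists 1; rewrite evK_pi_inv rmorph1 mul1r.
  have := h (dv_point (ev_filtrationP s) Gd Gd G1 GV).
  by rewrite -(tpiz0 W) => /dv_pointE.
Qed.

End WeightPairResiduallyFinite.

(** * Finiteness of the residue field *)

Definition finite_index (R : zmodType) (I : set R) : Prop :=
  exists l : seq R, forall x, exists2 y, y \in l & I (x - y).

Section FiniteIndex.

(** Were the index infinite, a greedy choice would give a sequence of pairwise incongruent
    elements. *)
Lemma finite_index_pigeonhole (R : zmodType) (I : set R) :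
    (forall x, I x -> I (- x)) ->
    (forall f : nat -> R, exists i j, (i < j)%N /\ I (f i - f j)) ->
  finite_index I.
Proof.
move=> IN h; apply: contrapT => hI.
have ex (l : seq R) : exists x, forall y, y \in l -> ~ I (x - y).
  apply: contrapT => k; apply: hI; exists l => x; apply: contrapT => k'.
  by apply: k; exists x => y yl hy; apply: k'; exists y.
have [nxt hn] := choice ex.
pose L := fix L n : seq R := if n is m.+1 then nxt (L m) :: L m else [::].
have LL m n : (m < n)%N -> nxt (L m) \in L n.
  elim: n => // n IH; rewrite ltnS leq_eqVlt => /orP[/eqP->|/IH h1].
    by rewrite inE eqxx.
  by rewrite inE h1 orbT.
have [i [j [ij hij]]] := h (fun n => nxt (L n)).
apply: (hn (L j) (nxt (L i)) (LL i j ij)).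
by rewrite -opprB; apply: IN.
Qed.

(** The bound is the number of representatives; being independent of f, it yields a single exponent
    for all units in [uniform_fermat]. *)
Lemma finite_index_collision (R : zmodType) (I : set R) : finite_index I ->
    (forall x y, I x -> I y -> I (x - y)) ->
  exists B, forall f : nat -> R, exists i j, [/\ (i < j)%N, (j <= B)%N & I (f i - f j)].
Proof.
move=> [l hl] IB; have /choice [r hr] : forall x, exists y, y \in l /\ I (x - y).
  by move=> x; have [y h1 h2] := hl x; exists y.
exists (size l) => f; pose g (i : 'I_(size l).+1) := r (f i).
have : ~~ injectiveb g.
  apply/negP => /injectiveP ginj.
  have : (size (codom g) <= size l)%N.
    apply: uniq_leq_size; first by rewrite map_inj_uniq ?enum_uniq.
    by move=> _ /codomP [i ->]; have [] := hr (f i).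
  by rewrite size_codom card_ord ltnn.
move=> /injectivePn [i [j ij e]].
have key (a b : nat) : r (f a) = r (f b) -> I (f a - f b).
  move=> eab; have [_ ha] := hr (f a); have [_ hb] := hr (f b).
  rewrite (_ : _ - _ = (f a - r (f a)) - (f b - r (f b))); first exact: IB.
  by rewrite eab opprB addrA subrK.
have [lij|lji|/val_inj eij] := ltngtP (val i) (val j).
- by exists i, j; split=> //; [rewrite -ltnS|apply: key].
- by exists j, i; split=> //; [rewrite -ltnS|apply: key].
- by rewrite eij eqxx in ij.
Qed.

(* The residue ring being finite, the powers of each unit collide. *)
Lemma uniform_fermat (O : comPzRingType) (w : O) : uniformizer w ->
    finite_index [set x | exists y, x = w * y] ->
  exists2 M, (0 < M)%N & forall c : O, exists d, c ^+ M.+1 - c = w * d.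
Proof.
move=> [_ _ hu] hfin.
have [|B hB] := finite_index_collision hfin.
  by move=> _ _ [x ->] [y ->]; exists (x - y); rewrite mulrBr.
(* Two powers of a unit collide at exponents whose difference depends on the unit but is at most B,
   hence divides the factorial. *)
exists B`! => [|c]; first exact: fact_gt0.
have [->|c0] := eqVneq c 0.
  by exists 0; rewrite expr0n /= mulr0 subrr.
have [u [n [[u' uu'] ec]]] := hu c c0.
case: n ec => [|n] ec; last first.
  exists (u * w ^+ n * (c ^+ B`! - 1)).
  have ec' : c = w * (u * w ^+ n) by rewrite ec exprS mulrCA.
  by rewrite mulrA -ec' exprS mulrBr mulr1.
have [i [j [ij jB [y hy]]]] := hB (fun i => c ^+ i).
have cu k : c ^+ k * u' ^+ k = 1.
  by rewrite -exprMn ec expr0 mulr1 uu' expr1n.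
have h1 : c ^+ (j - i) - 1 = w * (- (u' ^+ i * y)).
  have ej : c ^+ j = c ^+ i * c ^+ (j - i) by rewrite -exprD subnKC // ltnW.
  by rewrite mulrN mulrCA -hy ej mulrBr mulrA [u' ^+ i * _]mulrC cu mul1r opprB.
have [e ->] : exists e, B`! = ((j - i) * e)%N.
  have /dvdnP [e ->] : (j - i %| B`!)%N.
    by apply: dvdn_fact; rewrite subn_gt0 ij (leq_trans (leq_subr _ _) jB).
  by exists e; rewrite mulnC.
exists (c * (- (u' ^+ i * y)) * \sum_(k < e) (c ^+ (j - i)) ^+ k).
rewrite exprS exprM (_ : _ - c = c * ((c ^+ (j - i)) ^+ e - 1)); last by ring.
by rewrite subrX1 h1; ring.
Qed.

(** An element of the closure of P is not a unit, for otherwise 1 would lie in P; so w divides it.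
    Hence representatives modulo P also represent the classes modulo w, by density. *)
Lemma complete_finite_index (R : comPzRingType) (P : set R) (w : primeCompl P) :
    is_prime_ideal P -> finite_index P -> uniformizer w ->
  finite_index [set x | exists y, x = w * y].
Proof.
move=> [[P0 PB PM] P1 _] [l hl] [_ _ hu].
have pw1 x : ideal_pow P 1 x <-> P x.
  split=> [h|h]; last by apply: idgen_sub; exists x, 1; split=> //; rewrite mulr1.
  by apply: h => // _ [y [z [hy _ ->]]]; rewrite mulrC; apply: PM.
have small z : compl_nbd (adic_top P) 1 z -> exists y, z = w * y.
  move=> hz; have [z0|z0] := eqVneq z 0; first by exists 0; rewrite mulr0.
  have [u [n [[u' uu'] ez]]] := hu z z0.
  case: n ez => [|n] ez; last by exists (u * w ^+ n); rewrite ez exprS mulrCA.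
  have eu : z = u by rewrite ez expr0 mulr1.
  case: P1; apply/pw1; apply/(@compl_nbd_in _ (adic_top P) 1 1).
  rewrite rmorph1 -uu' -eu.
  have [v ev] := complP u'; have [v' ev'] := complP z; move: hz.
  rewrite ev ev' => /compl_nbdE [N hN]; rewrite -clsM; apply/compl_nbdE.
  by exists N => i /hN /pw1 h; apply/pw1; rewrite /= mulrC; apply: PM.
exists [seq compl_in (adic_top P) y | y <- l] => z.
have [v ->] := complP z; have [N hN] := compl_approx 1 v.
have [y yl hy] := hl (v N); exists (compl_in (adic_top P) y); first exact: map_f.
apply: small; apply: compl_nbd_trans (hN N (leqnn N)) _.
by rewrite -rmorphB; apply/compl_nbd_in/pw1.
Qed.

Lemma finite_index_unramified (R : comPzRingType) (O : idomainType) (w : R)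
    (iota : {rmorphism R -> O}) : finite_unramified iota w ->
  finite_index [set x | exists y, x = w * y] ->
  finite_index [set x | exists y, x = iota w * y].
Proof.
move=> [_ [m [e he]] _] [l hl].
pose T := {ffun 'I_m -> 'I_(size l)}.
pose F (t : T) := \sum_i iota (nth 0 l (t i)) * e i.
exists [seq F t | t <- enum {: T}] => x.
have [a ->] := he x.
have /choice [b hb] : forall i, exists k : 'I_(size l), exists y, a i - nth 0 l k = w * y.
  move=> i; have [y yl [z hz]] := hl (a i).
  have hk : (index y l < size l)%N by rewrite index_mem.
  by exists (Ordinal hk), z; rewrite /= nth_index.
have /choice [c hc] := hb.
exists (\sum_i iota (nth 0 l (b i)) * e i).
  rewrite (_ : \sum_i _ = F [ffun i => b i]); first by apply: map_f; rewrite mem_enum.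
  by apply: eq_bigr => i _; rewrite ffunE.
exists (\sum_i iota (c i) * e i); rewrite -sumrB mulr_sumr; apply: eq_bigr => i _.
by rewrite -mulrBl -rmorphB hc rmorphM mulrA.
Qed.

End FiniteIndex.

(** * Counting by degree in the function field *)

Lemma frac_denominator (R : idomainType) (x : {fraction R}) : exists d n : R,
  d != 0 /\ FracField.tofrac d * x = FracField.tofrac n.
Proof.
have [y ->] : exists y : {ratio R}, x = \pi_({fraction R})%qT y.
  by exists (repr x); rewrite reprK.
exists (\d_y), (\n_y); split; first exact: denom_ratioP.
rewrite -[_ * _]/(FracField.mul _ _) !piE; apply/eqmodP => /=.
rewrite FracField.equivfE /FracField.mulf !numden_Ratio ?oner_neq0 ?mulf_neq0 ?denom_ratioP //.
- by rewrite mul1r mulr1.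
- exact: oner_neq0.
- exact: oner_neq0.
Qed.

Section BoundedDegree.
Variables (K : fieldType) (L : fieldExtType {fraction {poly K}}).
Local Notation n := (\dim {: L}).
Local Notation b := (vbasis {: L}).
Local Notation "x %:F" := (@FracField.tofrac {poly K} x).

(** Elements whose coordinates are polynomials of degree less than k. Over F_p such an element is
    given by an n by k matrix of coefficients, which is what gets counted. *)
Definition bounded (k : nat) : set L := [set x | exists g : 'I_n -> {poly K},
  (forall i, (size (g i) <= k)%N) /\ x = \sum_i (g i)%:F *: b`_i].

Lemma bounded_le k l x : (k <= l)%N -> bounded k x -> bounded l x.
Proof. by move=> kl [g [h ->]]; exists g; split=> // i; apply: leq_trans kl. Qed.

Lemma bounded0 k : bounded k 0.
Proof.
exists (fun=> 0); split=> [i|]; first by rewrite size_poly0.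
by rewrite big1 // => i _; rewrite tofrac0 scale0r.
Qed.

Lemma boundedD k x y : bounded k x -> bounded k y -> bounded k (x + y).
Proof.
move=> [g [hg ->]] [h [hh ->]]; exists (fun i => g i + h i); split=> [i|].
  by apply: leq_trans (size_polyD _ _) _; rewrite geq_max hg hh.
by rewrite -big_split; apply: eq_bigr => i _; rewrite tofracD scalerDl.
Qed.

Lemma bounded_sum k (I : finType) (x : I -> L) :
  (forall i, bounded k (x i)) -> bounded k (\sum_i x i).
Proof. by move=> h; apply: big_ind => // [|y z]; [exact: bounded0|exact: boundedD]. Qed.

Lemma boundedZ k (d : {poly K}) x : bounded k x -> bounded (size d + k) (d%:F *: x).
Proof.
move=> [g [hg ->]]; exists (fun i => d * g i); split=> [i|].
  by apply: leq_trans (size_polyMleq _ _) _; apply: leq_trans (leq_pred _) _; rewrite leq_add2l.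
by rewrite scaler_sumr; apply: eq_bigr => i _; rewrite scalerA tofracM.
Qed.

Lemma common_denominator (I : finType) (x : I -> L) : exists (d : {poly K}) k,
  d != 0 /\ forall i, bounded k (d%:F *: x i).
Proof.
have H (y : {fraction {poly K}}) := frac_denominator y.
pose J := (I * 'I_n)%type.
pose c (j : J) := coord b j.2 (x j.1).
pose dd (j : J) := projT1 (cid (H (c j))).
have hd j : dd j != 0 /\ exists m, (dd j)%:F * c j = m%:F.
  by rewrite /dd; case: cid => d /= [m [d0 e]]; split=> //; exists m.
pose nn j := projT1 (cid (hd j).2).
have hn j : (dd j)%:F * c j = (nn j)%:F by rewrite /nn; case: cid.
pose d := \prod_j dd j.
have d0 : d != 0 by rewrite prodf_seq_neq0; apply/allP => j _; case: (hd j).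
pose e j := (\prod_(k | k != j) dd k) * nn j.
have he j : d%:F * c j = (e j)%:F.
  by rewrite /d (bigD1 j) //= mulrC tofracM tofracM mulrCA mulrA -hn; ring.
exists d, (\max_j size (e j)); split=> // i; exists (fun l => e (i, l)); split=> [l|].
  exact: (leq_bigmax (F := fun j => size (e j)) (i, l)).
rewrite {1}(coord_vbasis (memvf (x i))) scaler_sumr; apply: eq_bigr => l _.
by rewrite scalerA -he.
Qed.

Lemma bounded_mul (a : L) : exists (d : {poly K}) k, d != 0 /\
  forall l x, bounded l x -> bounded (l + k) (d%:F *: (a * x)) /\ bounded (l + k) (d%:F *: x).
Proof.
have [d [k [d0 h]]] := common_denominator (fun i : 'I_n => a * b`_i).
exists d, (size d + k)%N; split=> // l x hx; split; last first.
  by apply: bounded_le (boundedZ d hx); lia.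
have [g [hg ->]] := hx; rewrite mulr_sumr scaler_sumr; apply: bounded_sum => i.
rewrite -scalerAr scalerA mulrC -scalerA; apply: bounded_le (boundedZ (g i) (h i)).
by have := hg i; lia.
Qed.

(** Each factor a costs one denominator d and c degrees. The second bound of [bounded_mul] pads
    lower powers of a, so that all j up to N share the denominator [d ^+ N] and a bound linear in
    N. *)
Lemma bounded_monomial (a : L) : exists (d : {poly K}) c, d != 0 /\ forall N j l x, (j <= N)%N ->
  bounded l x -> bounded (l + c * N) ((d%:F ^+ N) *: (a ^+ j * x)).
Proof.
have [d [c [d0 h]]] := bounded_mul a; exists d, c; split=> //.
elim=> [|N IH] j l x; first by rewrite leqn0 => /eqP-> hx; rewrite !expr0 scale1r mul1r muln0 addn0.
case: j => [_ hx|j]; last rewrite ltnS => jN hx.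
  have [_ h2] := h l x hx.
  have := IH 0%N _ _ (leq0n N) h2; rewrite expr0 !mul1r scalerA -exprSr.
  by rewrite mulnS addnA.
have [h2 _] := h l x hx.
have := IH j _ _ jN h2; rewrite -scalerAr scalerA -exprSr mulrA -exprSr.
by rewrite mulnS addnA.
Qed.

End BoundedDegree.

Lemma expn_unbounded (q K : nat) : (0 < q)%N -> exists N, (q ^ N * K < q.+1 ^ N)%N.
Proof.
(* Bernoulli's inequality for [(1 + 1/q)^N], cleared of denominators. *)
move=> q0; have H N : (q ^ N * (q + N) <= q.+1 ^ N * q)%N.
  elim: N => [|N IH]; first by rewrite !expn0 addn0.
  rewrite !expnS; apply: (@leq_trans (q ^ N * (q.+1 * (q + N)))%N).
    by rewrite -mulnA mulnCA leq_mul2l; apply/orP; right; nia.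
  by rewrite mulnCA -mulnA leq_mul2l IH orbT.
exists (q * K)%N; rewrite -(ltn_pmul2r q0); apply: leq_trans (H _).
rewrite -mulnA ltn_mul2l expn_gt0 q0 /=; nia.
Qed.

Lemma sub_of_digits (R : comPzRingType) (x y a s t : R) :
  x + a * s = y + a * t -> x - y = (t - s) * a.
Proof.
move=> e; have -> : x = y + a * t - a * s by rewrite -e addrK.
by ring.
Qed.

Section ResidueField.
Variables (p : nat) (p_prime : prime p).
Variables (L : fieldExtType {fraction {poly 'F_p}}) (inf : place L).
Local Notation R := (regularRing inf).
Variables (P : set R) (P_prime : is_prime_ideal P).

(** Uniqueness of a-adic expansions: modulo P the first digit is determined, and a can then be
    cancelled because L is a field. *)
Lemma adic_digits_inj (a : R) (f : nat -> R) : P a -> a <> 0 ->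
    (forall i j, P (f i - f j) -> i = j) ->
  forall N (u v : 'I_N -> nat),
    \sum_(j < N) a ^+ j * f (u j) = \sum_(j < N) a ^+ j * f (v j) -> u =1 v.
Proof.
move=> Pa a0 hf; have [[P0 PB PM] _ _] := P_prime.
have aI (x y : R) : a * x = a * y -> x = y.
  move=> e; apply: sr_inj; apply: (@mulfI _ (sr_val a)).
    by apply/eqP => e0; apply: a0; apply: sr_inj.
  exact: (congr1 (@sr_val _ _ _) e).
elim=> [|N IH] u v; first by move=> _ [].
have hS (w : 'I_N.+1 -> nat) : \sum_(j < N.+1) a ^+ j * f (w j) =
    f (w ord0) + a * \sum_(j < N) a ^+ j * f (w (lift ord0 j)).
  rewrite big_ord_recl expr0 mul1r mulr_sumr; congr (_ + _).
  by apply: eq_bigr => j _; rewrite exprS mulrA.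
rewrite !hS => e.
have e0 : u ord0 = v ord0.
  by apply: hf; rewrite (sub_of_digits e); apply: PM.
move: e; rewrite e0 => /addrI /aI /IH e i.
by have [j ->|->] := unliftP ord0 i; [exact: e|].
Qed.

(* If the [f i] are pairwise incongruent modulo [P], the sums of the
   [a ^ j * f (t j)] for [j < N] are pairwise distinct; up to a fixed denominator
   they have coordinates of degree [O(c * N)], with [c] independent of the number
   of the [f i], which bounds this number. *)
Lemma regular_finite_index (a : R) : P a -> a <> 0 -> finite_index P.
Proof.
move=> Pa a0; have [[P0 PB PM] _ _] := P_prime.
have PN x : P x -> P (- x) by move=> h; rewrite -sub0r; apply: PB.
apply: finite_index_pigeonhole => // f; apply: contrapT => nf.
have hf i j : P (f i - f j) -> i = j.
  move=> h; have [ij|ji|//] := ltngtP i j; case: nf.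
    by exists i, j.
  by exists j, i; split=> //; rewrite -opprB; apply: PN.
have [d [c [d0 hd]]] := bounded_monomial (sr_val a).
set n := (\dim {: L}) in hd.
(* With [q + 1] digits there are [(q + 1) ^ N] sums, but only [p ^ (n * (k + c * N)) = q ^ N * p ^
   (n * k)] coefficient matrices, fewer for large N. The constant c depends on a alone, so q is
   fixed before the digits are taken; only k depends on them. *)
pose q := (p ^ (n * c))%N.
have [e [k [e0 he]]] := common_denominator (fun i : 'I_q.+1 => sr_val (f i)).
have q0 : (0 < q)%N by rewrite expn_gt0 prime_gt0.
have [N hN] := expn_unbounded (p ^ (n * k)) q0.
pose y (t : {ffun 'I_N -> 'I_q.+1}) : R := \sum_(j < N) a ^+ j * f (t j).
have yinj t t' : y t = y t' -> t = t'.
  move=> /(adic_digits_inj Pa a0 hf) h; apply/ffunP => j; apply: val_inj; exact: h.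
pose m := (k + c * N)%N.
have y_bounded t : bounded m ((FracField.tofrac d ^+ N) *: (FracField.tofrac e *: sr_val (y t))).
  rewrite rmorph_sum !scaler_sumr; apply: bounded_sum => j.
  rewrite rmorphM rmorphXn scalerAr; apply: hd; first exact: ltnW.
  exact: he.
have [g hg] := choice y_bounded.
have hg1 t := (hg t).1; have hg2 t := (hg t).2.
pose G t : 'M['F_p]_(n, m) := \matrix_(i, l) (g t i)`_l.
have Ginj : injective G.
  move=> t t' eG; apply: yinj; apply: sr_inj.
  have eg i : g t i = g t' i.
    apply/polyP => l; have [lm|ml] := ltnP l m.
      by have /matrixP /(_ i (Ordinal lm)) := eG; rewrite !mxE.
    by rewrite !nth_default //; apply: leq_trans ml; apply: hg1.
  apply: (@scalerI _ _ (FracField.tofrac e)); first by rewrite tofrac_eq0.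
  apply: (@scalerI _ _ (FracField.tofrac d ^+ N)).
    by rewrite expf_neq0 // tofrac_eq0.
  by rewrite !hg2; apply: eq_bigr => i _; rewrite eg.
have := leq_card G Ginj; rewrite card_ffun !card_ord card_mx card_Fp // leqNgt.
suff -> : (p ^ (n * m) = q ^ N * p ^ (n * k))%N by rewrite hN.
by rewrite /m mulnDr addnC expnD mulnA expnM.
Qed.

End ResidueField.

Theorem mainTheorem12 (p : nat) (p_prime : prime p)
    (L : fieldExtType {fraction {poly 'F_p}}) (inf : place L)
    (P : set (regularRing inf)) (P_prime : is_prime_ideal P)
    (P_neq0 : exists a : regularRing inf, P a /\ a <> 0)
    (w : primeCompl P) (w_unif : uniformizer w)
    (O : idomainType) (iota : {rmorphism primeCompl P -> O})
    (O_unram : finite_unramified iota w)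
    (ev : {rmorphism iwasawa w iota -> (padicInt p -> O)}) (ev_weight : is_weight_map ev) :
  let W := weightSpace O_unram ev_weight in
  (is_topological_sheaf (structure_presheaf W) /\
   is_topological_sheaf (structure_presheaf_plus W)) /\
  (coherent_acyclic (structure_presheaf W) /\
   coherent_acyclic (structure_presheaf_plus W)).
Proof.
move=> W; have [a [Pa a0]] := P_neq0.
have hP := regular_finite_index p_prime P_prime Pa a0.
have hO := finite_index_unramified O_unram (complete_finite_index P_prime hP w_unif).
have [M M0 hM] := uniform_fermat (unramified_uniformizer O_unram) hO.
have hW : residually_finite W := weightPair_residually_finite _ _ M0 hM.
split; split.
- exact: structure_presheaf_sheaf.
- exact: structure_presheaf_plus_sheaf.
- exact: coherent_acyclic_rational.
- exact: coherent_acyclic_rational.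
Qed.
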